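(* Let $g$ be a bounded function on $\mathbb{R}$ such that the Fourier transform of $g$ (in the sense of tempered distributions) has compact support and is not a measure. Let $f$ be the function on $\mathbb{R}^3$ defined by $$f(x_1,x_2,x_3)=g(x_1-x_3)\sin x_2,$$ and let $\mathfrak{D}_2f$ be the function on $\mathbb{R}^3\times\mathbb{R}^3$ defined by $$(\mathfrak{D}_2f)(x,y)=\frac{f(y_1,x_2,x_3)-f(y_1,y_2,x_3)}{x_2-y_2},\qquad x=(x_1,x_2,x_3),\ y=(y_1,y_2,y_3).$$ Then $\mathfrak{D}_2f\notin\mathfrak{M}_{\mathbb{R}^3,\mathbb{R}^3}$.
   Context: A bounded function with compactly supported Fourier transform is identified with its smooth representative. For $x_2=y_2$ the divided difference $(\mathfrak{D}_2f)(x,y)$ is understood as the partial derivative of $f$ in the second variable at $(y_1,x_2,x_3)$. ''Measure'' means a complex Borel measure. Schur multipliers: let $E_1,E_2$ be spectral measures on $\mathcal{X}_1,\mathcal{X}_2$ acting on Hilbert space and let $\Phi$ be a bounded measurable function on $\mathcal{X}_1\times\mathcal{X}_2$. For $T$ in the Hilbert--Schmidt class $\boldsymbol{S}_2$, the double operator integral $\iint\Phi(s_1,s_2)\,dE_1(s_1)T\,dE_2(s_2)\in\boldsymbol{S}_2$ is defined as the integral of $\Phi$ against the spectral measure on the Hilbert space $\boldsymbol{S}_2$ determined by $\mathcal{E}(\Delta_1\times\Delta_2)T=E_1(\Delta_1)TE_2(\Delta_2)$. $\Phi$ is a Schur multiplier with respect to $E_1,E_2$ if the transformer $T\mapsto\iint\Phi\,dE_1T\,dE_2$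 maps the trace class $\boldsymbol{S}_1$ into itself. For Borel subsets $\mathcal{X}_1,\mathcal{X}_2$ of Euclidean spaces, $\mathfrak{M}_{\mathcal{X}_1,\mathcal{X}_2}$ is the space of (bounded) Borel functions on $\mathcal{X}_1\times\mathcal{X}_2$ that are Schur multipliers with respect to all Borel spectral measures $E_1$ on $\mathcal{X}_1$ and $E_2$ on $\mathcal{X}_2$. *)

(* Defs.v *)
From HB Require Import structures.
From mathcomp Require Import all_boot all_order all_algebra.
From mathcomp Require Import complex.
From mathcomp Require Import all_classical all_reals all_analysis.
From mathcomp.analysis.showcase Require Import summability.

Set Implicit Arguments.
Unset Strict Implicit.
Unset Printing Implicit Defensive.

Import Order.TTheory GRing.Theory Num.Theory.
Import numFieldNormedType.Exports.

Local Open Scope classical_set_scope.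
Local Open Scope ring_scope.
Local Open Scope complex_scope.

Section ComplexFunctions.
Context {R : realType}.

Definition cbounded (T : Type) (F : T -> R[i]) : Prop :=
  exists M : R, forall x, `|F x| <= M%:C.

Definition cmeasurable d (T : measurableType d) (F : T -> R[i]) : Prop :=
  measurable_fun setT (fun x => complex.Re (F x)) /\
  measurable_fun setT (fun x => complex.Im (F x)).

Definition cintegral d (T : measurableType d) (mu : {measure set T -> \bar R})
    (F : T -> R[i]) : R[i] :=
  Rintegral mu setT (fun x => complex.Re (F x)) +i*
  Rintegral mu setT (fun x => complex.Im (F x)).

Definition cderive (F : R -> R[i]) (t : R) : R[i] :=
  derive1 (fun x => complex.Re (F x)) t +i*
  derive1 (fun x => complex.Im (F x)) t.

Definition smooth (a : R -> R) : Prop :=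
  forall (n : nat) (x : R), derivable (derive1n n a) x 1.

Definition csmooth (F : R -> R[i]) : Prop :=
  smooth (fun x => complex.Re (F x)) /\ smooth (fun x => complex.Im (F x)).

End ComplexFunctions.

Section TemperedDistributions.
Context {R : realType}.

Definition rapidly_decreasing (a : R -> R) : Prop :=
  forall n k : nat, exists M : R, forall x, `|x ^+ k * derive1n n a x| <= M.

Definition schwartz (phi : R -> R[i]) : Prop :=
  [/\ csmooth phi,
      rapidly_decreasing (fun x => complex.Re (phi x)) &
      rapidly_decreasing (fun x => complex.Im (phi x))].

Definition fsupport (phi : R -> R[i]) : set R :=
  closure [set x | phi x != 0].

Definition test_function (U : set R) (phi : R -> R[i]) : Prop :=
  [/\ csmooth phi, compact (fsupport phi) & fsupport phi `<=` U].

(* The integral of phi(x) exp(- i x xi) dx; the normalization is immaterial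
   below. *)
Definition fourier (phi : R -> R[i]) (xi : R) : R[i] :=
  cintegral (@lebesgue_measure R)
    (fun x => phi x * (cos (x * xi) +i* - sin (x * xi))).

Definition fourier_distribution (g : R -> R[i]) (phi : R -> R[i]) : R[i] :=
  cintegral (@lebesgue_measure R) (fun x => g x * fourier phi x).

Definition distribution_support (u : (R -> R[i]) -> R[i]) : set R :=
  [set x | forall U : set R, open U -> U x ->
     exists2 phi, test_function U phi & u phi <> 0].

Definition charge_integral d (T : measurableType d)
    (nu : {charge set T -> \bar R}) (a : T -> R) : R :=
  let hP := cid (Hahn_decomposition nu) in
  let hN := cid (projT2 hP) in
  Rintegral (jordan_pos (projT2 hN)) setT a -
  Rintegral (jordan_neg (projT2 hN)) setT a.

(* A complex measure is nu1 + i nu2 with nu1, nu2 real charges (a charge takes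
   finite values). *)
Definition complex_measure_integral d (T : measurableType d)
    (nu1 nu2 : {charge set T -> \bar R}) (F : T -> R[i]) : R[i] :=
  let a x := complex.Re (F x) in
  let b x := complex.Im (F x) in
  (charge_integral nu1 a - charge_integral nu2 b) +i*
  (charge_integral nu1 b + charge_integral nu2 a).

Definition is_complex_measure (u : (R -> R[i]) -> R[i]) : Prop :=
  exists nu1 nu2 : {charge set R -> \bar R},
    forall phi, schwartz phi -> u phi = complex_measure_integral nu1 nu2 phi.

End TemperedDistributions.

Record hilbertSpace (R : realType) := HilbertSpace {
  hilbert_sort :> completeNormedModType R[i] ;
  hdot : {dot hilbert_sort for Num.conj} ;
  hdot_norm : forall x : hilbert_sort, `|x| ^+ 2 = hdot x x
}.

Section SpectralMeasures.
Context {R : realType}.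

(* Below, a Hilbert space is given as a subspace D of a complex vector space V,
   with an inner product ip on D: either D = V is a hilbertSpace, or D is the
   Hilbert-Schmidt class inside the space of all maps H -> H. *)

Definition ip_norm (V : lmodType R[i]) (ip : V -> V -> R[i]) (v : V) : R :=
  Num.sqrt (complex.Re (ip v v)).

(* Orthogonal projections, countably additive in the strong operator topology;
   E set0 = 0 and E (A `&` B) = E A \o E B are consequences. *)
Record spectral_measure d (X : measurableType d) (V : lmodType R[i])
    (D : set V) (ip : V -> V -> R[i]) (E : set X -> V -> V) : Prop := {
  spectral_stable : forall A, measurable A -> forall v, D v -> D (E A v) ;
  spectral_linear : forall A, measurable A -> forall (c : R[i]) u v,
    D u -> D v -> E A (c *: u + v) = c *: E A u + E A v ;
  spectral_idempotent : forall A, measurable A -> forall v,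
    D v -> E A (E A v) = E A v ;
  spectral_selfadjoint : forall A, measurable A -> forall u v,
    D u -> D v -> ip (E A u) v = ip u (E A v) ;
  spectral_total : forall v, D v -> E setT v = v ;
  spectral_sigma_additive : forall F : nat -> set X,
    (forall n, measurable (F n)) -> trivIset setT F -> forall v, D v ->
    ip_norm ip (E (\bigcup_n F n) v - \sum_(0 <= k < n) E (F k) v)
      @[n --> \oo] --> (0 : R)
}.

(* The list s of pairs (c, A) stands for the simple function sum of c 1_A. *)
Definition simple_fun (X : Type) (s : seq (R[i] * set X)) (x : X) : R[i] :=
  \sum_(p <- s) p.1 * \1_(p.2) x.

(* w is the value at v of the integral of Phi against E, as the limit of the
   integrals of simple functions converging uniformly to the bounded Phi. *)
Definition spectral_integral d (X : measurableType d) (V : lmodType R[i])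
    (D : set V) (ip : V -> V -> R[i]) (E : set X -> V -> V)
    (Phi : X -> R[i]) (v w : V) : Prop :=
  D w /\
  exists s : nat -> seq (R[i] * set X),
    [/\ forall n p, p \in s n -> measurable p.2,
        forall eps : R, 0 < eps ->
          \forall n \near \oo, forall x,
            `|Phi x - simple_fun (s n) x| <= eps%:C &
        ip_norm ip (w - \sum_(p <- s n) p.1 *: E p.2 v)
          @[n --> \oo] --> (0 : R)].

End SpectralMeasures.

Section SchattenClasses.
Context {R : realType} (H : hilbertSpace R).

Definition bounded_operator (T : H -> H) : Prop := linear T /\ continuous T.

Definition orthonormal_basis (I : choiceType) (e : I -> H) : Prop :=
  (forall i j, hdot H (e i) (e j) = (i == j)%:R) /\
  (forall x, (forall i, hdot H x (e i) = 0) -> x = 0).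

(* P is positive and P P = T^* T, i.e. P = |T|. *)
Definition is_modulus (T P : H -> H) : Prop :=
  [/\ bounded_operator P, forall x, 0 <= hdot H (P x) x &
      forall x y, hdot H (P (P x)) y = hdot H (T x) (T y)].

(* The notions below do not depend on the orthonormal basis e. *)
Variables (I : choiceType) (e : I -> H).

Definition trace_class (T : H -> H) : Prop :=
  bounded_operator T /\
  exists2 P, is_modulus T P &
    (\esum_(i in [set: I]) (complex.Re (hdot H (P (e i)) (e i)))%:E < +oo)%E.

Definition hilbert_schmidt (T : H -> H) : Prop :=
  bounded_operator T /\
  (\esum_(i in [set: I]) (complex.Re (hdot H (T (e i)) (T (e i))))%:E < +oo)%E.

Definition hs_dot (T S : H -> H) : R[i] :=
  summability.sum (fun i => hdot H (T (e i)) (S (e i)) : R[i]^o).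

End SchattenClasses.

Section SchurMultipliers.
Context {R : realType}.
Context d1 d2 (X1 : measurableType d1) (X2 : measurableType d2).

(* E is the spectral measure on the Hilbert-Schmidt class determined by E1, E2
   (such an E exists and is unique). *)
Definition is_double_spectral_measure (H : hilbertSpace R)
    (I : choiceType) (e : I -> H)
    (E1 : set X1 -> H -> H) (E2 : set X2 -> H -> H)
    (E : set (X1 * X2) -> (H -> H) -> (H -> H)) : Prop :=
  spectral_measure (hilbert_schmidt e) (hs_dot e) E /\
  forall A1 A2, measurable A1 -> measurable A2 ->
    forall T, hilbert_schmidt e T -> E (A1 `*` A2) T = E1 A1 \o T \o E2 A2.

(* A is the double operator integral of Phi against E1, T, E2. *)
Definition is_double_operator_integral (H : hilbertSpace R)
    (I : choiceType) (e : I -> H)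
    (E1 : set X1 -> H -> H) (E2 : set X2 -> H -> H)
    (Phi : X1 * X2 -> R[i]) (T A : H -> H) : Prop :=
  exists2 E, is_double_spectral_measure e E1 E2 E &
    spectral_integral (hilbert_schmidt e) (hs_dot e) E Phi T A.

Definition schur_multiplier (H : hilbertSpace R)
    (I : choiceType) (e : I -> H)
    (E1 : set X1 -> H -> H) (E2 : set X2 -> H -> H)
    (Phi : X1 * X2 -> R[i]) : Prop :=
  forall T A, trace_class e T ->
    is_double_operator_integral e E1 E2 Phi T A -> trace_class e A.

Definition schur_multipliers : set (X1 * X2 -> R[i]) :=
  [set Phi | [/\ cmeasurable Phi, cbounded Phi &
    forall (H : hilbertSpace R) (I : choiceType) (e : I -> H),
      orthonormal_basis e ->
    forall (E1 : set X1 -> H -> H) (E2 : set X2 -> H -> H),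
      spectral_measure setT (hdot H) E1 ->
      spectral_measure setT (hdot H) E2 ->
      schur_multiplier e E1 E2 Phi]].

End SchurMultipliers.

Arguments schur_multipliers R {d1 d2} X1 X2.

Definition divided_difference2 {R : realType} (f : R * R * R -> R[i])
    (p : (R * R * R) * (R * R * R)) : R[i] :=
  let: ((x1, x2, x3), (y1, y2, y3)) := p in
  if x2 == y2 then cderive (fun t => f (y1, t, x3)) x2
  else (f (y1, x2, x3) - f (y1, y2, x3)) / (x2 - y2)%:C.

(* Main.v *)
(* At the points [x = (r, 0, r)] and [y = (s, 0, s)] the function [D_2 f] equals [h (s - r)], so
   it suffices to show that if [(r, s) |-> h (s - r)] comes from a Schur multiplier then the
   Fourier transform of [h] is a measure.  Fix [N] and a step [delta], and let the two spectral
   measures act diagonally on [C^N], with atoms at the sample points of the grid [i delta].  The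
   rank one matrix with entries [1 / N] has trace norm [1]; the double operator integral
   multiplies it entrywise by [h ((i - j) delta)] (up to the sign of the argument).  Its diagonal
   coefficients in an orthonormal basis of characters of [Z/N] are Fejer means of the Fourier
   transform of [h], whose absolute values therefore have a sum bounded by the trace norm.  The
   bound is uniform in [N], [delta] and the phase: otherwise a weighted direct sum of such blocks
   would be a trace class operator on [l^2] whose transform is not of trace class.

   Summing over all phases, the Fejer means with [delta = 1 / n] and [N = n ^ 2], cut to the period
   [[-pi n, pi n]], have bounded [L^1] norms, and as distributions they converge to the Fourier
   transform of [h] (Riemann sums).  A Helly selection argument along an ultrafilter turns the
   positive and negative parts of these densities into Stieltjes measures. *)

Require Import Defs.
From HB Require Import structures.
From mathcomp Require Import all_boot all_order all_algebra.
From mathcomp Require Import complex.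
From mathcomp Require Import all_classical all_reals all_analysis.
From mathcomp.analysis.showcase Require Import summability.
From mathcomp Require Import measurable_realfun finmap.
From mathcomp Require Import ring lra zify.

Set Implicit Arguments.
Unset Strict Implicit.
Unset Printing Implicit Defensive.

Import Order.TTheory GRing.Theory Num.Theory.
Import numFieldNormedType.Exports.
Import Normc.

Local Open Scope classical_set_scope.
Local Open Scope ring_scope.
Local Open Scope complex_scope.

(* Being a Schur multiplier is a qualitative property, so no constant is available to start from;
   the direct sum is a gliding hump that extracts one. With [delta = 1 / n] and [N = n ^ 2] both the
   period [2 pi n] of the Fejer means and the length [N delta = n] of the sampled stretch of [h]
   tend to infinity. The frequencies in one instance of the bound are [2 pi / n] apart and fill a
   period, so integrating the phase over one gap turns the discrete bound into an [L^1] bound. The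
   cut is forced because a periodic density is not integrable on the line. It is harmless because
   the density is of order [n], hence of order [|x|] outside the period, while [x a(x)] is
   integrable for a Schwartz function [a]. Mass may escape to infinity in the limit, which test
   functions vanishing there do not see. Charges are real, so the real part of the distribution is
   represented first; its imaginary part is the real part for [- i h]. *)
#[local] Existing Instance totally_filter.

(** * Unordered sums *)

Section NetSums.
Context {R : realType} {I : choiceType}.
Implicit Types (f g : I -> R) (A B : {fset I}).

Definition abs_summable f : Prop :=
  exists M : R, forall A : {fset I}, \sum_(i <- A) `|f i| <= M.

(** A limit over finite subsets, for an index type that need not be countable. A divergent net
    yields a default value, hence the [abs_summable] hypotheses below. *)
Definition rsum f : R := lim ((fun A : {fset I} => \sum_(i <- A) f i) @ totally).

Lemma ler_sum_fset f A B : (forall i, 0 <= f i) -> (A `<=` B)%fset ->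
  \sum_(i <- A) f i <= \sum_(i <- B) f i.
Proof.
move=> f0 AB; rewrite -(fsetIidPr AB).
rewrite (big_fsetID _ (fun i => i \in A) B) /=.
rewrite (_ : [fset x in B | x \in A]%fset = (B `&` A)%fset); last first.
  by apply/fsetP => x; rewrite !inE.
by rewrite lerDl sumr_ge0.
Qed.

Lemma totally_ge A : \forall B \near (@totally I), (A `<=` B)%fset.
Proof. by exists A. Qed.

Lemma cvg_rsum_ge0 f : (forall i, 0 <= f i) -> abs_summable f ->
  (fun A : {fset I} => \sum_(i <- A) f i) @ totally -->
  sup [set \sum_(i <- A) f i | A in [set: {fset I}]].
Proof.
move=> f0 [M fM]; set S := [set _ | _ in _].
have hS : has_sup S.
  split; first by exists (\sum_(i <- fset0) f i); exists fset0.
  exists M => _ [A _ <-]; apply: le_trans (fM A).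
  by apply: ler_sum => i _; exact: ler_norm.
apply/cvgrPdist_le => e e0.
have [_ [A _ <-] eA] := sup_adherent e0 hS.
apply: filterS (totally_ge A) => B AB.
have BS : \sum_(i <- B) f i <= sup S by apply: ub_le_sup; [case: hS|exists B].
rewrite ger0_norm ?subr_ge0// lerBlDl -lerBlDr (le_trans (ltW eA))//.
exact: ler_sum_fset.
Qed.

(** Both [f + |f|] and [|f|] are nonnegative, so their nets converge to suprema, and [f] is the
    difference. *)
Lemma is_cvg_rsum f : abs_summable f ->
  cvg ((fun A : {fset I} => \sum_(i <- A) f i) @ totally).
Proof.
move=> [M fM].
have -> : (fun A : {fset I} => \sum_(i <- A) f i) =
   (fun A : {fset I} => \sum_(i <- A) (f i + `|f i|)) \-
   (fun A : {fset I} => \sum_(i <- A) `|f i|).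
  by apply/funext => A /=; rewrite big_split /= addrK.
apply: is_cvgB.
  apply/cvg_ex; eexists; apply: cvg_rsum_ge0.
    by move=> i; rewrite -lerBlDr sub0r lerNl -normrN ler_norm.
  exists (M + M) => A; apply: le_trans (lerD (fM A) (fM A)).
  rewrite -big_split /=; apply: ler_sum => i _.
  by rewrite (le_trans (ler_normD _ _))// normr_id.
apply/cvg_ex; eexists; apply: cvg_rsum_ge0 => //.
by exists M => A; rewrite (eq_bigr (fun i => `|f i|)) // => i _; rewrite normr_id.
Qed.

Lemma cvg_rsum f : abs_summable f ->
  (fun A : {fset I} => \sum_(i <- A) f i) @ totally --> rsum f.
Proof. by move/is_cvg_rsum. Qed.

Lemma rsum_eq f l :
  (fun A : {fset I} => \sum_(i <- A) f i) @ totally --> l -> rsum f = l.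
Proof. by move=> /cvg_lim; apply. Qed.

Lemma rsum_ext f g : f =1 g -> rsum f = rsum g.
Proof. by move=> /funext ->. Qed.

Lemma abs_summable_le f g : (forall i, `|f i| <= g i) -> abs_summable g ->
  abs_summable f.
Proof.
move=> fg [M gM]; exists M => A; apply: le_trans (gM A).
by apply: ler_sum => i _; rewrite (le_trans (fg i)) ?ler_norm.
Qed.

Lemma abs_summableD f g : abs_summable f -> abs_summable g ->
  abs_summable (fun i => f i + g i).
Proof.
move=> [M fM] [N gN]; exists (M + N) => A.
apply: le_trans (lerD (fM A) (gN A)).
by rewrite -big_split; apply: ler_sum => i _; exact: ler_normD.
Qed.

Lemma abs_summableZ c f : abs_summable f -> abs_summable (fun i => c * f i).
Proof.
move=> [M fM]; exists (`|c| * M) => A.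
under eq_bigr do rewrite normrM.
by rewrite -mulr_sumr ler_wpM2l.
Qed.

Lemma rsumD f g : abs_summable f -> abs_summable g ->
  rsum (fun i => f i + g i) = rsum f + rsum g.
Proof.
move=> sf sg; apply: rsum_eq.
rewrite (_ : (fun A : {fset I} => _) = (fun A : {fset I} => \sum_(i <- A) f i)
  \+ (fun A : {fset I} => \sum_(i <- A) g i)); last first.
  by apply/funext => A /=; rewrite big_split.
by apply: cvgD; exact: cvg_rsum.
Qed.

Lemma rsumZ c f : abs_summable f -> rsum (fun i => c * f i) = c * rsum f.
Proof.
move=> sf; apply: rsum_eq.
rewrite (_ : (fun A : {fset I} => _) =
   (fun A : {fset I} => c * (\sum_(i <- A) f i))); last first.
  by apply/funext => A /=; rewrite mulr_sumr.
by apply: cvgMr; exact: cvg_rsum.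
Qed.

Lemma rsum0 : rsum (fun=> 0) = 0.
Proof.
apply: rsum_eq; rewrite (_ : (fun A : {fset I} => _) = fun=> 0).
  exact: cvg_cst.
by apply/funext => A; rewrite big1.
Qed.

Lemma rsum_le_ub f M : abs_summable f ->
  (forall A : {fset I}, \sum_(i <- A) f i <= M) -> rsum f <= M.
Proof.
by move=> sf fM; apply: limr_le; [exact: is_cvg_rsum|near=> A; exact: fM].
Unshelve. all: by end_near. Qed.

Lemma rsum_ge_fset f A : (forall i, 0 <= f i) -> abs_summable f ->
  \sum_(i <- A) f i <= rsum f.
Proof.
move=> f0 sf; apply: limr_ge; first exact: is_cvg_rsum.
by apply: filterS (totally_ge A) => B; exact: ler_sum_fset.
Qed.

Lemma rsum_ge0 f : (forall i, 0 <= f i) -> abs_summable f -> 0 <= rsum f.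
Proof.
by move=> f0 sf; have := rsum_ge_fset fset0 f0 sf; rewrite big_seq_fset0.
Qed.

Lemma ge0_abs_summableP f : (forall i, 0 <= f i) ->
  abs_summable f <-> exists M, forall A : {fset I}, \sum_(i <- A) f i <= M.
Proof.
move=> f0.
have E (A : {fset I}) : \sum_(i <- A) `|f i| = \sum_(i <- A) f i.
  by apply: eq_bigr => i _; rewrite ger0_norm.
by split=> -[M fM]; exists M => A; move: (fM A); rewrite E.
Qed.

Lemma rsum_single f i : (forall j, j != i -> f j = 0) -> rsum f = f i.
Proof.
move=> fi; apply: rsum_eq; apply: cvg_near_cst.
apply: filterS (totally_ge [fset i]%fset) => A; rewrite fsub1set => iA.
rewrite (big_fsetD1 i) //= big_seq big1 ?addr0 // => j.
by rewrite !inE => /andP[/fi].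
Qed.

End NetSums.
Lemma rsum_sum {R : realType} {I J : choiceType} (A : seq I) (f : I -> J -> R) :
  (forall i, abs_summable (f i)) ->
  abs_summable (fun j => \sum_(i <- A) f i j) /\
  rsum (fun j => \sum_(i <- A) f i j) = \sum_(i <- A) rsum (f i).
Proof.
move=> sf; elim: A => [|a A [IH1 IH2]].
  rewrite big_nil; split.
    by exists 0 => B; rewrite big1// => i _; rewrite big_nil normr0.
  by rewrite -[RHS](@rsum0 _ J); apply: rsum_ext => j; rewrite big_nil.
split.
  case: (abs_summableD (sf a) IH1) => M hM; exists M => B.
  by under eq_bigr do rewrite big_cons.
rewrite big_cons -IH2 -rsumD//; apply: rsum_ext => j.
by rewrite big_cons.
Qed.

Section ComplexSums.
Context {R : realType} {I : choiceType}.
Local Notation C := R[i].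
Implicit Types (f g : I -> C) (A : {fset I}).

Lemma normcE' (z : C) : `|z| = (normc z)%:C. Proof. by []. Qed.

Lemma normc_ge0 (z : C) : 0 <= normc z.
Proof. by case: z => a b; exact: sqrtr_ge0. Qed.

Lemma normc_sqr (z : C) : normc z ^+ 2 = complex.Re z ^+ 2 + complex.Im z ^+ 2.
Proof. by case: z => a b; rewrite /= sqr_sqrtr// addr_ge0// sqr_ge0. Qed.

Lemma ler_Re_normc (z : C) : `|complex.Re z| <= normc z.
Proof.
rewrite -(@ler_pXn2r _ 2)// ?nnegrE ?normc_ge0// normc_sqr real_normK ?num_real//.
by rewrite lerDl sqr_ge0.
Qed.

Lemma ler_Im_normc (z : C) : `|complex.Im z| <= normc z.
Proof.
rewrite -(@ler_pXn2r _ 2)// ?nnegrE ?normc_ge0// normc_sqr real_normK ?num_real//.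
by rewrite lerDr sqr_ge0.
Qed.

Lemma normcJ' (z : C) : normc (Num.conj z) = normc z.
Proof. by case: z => a b /=; rewrite sqrrN. Qed.

Lemma normc_real (r : R) : normc r%:C = `|r|.
Proof. by rewrite /= expr0n /= addr0 sqrtr_sqr. Qed.

Definition csum f : C :=
  rsum (fun i => complex.Re (f i)) +i* rsum (fun i => complex.Im (f i)).

Definition csummable f : Prop := abs_summable (fun i => normc (f i)).

Lemma csummable_Re f : csummable f -> abs_summable (fun i => complex.Re (f i)).
Proof. by apply: abs_summable_le => i; exact: ler_Re_normc. Qed.

Lemma csummable_Im f : csummable f -> abs_summable (fun i => complex.Im (f i)).
Proof. by apply: abs_summable_le => i; exact: ler_Im_normc. Qed.

Lemma csummable_le f (g : I -> R) : (forall i, normc (f i) <= g i) ->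
  abs_summable g -> csummable f.
Proof. by move=> fg; apply: abs_summable_le => i; rewrite ger0_norm ?normc_ge0. Qed.

Lemma csum_ext f g : f =1 g -> csum f = csum g.
Proof. by move=> /funext ->. Qed.

Lemma csumD f g : csummable f -> csummable g ->
  csum (fun i => f i + g i) = csum f + csum g.
Proof.
move=> sf sg; rewrite /csum -[RHS]/(Complex _ _); congr Complex.
  rewrite -rsumD; [|exact: csummable_Re|exact: csummable_Re].
  by apply: rsum_ext => i; case: (f i) (g i) => a b [].
rewrite -rsumD; [|exact: csummable_Im|exact: csummable_Im].
by apply: rsum_ext => i; case: (f i) (g i) => a b [].
Qed.

Lemma csumZ (c : C) f : csummable f -> csum (fun i => c * f i) = c * csum f.
Proof.
case: c => a b sf; have sr := csummable_Re sf; have si := csummable_Im sf.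
rewrite /csum -[RHS]/(Complex _ _); congr Complex.
  rewrite -mulNr -!rsumZ// -rsumD; [|exact: abs_summableZ|exact: abs_summableZ].
  by apply: rsum_ext => i; case: (f i) => u v /=; rewrite mulNr.
rewrite -!rsumZ// -rsumD; [|exact: abs_summableZ|exact: abs_summableZ].
by apply: rsum_ext => i; case: (f i) => u v /=.
Qed.

Lemma csumJ f : csummable f -> csum (fun i => Num.conj (f i)) = Num.conj (csum f).
Proof.
move=> sf; rewrite /csum -[RHS]/(Complex _ _); congr Complex.
  by apply: rsum_ext => i; case: (f i).
rewrite -mulN1r -rsumZ; last exact: csummable_Im.
by apply: rsum_ext => i; case: (f i) => a b; rewrite mulN1r.
Qed.

Lemma csum0 : csum (fun=> 0) = 0.
Proof. by rewrite /csum rsum0. Qed.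

Lemma csum_single f i : (forall j, j != i -> f j = 0) -> csum f = f i.
Proof.
move=> fi; rewrite /csum (@rsum_single _ _ _ i) 1?(@rsum_single _ _ _ i).
- by case: (f i).
- by move=> j /fi ->.
- by move=> j /fi ->.
Qed.

Lemma csum_real (f : I -> R) : csum (fun i => (f i)%:C) = (rsum f)%:C.
Proof. by rewrite /csum rsum0. Qed.

Lemma sum_mul_le_sqr (T : Type) (s : seq T) (a b : T -> R) :
  (forall i, 0 <= a i) -> (forall i, 0 <= b i) ->
  (\sum_(i <- s) a i * b i) ^+ 2 <=
  (\sum_(i <- s) a i ^+ 2) * (\sum_(i <- s) b i ^+ 2).
Proof.
move=> a0 b0; elim: s => [|i s IH]; first by rewrite !big_nil expr0n mul0r.
rewrite !big_cons.
have : 0 <= \sum_(j <- s) a j * b j by apply: sumr_ge0 => j _; exact: mulr_ge0.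
have : 0 <= \sum_(j <- s) a j ^+ 2 by apply: sumr_ge0 => j _; exact: sqr_ge0.
have : 0 <= \sum_(j <- s) b j ^+ 2 by apply: sumr_ge0 => j _; exact: sqr_ge0.
move: IH (a0 i) (b0 i); move: (\sum_(j <- s) a j * b j) (\sum_(j <- s) a j ^+ 2)
  (\sum_(j <- s) b j ^+ 2) (a i) (b i) => S X Y x y SXY x0 y0 Y0 X0 S0.
(* The cross term. By induction [S ^+ 2 <= X * Y], so after squaring this is the inequality of
   arithmetic and geometric means for [X * y ^+ 2] and [x ^+ 2 * Y]. *)
have H : 2 * S * (x * y) <= X * y ^+ 2 + x ^+ 2 * Y.
  rewrite -(@ler_pXn2r _ 2)// ?nnegrE; last 2 first.
    by rewrite !mulr_ge0.
    by rewrite addr_ge0// mulr_ge0// sqr_ge0.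
  have := sqr_ge0 (X * y ^+ 2 - x ^+ 2 * Y).
  have : 0 <= (X * Y - S ^+ 2) * (x * y) ^+ 2 by rewrite mulr_ge0 ?subr_ge0// sqr_ge0.
  by nra.
by nra.
Qed.

Lemma sum_mul_le (T : Type) (s : seq T) (a b : T -> R) (M N : R) :
  (forall i, 0 <= a i) -> (forall i, 0 <= b i) ->
  \sum_(i <- s) a i ^+ 2 <= M -> \sum_(i <- s) b i ^+ 2 <= N ->
  \sum_(i <- s) a i * b i <= Num.sqrt M * Num.sqrt N.
Proof.
move=> a0 b0 aM bN.
have M0 : 0 <= M by apply: le_trans aM; apply: sumr_ge0 => j _; exact: sqr_ge0.
have N0 : 0 <= N by apply: le_trans bN; apply: sumr_ge0 => j _; exact: sqr_ge0.
rewrite -(@ler_pXn2r _ 2)// ?nnegrE; last 2 first.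
  by apply: sumr_ge0 => j _; exact: mulr_ge0.
  by rewrite mulr_ge0// sqrtr_ge0.
apply: le_trans (sum_mul_le_sqr s a0 b0) _.
rewrite exprMn !sqr_sqrtr//; apply: ler_pM => //;
  by apply: sumr_ge0 => j _; exact: sqr_ge0.
Qed.

End ComplexSums.

(** * The Hilbert space of square summable families *)

Section Ell2.
Context {R : realType} {I : choiceType}.
Local Notation C := R[i].
Implicit Types (x y : I -> C) (A : {fset I}).

Definition l2 x : Prop := abs_summable (fun i => normc (x i) ^+ 2).

Lemma l2P x : l2 x <->
  exists M : R, forall A, \sum_(i <- A) normc (x i) ^+ 2 <= M.
Proof. by apply: ge0_abs_summableP => i; exact: sqr_ge0. Qed.

Lemma l2_le x y : (forall i, normc (x i) <= normc (y i)) -> l2 y -> l2 x.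
Proof.
move=> xy /l2P[M yM]; apply/l2P; exists M => A; apply: le_trans (yM A).
by apply: ler_sum => i _; rewrite ler_pXn2r ?nnegrE ?normc_ge0.
Qed.

Lemma l2D x y : l2 x -> l2 y -> l2 (fun i => x i + y i).
Proof.
move=> sx sy; have := abs_summableZ 2 (abs_summableD sx sy).
apply: abs_summable_le => i; rewrite ger0_norm ?sqr_ge0//.
have xy0 : normc (x i + y i) ^+ 2 <= (normc (x i) + normc (y i)) ^+ 2.
  by rewrite ler_pXn2r ?nnegrE ?addr_ge0 ?normc_ge0// le_normcD.
by apply: le_trans xy0 _; have := sqr_ge0 (normc (x i) - normc (y i)); nra.
Qed.

Lemma l2Z c x : l2 x -> l2 (fun i => c * x i).
Proof.
move=> sx; have := abs_summableZ (normc c ^+ 2) sx.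
by apply: abs_summable_le => i; rewrite ger0_norm ?sqr_ge0// normcM exprMn.
Qed.

Lemma l2J x : l2 x -> l2 (fun i => Num.conj (x i)).
Proof. by apply: l2_le => i; rewrite normcJ'. Qed.

Lemma csummableM x y : l2 x -> l2 y -> csummable (fun i => x i * y i).
Proof.
move=> /l2P[M xM] /l2P[N yN]; exists (Num.sqrt M * Num.sqrt N) => A.
under eq_bigr do rewrite ger0_norm ?normc_ge0// normcM.
by apply: sum_mul_le => // i; exact: normc_ge0.
Qed.

Definition ell2_pred : {pred I -> C} := [pred x | `[< l2 x >]].

Lemma ell2_submod : submod_closed ell2_pred.
Proof.
split => [|c x y /asboolP lx /asboolP ly]; apply/asboolP.
  by apply/l2P; exists 0 => A; rewrite big1// => i _; rewrite normc0 expr0n.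
exact: l2D (l2Z c lx) ly.
Qed.

HB.instance Definition _ :=
  GRing.isSubmodClosed.Build C (I -> C) ell2_pred ell2_submod.

Record ell2 := Ell2 { ell2_fun :> I -> C; ell2_proof : ell2_fun \in ell2_pred }.

HB.instance Definition _ := [isSub for ell2_fun].
HB.instance Definition _ := [Choice of ell2 by <:].
HB.instance Definition _ := [SubChoice_isSubLmodule of ell2 by <:].

Implicit Types u v w : ell2.

Lemma ell2P u : l2 u. Proof. by have /asboolP := ell2_proof u. Qed.

(** Falls back to [0] on families that are not square summable; every use goes through [mkell2E]. *)
Definition mkell2 x : ell2 := insubd 0 x.

Lemma mkell2E x : l2 x -> mkell2 x = x :> (I -> C).
Proof. by move=> lx; rewrite /mkell2 insubdK//; apply/asboolP. Qed.

Lemma ell2_ext u v : (forall i, u i = v i) -> u = v.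
Proof. by move=> uv; apply: val_inj; exact/funext. Qed.

Lemma ell2DE u v i : (u + v) i = u i + v i. Proof. by []. Qed.
Lemma ell2ZE (c : C) u i : (c *: u) i = c * u i. Proof. by []. Qed.
Lemma ell2NE u i : (- u) i = - u i. Proof. by []. Qed.
Lemma ell2_sumE (T : Type) (s : seq T) (F : T -> ell2) i :
  (\sum_(t <- s) F t) i = \sum_(t <- s) F t i.
Proof. by elim/big_ind2 : _ => // a b c d <- <-. Qed.

Definition ell2_dot u v : C := csum (fun i => u i * Num.conj (v i)).

Definition ell2_nsq u : R := rsum (fun i => normc (u i) ^+ 2).

Lemma ell2_nsq_ge0 u : 0 <= ell2_nsq u.
Proof. by apply: rsum_ge0 (ell2P u) => i; exact: sqr_ge0. Qed.

Lemma ell2_nsq_le u M :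
  (forall A, \sum_(i <- A) normc (u i) ^+ 2 <= M) -> ell2_nsq u <= M.
Proof. by apply: rsum_le_ub (ell2P u). Qed.

Lemma ell2_nsq_ge u A : \sum_(i <- A) normc (u i) ^+ 2 <= ell2_nsq u.
Proof. by apply: rsum_ge_fset (ell2P u) => i; exact: sqr_ge0. Qed.

Lemma normc_le_nsq u i : normc (u i) <= Num.sqrt (ell2_nsq u).
Proof.
rewrite -(@ler_pXn2r _ 2)// ?nnegrE ?normc_ge0 ?sqrtr_ge0//.
rewrite sqr_sqrtr ?ell2_nsq_ge0//.
by have := ell2_nsq_ge u [fset i]%fset; rewrite big_seq_fset1.
Qed.

Lemma ell2_dotxx u : ell2_dot u u = (ell2_nsq u)%:C.
Proof.
rewrite -csum_real; apply: csum_ext => i.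
by rewrite -normCK normcE' -rmorphXn.
Qed.

Definition ell2_norm u : C := (Num.sqrt (ell2_nsq u))%:C.

Lemma ell2_normD u v : ell2_norm (u + v) <= ell2_norm u + ell2_norm v.
Proof.
rewrite /ell2_norm -rmorphD lecR.
have X0 := ell2_nsq_ge0 u; have Y0 := ell2_nsq_ge0 v.
rewrite -(@ler_pXn2r _ 2)// ?nnegrE ?addr_ge0 ?sqrtr_ge0//.
rewrite sqr_sqrtr ?ell2_nsq_ge0//; apply: ell2_nsq_le => A.
apply: (@le_trans _ _ (\sum_(i <- A) (normc (u i) + normc (v i)) ^+ 2)).
  apply: ler_sum => i _.
  by rewrite ler_pXn2r ?nnegrE ?addr_ge0 ?normc_ge0// le_normcD.
under eq_bigr do rewrite sqrrD.
rewrite !big_split /= sqrrD !sqr_sqrtr// lerD ?ell2_nsq_ge// lerD ?ell2_nsq_ge//.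
rewrite mulr2n; apply: lerD;
  by apply: sum_mul_le => [i|i||]; rewrite ?normc_ge0 ?ell2_nsq_ge.
Qed.

Lemma ell2_normZ c u : ell2_norm (c *: u) = `|c| * ell2_norm u.
Proof.
rewrite /ell2_norm normcE' -rmorphM; congr (_%:C).
rewrite /ell2_nsq (@rsum_ext _ _ _ (fun i => normc c ^+ 2 * normc (u i) ^+ 2)).
  have su : abs_summable (fun i => normc (u i) ^+ 2) := ell2P u.
  by rewrite rsumZ// sqrtrM ?sqr_ge0// sqrtr_sqr ger0_norm ?normc_ge0.
by move=> i; rewrite ell2ZE normcM exprMn.
Qed.

Lemma ell2_norm0_eq0 u : ell2_norm u = 0 -> u = 0.
Proof.
move=> /complexI/eqP; rewrite sqrtr_eq0 => u0.
apply: ell2_ext => i; apply: eq0_normc; apply/eqP.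
rewrite eq_le normc_ge0 andbT (le_trans (normc_le_nsq u i))//.
by rewrite ler0_sqrtr.
Qed.

HB.instance Definition _ :=
  Lmodule_isNormed.Build C ell2 ell2_normD ell2_normZ ell2_norm0_eq0.

Lemma ell2_normE u : `|u| = (Num.sqrt (ell2_nsq u))%:C. Proof. by []. Qed.

End Ell2.
Arguments ell2 : clear implicits.

Section Ell2Complete.
Context {R : realType} {I : choiceType}.
Local Notation C := R[i].
Local Notation H := (ell2 R I).
Implicit Types u v w : H.

Lemma gt0_complexE (e : C) : 0 < e -> 0 < complex.Re e /\ e = (complex.Re e)%:C.
Proof. by case: e => a b; rewrite ltcE /= => /andP[/eqP -> ->]. Qed.

Lemma ell2_norm_le u (e : R) : 0 <= e -> (`|u| <= e%:C) = (ell2_nsq u <= e ^+ 2).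
Proof.
move=> e0; rewrite ell2_normE lecR -[in LHS](ger0_norm e0) -sqrtr_sqr ler_sqrt//.
exact: sqr_ge0.
Qed.

(** Squared norms are real and are controlled by finite partial sums through [ell2_nsq_le], which
    removes square roots and complex-valued distances from convergence proofs. *)
Lemma cvg_ell2P (T : Type) (F : set_system T) (FF : Filter F) (f : T -> H) u :
  f @ F --> u <->
  (forall e : R, 0 < e -> \forall t \near F, ell2_nsq (u - f t) <= e).
Proof.
split=> [/cvgrPdist_le fu e e0|fu].
  have : 0 < (Num.sqrt e)%:C :> C by rewrite ltcR sqrtr_gt0.
  move=> /fu; apply: filterS => t; rewrite ell2_norm_le ?sqrtr_ge0//.
  by rewrite sqr_sqrtr// ltW.
apply/cvgrPdist_le => e /gt0_complexE[e0 ->].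
have /fu : 0 < complex.Re e ^+ 2 by rewrite exprn_gt0.
by apply: filterS => t; rewrite ell2_norm_le// ltW.
Qed.

(** Each coordinate is 1-Lipschitz, so its real and imaginary parts converge along [F] by
    completeness of the reals; these limits form the candidate [l]. *)
Lemma ell2_complete (F : set_system H) : ProperFilter F -> cauchy F -> cvg F.
Proof.
move=> FF cF.
have cau (e : R) : 0 < e -> exists w, \forall u \near F, ell2_nsq (w - u) <= e.
  move=> e0; have /cauchyP/(_ ((Num.sqrt e)%:C))[|w Fw] := cF.
    by rewrite ltcR sqrtr_gt0.
  exists w; apply: filterS Fw => u; rewrite -ball_normE /ball_ /= => /ltW.
  by rewrite ell2_norm_le ?sqrtr_ge0// sqr_sqrtr// ltW.
have cvgc (p : C -> R) : (forall z z', `|p z - p z'| <= normc (z - z')) ->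
    forall i, exists l : R, (fun u : H => p (u i)) @ F --> l.
  move=> pl i; apply/cvg_ex; apply: R_complete; apply/cauchyP => e e0.
  have [w Fw] : exists w, \forall u \near F, ell2_nsq (w - u) <= (e / 2) ^+ 2.
    by apply: cau; rewrite exprn_gt0// divr_gt0.
  exists (p (w i)); rewrite nbhs_simpl /=; apply: filterS Fw => u wu.
  rewrite -ball_normE /ball_ /=; apply: le_lt_trans (pl _ _) _.
  apply: le_lt_trans (normc_le_nsq (w - u) i) _.
  have e2 : 0 <= e / 2 by rewrite divr_ge0// ltW.
  apply: (@le_lt_trans _ _ (e / 2)); last by rewrite ltr_pdivrMr// ltr_pMr// ltr1n.
  by rewrite -[leRHS](ger0_norm e2) -sqrtr_sqr ler_wsqrtr.
have Rel (z z' : C) : `|complex.Re z - complex.Re z'| <= normc (z - z').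
  by have := ler_Re_normc (z - z'); case: z z' => a b [].
have Iml (z z' : C) : `|complex.Im z - complex.Im z'| <= normc (z - z').
  by have := ler_Im_normc (z - z'); case: z z' => a b [].
have /choice[lr hlr] := cvgc (@complex.Re R) Rel.
have /choice[li hli] := cvgc (@complex.Im R) Iml.
pose l i : C := lr i +i* li i.
(* Fatou for finite sums: a bound on the squared distance that holds near [F] survives the
   coordinatewise limit. It yields both the square summability of [l] and the convergence to it. *)
have near_l w (e : R) : (\forall u \near F, ell2_nsq (w - u) <= e) ->
    forall A : {fset I}, \sum_(i <- A) normc (w i - l i) ^+ 2 <= e.
  move=> Fw A.
  have cA : (fun u : H => \sum_(i <- A) normc (w i - u i) ^+ 2) @ F -->
      \sum_(i <- A) normc (w i - l i) ^+ 2.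
    have addc : continuous (fun x : R * R => x.1 + x.2) by exact: add_continuous.
    apply: (@cvg_big R I +%R 0 xpredT addc _ F A
      (fun i (u : H) => normc (w i - u i) ^+ 2)) => i _.
    rewrite normc_sqr (_ : (fun x : H => _) = (fun x : H =>
       (complex.Re (w i) - complex.Re (x i)) ^+ 2 +
       (complex.Im (w i) - complex.Im (x i)) ^+ 2)); last first.
      by apply/funext => u; rewrite normc_sqr; case: (w i) (u i) => ? ? [].
    rewrite (_ : complex.Re (w i - l i) = complex.Re (w i) - lr i); last by case: (w i).
    rewrite (_ : complex.Im (w i - l i) = complex.Im (w i) - li i); last by case: (w i).
    by apply: cvgD; (under eq_fun do rewrite expr2); rewrite expr2; apply: cvgM;
      apply: cvgB; (exact: cvg_cst || exact: hlr || exact: hli).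
  apply: cvgr_to_le cA _; apply: filterS Fw => u; apply: le_trans.
  exact: (ell2_nsq_ge (w - u)).
have ll : l2 l.
  have [w Fw] := cau 1 ltr01.
  have lwl : l2 (fun i => w i - l i) by apply/l2P; exists 1; exact: near_l.
  have := l2D (ell2P w) (l2Z (-1) lwl); apply: l2_le => i.
  by rewrite mulN1r opprB addrC subrK.
apply/cvg_ex; exists (mkell2 l); apply/(@cvg_ell2P _ _ FF id) => e e0.
(* The [4] absorbs [|a - b| ^ 2 <= 2 (|a| ^ 2 + |b| ^ 2)], both squares having sums at most
   [e / 4]. *)
have [w Fw] : exists w, \forall u \near F, ell2_nsq (w - u) <= e / 4.
  by apply: cau; rewrite divr_gt0.
apply: filterS (Fw) => u wu; apply: ell2_nsq_le => A.
apply: (@le_trans _ _ (\sum_(i <- A) 2 * (normc (w i - l i) ^+ 2 +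
   normc (w i - u i) ^+ 2))).
  apply: ler_sum => i _.
  rewrite ell2DE ell2NE mkell2E//.
  have -> : l i - u i = (w i - u i) - (w i - l i) by ring.
  set a := w i - u i; set b := w i - l i.
  have : normc (a - b) ^+ 2 <= (normc a + normc b) ^+ 2.
    rewrite ler_pXn2r ?nnegrE ?addr_ge0 ?normc_ge0//.
    by apply: le_trans (le_normcD _ _) _; rewrite normcN.
  by have := sqr_ge0 (normc a - normc b); nra.
rewrite -mulr_sumr big_split /=.
have := near_l _ _ Fw A.
have : \sum_(i <- A) normc (w i - u i) ^+ 2 <= e / 4.
  exact: le_trans (ell2_nsq_ge (w - u) A) wu.
by lra.
Qed.

HB.instance Definition _ := Uniform_isComplete.Build H ell2_complete.

Lemma ell2_dot_bilinear :
  bilinear_for (GRing.Scale.Law.clone _ _ *%R _)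
    (GRing.Scale.Law.clone _ _ (Num.conj \; *%R) _) (@ell2_dot R I).
Proof.
split=> [v c u u'|u c v v']; rewrite /ell2_dot.
  have s1 := csummableM (ell2P u) (l2J (ell2P v)).
  have s2 := csummableM (ell2P u') (l2J (ell2P v)).
  rewrite -[RHS]/(c * csum _ + csum _) -csumZ// -csumD//.
    by apply: csum_ext => i; rewrite ell2DE ell2ZE mulrDl mulrA.
  apply: csummable_le (abs_summableZ (normc c) s1) => i.
  by rewrite normcM.
have s1 := csummableM (ell2P u) (l2J (ell2P v)).
have s2 := csummableM (ell2P u) (l2J (ell2P v')).
rewrite -[RHS]/(Num.conj c * csum _ + csum _) -csumZ// -csumD//.
  by apply: csum_ext => i; rewrite ell2DE ell2ZE rmorphD rmorphM /=; ring.
apply: csummable_le (abs_summableZ (normc (Num.conj c)) s1) => i.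
by rewrite normcM.
Qed.

HB.instance Definition _ := bilinear_isBilinear.Build C H H C
  (GRing.Scale.Law.clone _ _ *%R _)
    (GRing.Scale.Law.clone _ _ (Num.conj \; *%R) _) (@ell2_dot R I) ell2_dot_bilinear.

Lemma ell2_dot_herm u v : ell2_dot u v = (-1) ^+ false * Num.conj (ell2_dot v u).
Proof.
rewrite expr0 mul1r /ell2_dot -csumJ.
  apply: csum_ext => i; case: (u i) (v i) => a b [c d].
  by apply/eqP; rewrite eq_complex /=; apply/andP; split; apply/eqP; ring.
exact: csummableM (ell2P v) (l2J (ell2P u)).
Qed.

HB.instance Definition _ :=
  isHermitianSesquilinear.Build C H false Num.conj (@ell2_dot R I) ell2_dot_herm.

Lemma ell2_dot_gt0 u : u != 0 -> 0 < ell2_dot u u.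
Proof.
move=> u0; rewrite ell2_dotxx ltcR lt_neqAle ell2_nsq_ge0 andbT eq_sym.
apply: contra u0 => /eqP u0; apply/eqP/ell2_norm0_eq0.
by rewrite /ell2_norm u0 sqrtr0.
Qed.

HB.instance Definition _ :=
  isDotProduct.Build C H (@ell2_dot R I) ell2_dot_gt0.

Lemma ell2_dot_norm u : `|u| ^+ 2 = ell2_dot u u.
Proof.
by rewrite ell2_normE ell2_dotxx -rmorphXn /= sqr_sqrtr// ell2_nsq_ge0.
Qed.

Definition ell2_hilbert : hilbertSpace R :=
  @HilbertSpace R H (@ell2_dot R I) ell2_dot_norm.

End Ell2Complete.
Arguments ell2_hilbert : clear implicits.

(** * Sums over finite rectangles and uniform tails *)

Section FiniteSums.
Context {R : realType} {I J : choiceType}.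

Lemma ge0_sum_seq_fset (T : choiceType) (s : seq T) (f : T -> R) : uniq s ->
  \sum_(i <- s) f i = \sum_(i <- [fset i in s]%fset) f i.
Proof.
move=> us; apply: perm_big; apply: uniq_perm => // i.
by rewrite inE.
Qed.

Lemma esum_ltyP (a : I -> R) : (forall i, 0 <= a i) ->
  (\esum_(i in [set: I]) (a i)%:E < +oo)%E <-> abs_summable a.
Proof.
move=> a0; rewrite (propext (ge0_abs_summableP a0)); split=> [fin|[M aM]].
  exists (fine (\esum_(i in [set: I]) (a i)%:E)) => A.
  rewrite -lee_fin fineK; last first.
    by rewrite ge0_fin_numE//; apply: esum_ge0 => i _; rewrite lee_fin.
  apply: esum_ge; exists [set` A]; first by split.
  by rewrite fsbig_finite//= set_fsetK -sumEFin.
apply: (@le_lt_trans _ _ M%:E); last exact: ltry.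
apply: ub_ereal_sup => _ [X [fX _] <-].
by rewrite fsbig_finite//= sumEFin lee_fin.
Qed.

(** A finite set of pairs lies in the product of its two projections. *)
Lemma l2_prodP (K : I * J -> R[i]) (M : R) :
  (forall (A : {fset I}) (B : {fset J}),
     \sum_(i <- A) \sum_(j <- B) normc (K (i, j)) ^+ 2 <= M) ->
  l2 K /\ forall D : {fset I * J}, \sum_(p <- D) normc (K p) ^+ 2 <= M.
Proof.
move=> KM; suff H (D : {fset I * J}) : \sum_(p <- D) normc (K p) ^+ 2 <= M.
  by split=> //; apply/l2P; exists M.
pose A := [fset p.1 | p in D]%fset; pose B := [fset p.2 | p in D]%fset.
apply: le_trans (KM A B).
rewrite (_ : \sum_(i <- A) _ = \sum_(p <- [seq (i, j) | i <- A, j <- B])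
    normc (K p) ^+ 2); last by rewrite big_allpairs.
rewrite [leRHS]ge0_sum_seq_fset; last first.
  by apply: allpairs_uniq => // -[? ?] [].
apply: ler_sum_fset => [p|]; first exact: sqr_ge0.
apply/fsubsetP => -[i j] ij; rewrite inE.
by apply/allpairsP; exists (i, j); split => //; apply: in_imfset.
Qed.

Lemma l2_prod_le (K : I * J -> R[i]) (A : {fset I}) (B : {fset J}) : l2 K ->
  \sum_(i <- A) \sum_(j <- B) normc (K (i, j)) ^+ 2 <=
  rsum (fun p => normc (K p) ^+ 2).
Proof.
move=> lK.
rewrite (_ : \sum_(i <- A) _ = \sum_(p <- [seq (i, j) | i <- A, j <- B])
    normc (K p) ^+ 2); last by rewrite big_allpairs.
rewrite ge0_sum_seq_fset; last by apply: allpairs_uniq => // -[? ?] [].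
by apply: rsum_ge_fset lK => p; exact: sqr_ge0.
Qed.

(** One finite set [A] works for all [g] dominated by [f] at once. This plays the part of dominated
    convergence when the spectral measures are shown to be countably additive. *)
Lemma abs_summable_tail (f : I -> R) (e : R) : (forall i, 0 <= f i) ->
  abs_summable f -> 0 < e -> exists A : {fset I},
  forall g : I -> R, (forall i, 0 <= g i <= f i) ->
  (forall i, i \in A -> g i = 0) -> forall B : {fset I}, \sum_(i <- B) g i <= e.
Proof.
move=> f0 sf e0.
have /cvgrPdist_lt/(_ e e0)[A _ AP] := cvg_rsum sf.
exists A => g gf gA B.
apply: (@le_trans _ _ (\sum_(i <- (A `|` B)%fset) g i)).
  by apply: ler_sum_fset; [move=> i; case/andP: (gf i)|exact: fsubsetUr].
apply: (@le_trans _ _ (\sum_(i <- (A `|` B)%fset) f i - \sum_(i <- A) f i)).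
  rewrite lerBrDl (big_fsetID _ (fun i => i \in A) (A `|` B)%fset) /=.
  rewrite [leRHS](big_fsetID _ (fun i => i \in A) (A `|` B)%fset) /=.
  rewrite (_ : [fset x in (A `|` B)%fset | x \in A]%fset = A); last first.
    by apply/fsetP => x; rewrite !inE; case: (x \in A); rewrite ?andbF.
  have -> : \sum_(i <- A) g i = 0 by rewrite big_seq big1.
  rewrite add0r lerD2l; apply: ler_sum => i _.
  by case/andP: (gf i).
have := AP A (fsubset_refl A); rewrite /= ltr_norml => /andP[_ h].
have := rsum_ge_fset (A `|` B)%fset f0 sf.
by lra.
Qed.

End FiniteSums.

(** * Integral kernels and Hilbert-Schmidt operators *)

Section Operators.
Context {R : realType} {I : choiceType}.
Local Notation C := R[i].
Local Notation H := (ell2 R I).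
Implicit Types (x y u v : H) (K : I * I -> C) (T : H -> H).

Definition ebasis (i : I) : H := mkell2 (fun j => (j == i)%:R).

Lemma ebasisE i j : ebasis i j = (j == i)%:R.
Proof.
rewrite mkell2E//; apply/l2P; exists 1 => A.
apply: (@le_trans _ _ (\sum_(k <- A) (if k == i then 1 else 0))).
  by apply: ler_sum => k _; case: eqP => _; rewrite ?normc0 ?normc1 ?expr0n ?expr1n.
by rewrite -big_mkcond big_const_seq count_uniq_mem//; case: (i \in A) => /=; rewrite ?addr0 ?ler01.
Qed.

Lemma dot_ebasis x i : ell2_dot x (ebasis i) = x i.
Proof.
rewrite /ell2_dot (@csum_single _ _ _ i) => [|j ji].
  by rewrite ebasisE eqxx rmorph1 mulr1.
by rewrite ebasisE (negbTE ji) rmorph0 mulr0.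
Qed.

Lemma orthonormal_ebasis : orthonormal_basis (H := ell2_hilbert R I) ebasis.
Proof.
split=> [i j|x x0]; first by rewrite /= dot_ebasis ebasisE eq_sym.
by apply: ell2_ext => i; rewrite -dot_ebasis; exact: x0.
Qed.

Definition kop K (x : H) : H := mkell2 (fun i => csum (fun j => K (i, j) * x j)).

Definition knsq K : R := rsum (fun p => normc (K p) ^+ 2).

Lemma knsq_ge0 K : l2 K -> 0 <= knsq K.
Proof. by move=> lK; apply: rsum_ge0 lK => p; exact: sqr_ge0. Qed.

Lemma l2_row K i : l2 K -> l2 (fun j => K (i, j)).
Proof.
move=> lK; apply/l2P; exists (knsq K) => A.
by have := l2_prod_le [fset i]%fset A lK; rewrite big_seq_fset1.
Qed.

Lemma csummable_row K i x : l2 K -> csummable (fun j => K (i, j) * x j).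
Proof. by move=> lK; apply: csummableM (l2_row i lK) (ell2P x). Qed.

(** Multiplied by the unit phase [c], the sum becomes real and nonnegative, hence a limit of finite
    real sums, to which the finite Cauchy-Schwarz inequality applies. *)
Lemma normc_csum_le (J : choiceType) (f g : J -> C) : l2 f -> l2 g ->
  normc (csum (fun j => f j * g j)) ^+ 2 <=
  rsum (fun j => normc (f j) ^+ 2) * rsum (fun j => normc (g j) ^+ 2).
Proof.
move=> lf lg; set z := csum _.
have [->|z0] := eqVneq z 0.
  by rewrite normc0 expr0n mulr_ge0// rsum_ge0// => j; exact: sqr_ge0.
have nz0 : 0 < normc z.
  by rewrite lt_neqAle normc_ge0 andbT eq_sym; apply: contra z0 => /eqP/eq0_normc ->.
have sfg := csummableM lf lg.
have F0 : 0 <= rsum (fun j => normc (f j) ^+ 2) by rewrite rsum_ge0// => j; exact: sqr_ge0.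
have G0 : 0 <= rsum (fun j => normc (g j) ^+ 2) by rewrite rsum_ge0// => j; exact: sqr_ge0.
suff : normc z <= Num.sqrt (rsum (fun j => normc (f j) ^+ 2)) *
    Num.sqrt (rsum (fun j => normc (g j) ^+ 2)).
  move=> h; rewrite -[X in _ <= X * _]sqr_sqrtr// -[X in _ <= _ * X]sqr_sqrtr// -exprMn.
  by rewrite ler_pXn2r ?nnegrE ?normc_ge0 ?mulr_ge0 ?sqrtr_ge0.
pose c := Num.conj z / (normc z)%:C.
have nc : normc c = 1.
  by rewrite normcM normcV normcJ' normc_real ger0_norm ?normc_ge0// mulfV// gt_eqF.
have cz : c * z = (normc z)%:C.
  rewrite /c mulrAC [_ * z]mulrC -normCK normcE' -rmorphXn -[_^-1]rmorphV ?unitfE ?gt_eqF//.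
  by rewrite -rmorphM expr2 mulfK// gt_eqF.
have -> : normc z = complex.Re (c * z) by rewrite cz.
rewrite /z -csumZ//; apply: rsum_le_ub => [|A].
  apply: csummable_Re; apply: csummable_le (abs_summableZ 1 sfg) => j.
  by rewrite normcM nc.
apply: (@le_trans _ _ (\sum_(j <- A) normc (f j) * normc (g j))).
  apply: ler_sum => j _; apply: le_trans (ler_norm _) _.
  by apply: le_trans (ler_Re_normc _) _; rewrite normcM nc mul1r normcM.
by apply: sum_mul_le => [j|j||]; rewrite ?normc_ge0 ?rsum_ge_fset// => j; exact: sqr_ge0.
Qed.

Lemma sum_rows_le K (A : {fset I}) : l2 K ->
  \sum_(i <- A) rsum (fun j => normc (K (i, j)) ^+ 2) <= knsq K.
Proof.
move=> lK.
have [s <-] := rsum_sum A (fun i => l2_row i lK).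
by apply: rsum_le_ub => // B; rewrite exchange_big; exact: l2_prod_le.
Qed.

Lemma kop_sum_le K x (A : {fset I}) : l2 K ->
  \sum_(i <- A) normc (csum (fun j => K (i, j) * x j)) ^+ 2 <= knsq K * ell2_nsq x.
Proof.
move=> lK.
apply: (@le_trans _ _ (\sum_(i <- A) rsum (fun j => normc (K (i, j)) ^+ 2) * ell2_nsq x)).
  by apply: ler_sum => i _; exact: normc_csum_le (l2_row i lK) (ell2P x).
by rewrite -mulr_suml ler_wpM2r ?ell2_nsq_ge0//; exact: sum_rows_le.
Qed.

Lemma kopE K x i : l2 K -> kop K x i = csum (fun j => K (i, j) * x j).
Proof.
move=> lK; rewrite mkell2E//; apply/l2P; exists (knsq K * ell2_nsq x) => A.
exact: kop_sum_le.
Qed.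

Lemma kop_nsq_le K x : l2 K -> ell2_nsq (kop K x) <= knsq K * ell2_nsq x.
Proof.
move=> lK; apply: ell2_nsq_le => A.
by under eq_bigr do rewrite kopE//; exact: kop_sum_le.
Qed.

Lemma kop_linear K : l2 K -> linear (kop K).
Proof.
move=> lK c x y; apply: ell2_ext => i.
rewrite ell2DE ell2ZE !kopE// -csumZ -?csumD; first last.
- exact: csummable_row.
- exact: csummable_row.
- apply: csummable_le (abs_summableZ (normc c) (csummable_row i x lK)) => j.
  by rewrite normcM.
by apply: csum_ext => j; rewrite ell2DE ell2ZE; ring.
Qed.

Lemma kop_bounded K : l2 K -> bounded_operator (H := ell2_hilbert R I) (kop K).
Proof.
move=> lK; split; first exact: kop_linear.
suff h (x : H) : kop K @ nbhs x --> kop K x by exact: h.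
apply/cvg_ell2P => e e0.
have M0 : 0 < knsq K + 1 by rewrite ltr_wpDl// knsq_ge0.
have /cvg_ell2P/(_ (e / (knsq K + 1)))/= : (fun y : H => y) @ nbhs x --> x by [].
rewrite divr_gt0// => /(_ isT); apply: filterS => y xy.
have -> : kop K x - kop K y = kop K (x - y).
  by rewrite [x - y]addrC -(scaleN1r y) kop_linear// scaleN1r addrC.
apply: le_trans (kop_nsq_le _ lK) _.
apply: (@le_trans _ _ ((knsq K + 1) * ell2_nsq (x - y))).
  by rewrite ler_wpM2r ?ell2_nsq_ge0// lerDl.
by rewrite mulrC -ler_pdivlMr.
Qed.

Lemma kop_ebasis K i j : l2 K -> kop K (ebasis j) i = K (i, j).
Proof.
move=> lK; rewrite kopE// (@csum_single _ _ _ j) => [|k kj].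
  by rewrite ebasisE eqxx mulr1.
by rewrite ebasisE (negbTE kj) mulr0.
Qed.

Lemma kop_hilbert_schmidt K : l2 K ->
  hilbert_schmidt (H := ell2_hilbert R I) ebasis (kop K).
Proof.
move=> lK; split; first exact: kop_bounded.
suff : abs_summable (fun j => ell2_nsq (kop K (ebasis j))).
  rewrite -(propext (esum_ltyP (fun j => ell2_nsq_ge0 _))).
  rewrite (_ : (fun j => _) = fun j => (complex.Re (hdot (ell2_hilbert R I)
    (kop K (ebasis j)) (kop K (ebasis j))))%:E)//.
  by apply/funext => j; rewrite -[hdot _ _ _]/(ell2_dot _ _) ell2_dotxx.
apply/ge0_abs_summableP => [j|]; first exact: ell2_nsq_ge0.
exists (knsq K) => B.
have [s h] := rsum_sum B (fun j => ell2P (kop K (ebasis j))).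
rewrite [leLHS](_ : _ = \sum_(i <- B) rsum (fun j => normc (kop K (ebasis i) j) ^+ 2))// -h.
apply: rsum_le_ub => // A.
under eq_bigr do under eq_bigr do rewrite kop_ebasis//.
exact: l2_prod_le.
Qed.

Definition kernel_of T (p : I * I) : C := T (ebasis p.2) p.1.

Lemma kernel_of_kop K : l2 K -> kernel_of (kop K) = K.
Proof. by move=> lK; apply/funext => -[i j]; rewrite /kernel_of kop_ebasis. Qed.

Lemma hs_sum_le T : hilbert_schmidt (H := ell2_hilbert R I) ebasis T ->
  exists M : R, forall A B : {fset I},
    \sum_(i <- A) \sum_(j <- B) normc (kernel_of T (i, j)) ^+ 2 <= M.
Proof.
move=> [_ /esum_ltyP]; have T0 j : 0 <= complex.Re (ell2_dot (T (ebasis j)) (T (ebasis j))).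
  by rewrite ell2_dotxx ell2_nsq_ge0.
move=> /(_ T0)/(ge0_abs_summableP T0)[M TM]; exists M => A B.
apply: le_trans (TM B); rewrite exchange_big; apply: ler_sum => j _.
by rewrite ell2_dotxx; exact: (ell2_nsq_ge (T (ebasis j))).
Qed.

Lemma hs_kernel T : hilbert_schmidt (H := ell2_hilbert R I) ebasis T ->
  l2 (kernel_of T).
Proof. by move=> /hs_sum_le[M TM]; have [] := l2_prodP TM. Qed.

Lemma cvg_ebasis x : (fun A : {fset I} => \sum_(i <- A) x i *: ebasis i) @ totally --> x.
Proof.
apply/cvg_ell2P => e e0.
have [A AP] := abs_summable_tail (fun i => sqr_ge0 (normc (x i))) (ell2P x) e0.
apply: filterS (totally_ge A) => B AB; apply: ell2_nsq_le.
have E i : (x - \sum_(j <- B) x j *: ebasis j) i = if i \in B then 0 else x i.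
  rewrite ell2DE ell2NE ell2_sumE.
  under eq_bigr do rewrite ell2ZE ebasisE.
  case: ifPn => iB.
    rewrite (big_fsetD1 i)//= eqxx mulr1 big_seq big1 ?addr0 ?subrr// => j.
    by rewrite !inE eq_sym => /andP[/negbTE -> _]; rewrite mulr0.
  rewrite big_seq big1 ?subr0// => j jB.
  by rewrite (_ : (i == j) = false) ?mulr0//; apply: contraNF iB => /eqP ->.
apply: AP => i; rewrite E.
  by case: ifP; rewrite ?normc0 ?expr0n /= ?lexx ?sqr_ge0.
by move=> iA; rewrite (fsubsetP AB _ iA) normc0 expr0n.
Qed.

(** Finite expansions in the basis converge to [x] and [T] is continuous, so the matrix determines
    [T]. Thus the Hilbert-Schmidt class can be handled as a space of square summable kernels. *)
Lemma kop_of_kernel T : hilbert_schmidt (H := ell2_hilbert R I) ebasis T ->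
  kop (kernel_of T) = T.
Proof.
move=> hT; have lK := hs_kernel hT; case: hT => -[linT contT] _.
apply/funext => x; apply: ell2_ext => i; rewrite kopE//.
have T0 : T 0 = 0.
  by have := linT (-1) 0 0; rewrite scaleN1r addNr scaleN1r addNr.
have Tsum (s : seq I) (c : I -> C) :
    T (\sum_(j <- s) c j *: ebasis j) = \sum_(j <- s) c j *: T (ebasis j).
  elim: s => [|j s IH]; first by rewrite !big_nil.
  by rewrite !big_cons -IH; exact: linT.
have cT : (fun A : {fset I} => T (\sum_(j <- A) x j *: ebasis j)) @ totally --> T x.
  have hT : T @ nbhs x --> T x by exact: contT.
  exact: (cvg_comp _ T (@cvg_ebasis x) hT).
(* Used for [p] the real and the imaginary part, through which the limit passes to coordinate
   [i]. *)
have coord (p : C -> R) : {morph p : a b / a + b} -> p 0 = 0 ->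
    (forall z, `|p z| <= normc z) ->
    rsum (fun j => p (kernel_of T (i, j) * x j)) = p (T x i).
  move=> pD p0 pn; apply: rsum_eq; apply/cvgrPdist_le => e e0.
  have /cvg_ell2P/(_ (e ^+ 2)) := cT; rewrite exprn_gt0// => /(_ isT).
  apply: filterS => A hA.
  have -> : \sum_(j <- A) p (kernel_of T (i, j) * x j) =
      p ((\sum_(j <- A) x j *: T (ebasis j)) i).
    rewrite ell2_sumE; elim: (enum_fset A) => [|j s IH]; first by rewrite !big_nil p0.
    by rewrite !big_cons IH pD ell2ZE mulrC.
  rewrite -Tsum.
  have pB a b : p (a - b) = p a - p b.
    by apply/eqP; rewrite eq_sym subr_eq -pD subrK.
  rewrite -pB; apply: le_trans (pn _) _.
  apply: le_trans (normc_le_nsq (T x - T (\sum_(j <- A) x j *: ebasis j)) i) _.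
  by rewrite -[leRHS](ger0_norm (ltW e0)) -sqrtr_sqr ler_wsqrtr.
rewrite /csum !coord//; first by case: (T x i).
- by move=> [a b] [].
- exact: ler_Im_normc.
- by move=> [a b] [].
- exact: ler_Re_normc.
Qed.

End Operators.

(** * Indicator masks and uniform approximation by simple functions *)

Section Masks.
Context {R : realType} d (X : measurableType d).
Local Notation C := R[i].

Lemma normc_indic (A : set X) x : normc (\1_A x : C) <= 1.
Proof. by rewrite indicE; case: (x \in A); rewrite ?normc1 ?normc0 ?ler01. Qed.

(** For pairwise disjoint [F k] this is the indicator of the union of those with [n <= k], the
    remainder in countable additivity. *)
Definition tail_mask (F : nat -> set X) (n : nat) (x : X) : C :=
  \1_(\bigcup_k F k) x - \sum_(0 <= k < n) \1_(F k) x.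

Lemma tail_maskE (F : nat -> set X) x : trivIset setT F ->
  (forall n, tail_mask F n x = 0) \/
  exists k, forall n, tail_mask F n x = (n <= k)%:R.
Proof.
move=> tF; have [[k _ Fk]|Fx] := pselect ((\bigcup_k F k) x); last first.
  left=> n; rewrite /tail_mask indicE memNset// big1 ?subrr// => k _.
  by rewrite indicE memNset// => Fk; apply: Fx; exists k.
right; exists k => n; rewrite /tail_mask indicE mem_set; last by exists k.
have E j : \1_(F j) x = (j == k)%:R :> C.
  have [->|jk] := eqVneq j k; first by rewrite indicE mem_set.
  rewrite indicE memNset// => Fj; move/eqP: jk; apply.
  by apply: (tF j k) => //; exists x.
rewrite (eq_bigr (fun j => (j == k)%:R)) => [|j _]; last exact: E.
have -> : \sum_(0 <= j < n) (j == k)%:R = (k < n)%:R :> C.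
  elim: n => [|n IH]; first by rewrite big_nil.
  rewrite big_nat_recr//= IH ltnS [in RHS]leq_eqVlt eq_sym.
  by case: ltngtP => _; rewrite ?addr0 ?add0r.
by rewrite ltnNge; case: (n <= k)%N; rewrite ?subr0 ?subrr.
Qed.

Lemma normc_tail_mask F n x : trivIset setT F -> normc (tail_mask F n x) <= 1.
Proof.
by move=> /tail_maskE -/(_ x)[->|[k ->]]; rewrite ?normc0//;
  case: (n <= k)%N; rewrite ?normc1 ?normc0.
Qed.

Lemma tail_mask_near F x : trivIset setT F ->
  \forall n \near \oo, tail_mask F n x = 0.
Proof.
move=> /tail_maskE -/(_ x)[h|[k h]]; first by apply: nearW.
by exists k.+1 => // n /= kn; rewrite h leqNgt kn.
Qed.

Lemma near_seq_all (T : Type) (I : eqType) (F : set_system T) {FF : Filter F}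
    (P : I -> T -> Prop) (s : seq I) :
  (forall i, \forall t \near F, P i t) ->
  \forall t \near F, forall i, i \in s -> P i t.
Proof.
move=> FP; elim: s => [|i s IH]; first by apply: nearW.
apply: filterS2 (FP i) IH => t Pi Ps j.
by rewrite inE => /orP[/eqP ->|/Ps].
Qed.

(** The sets are level sets of height [1 / n.+1], taken after a shift by [M] that makes the values
    nonnegative, so that [truncn] picks the cell of a point. *)
Lemma simple_real_approx (a : X -> R) (M : R) :
  measurable_fun setT a -> (forall x, `|a x| <= M) ->
  forall n : nat, exists s : seq (R * set X),
    (forall p, p \in s -> measurable p.2) /\
    forall x, `|a x - \sum_(p <- s) p.1 * \1_(p.2) x| <= n.+1%:R^-1.
Proof.
move=> ma aM n.
have [[x0 _]|nx] := pselect (exists x : X, True); last first.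
  by exists [::]; split=> // x; exfalso; apply: nx; exists x.
have M0 : 0 <= M := le_trans (normr_ge0 _) (aM x0).
pose N : R := n.+1%:R; have N0 : 0 < N by rewrite ltr0n.
pose b x := (a x + M) * N.
have b0 x : 0 <= b x.
  rewrite mulr_ge0 ?(ltW N0)//;
    have := aM x; rewrite ler_norml => /andP[h _]; by rewrite -lerBlDr sub0r.
pose cell (k : nat) : set X := [set x | k%:R <= b x < k.+1%:R].
pose K := (Num.truncn ((M + M) * N)).+1.
pose v (k : nat) : R := k%:R / N - M.
exists [seq (v k, cell k) | k <- iota 0 K]; split=> [p /mapP[k _ ->]/=|x].
  have mb : measurable_fun setT b.
    by apply: measurable_funM => //; apply: measurable_funD.
  have -> : cell k = setT `&` b @^-1` `[k%:R, k.+1%:R[%classic.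
    by rewrite setTI; apply/seteqP; split=> x /=; rewrite in_itv.
  by apply: mb => //; exact: measurable_itv.
pose k := Num.truncn (b x).
have /andP[k1 k2] : k%:R <= b x < k.+1%:R by exact: truncn_itv.
have kK : (k < K)%N.
  rewrite ltnS /k; apply: le_truncn.
  rewrite /b ler_wpM2r ?(ltW N0)// lerD2r; by have := aM x; rewrite ler_norml => /andP[].
have E j : \1_(cell j) x = (j == k)%:R :> R.
  have [->|jk] := eqVneq j k; first by rewrite indicE mem_set//; apply/andP.
  rewrite indicE memNset//= => /andP[j1 j2]; move/eqP: jk; apply; apply/eqP.
  rewrite eqn_leq -(ltnS j) -(ltnS k) -!(ltr_nat R); apply/andP; split.
    exact: le_lt_trans j1 k2.
  exact: le_lt_trans k1 j2.
rewrite big_map (_ : \sum_(j <- _) _ = v k); last first.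
  transitivity (\sum_(j <- iota 0 K) v j * (j == k)%:R).
    by apply: eq_bigr => j _; rewrite E.
  rewrite (bigD1_seq k) ?iota_uniq ?mem_iota ?kK// eqxx mulr1 big1 /= ?addr0//.
  by move=> j /negbTE ->; rewrite mulr0.
rewrite /v (_ : a x - _ = (b x - k%:R) / N); last first.
  by rewrite /b mulrBl mulfK ?gt_eqF//; ring.
rewrite ger0_norm; last by rewrite divr_ge0 ?(ltW N0)// ?subr_ge0.
by rewrite ler_pdivrMr// mulVf ?gt_eqF// lerBlDr addrC natr1 ltW.
Qed.

Lemma simple_fun_approx (Phi : X -> C) : cmeasurable Phi -> cbounded Phi ->
  exists s : nat -> seq (C * set X),
    (forall n p, p \in s n -> measurable p.2) /\
    forall eps : R, 0 < eps ->
      \forall n \near \oo, forall x, `|Phi x - simple_fun (s n) x| <= eps%:C.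
Proof.
move=> [mr mi] [M PM].
have PM' x : normc (Phi x) <= M by have := PM x; rewrite normcE' lecR.
have /choice[sr hr] := simple_real_approx mr (fun x => le_trans (ler_Re_normc _) (PM' x)).
have /choice[si hi] := simple_real_approx mi (fun x => le_trans (ler_Im_normc _) (PM' x)).
exists (fun n => [seq (p.1%:C, p.2) | p <- sr n] ++ [seq ('i%C * p.1%:C, p.2) | p <- si n]).
split=> [n p|e e0].
  rewrite mem_cat => /orP[] /mapP[q qs ->].
    exact: (hr n).1 qs.
  exact: (hi n).1 qs.
have e2 : 0 < e / 2 by rewrite divr_gt0.
near=> n => x.
have -> : simple_fun ([seq (p.1%:C, p.2) | p <- sr n] ++
    [seq ('i%C * p.1%:C, p.2) | p <- si n]) x =
    (\sum_(p <- sr n) p.1 * \1_(p.2) x) +i* (\sum_(p <- si n) p.1 * \1_(p.2) x).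
  rewrite /simple_fun big_cat !big_map /=.
  have E1 (s : seq (R * set X)) : \sum_(p <- s) p.1%:C * \1_(p.2) x =
      (\sum_(p <- s) p.1 * \1_(p.2) x)%:C.
    rewrite rmorph_sum; apply: eq_bigr => p _; rewrite rmorphM; congr (_ * _).
    by rewrite !indicE; case: (x \in p.2).
  have E2 : \sum_(p <- si n) 'i%C * p.1%:C * \1_(p.2) x =
      'i%C * (\sum_(p <- si n) p.1 * \1_(p.2) x)%:C.
    by rewrite -E1 mulr_sumr; apply: eq_bigr => p _; rewrite mulrA.
  by rewrite E1 E2 [RHS]complexE.
have h1 := (hr n).2 x; have h2 := (hi n).2 x.
move: h1 h2; set r := \sum_(p <- _) _; set i := \sum_(p <- _) _.
case: (Phi x) => a b /= h1 h2.
rewrite normcE' lecR (_ : _ - _ = (a - r)%:C + 'i%C * (b - i)%:C); last first.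
  by rewrite [LHS]complexE.
apply: le_trans (le_normcD _ _) _; rewrite normcM !normc_real.
rewrite (_ : normc 'i%C = 1); last by rewrite /= expr0n expr1n add0r sqrtr1.
rewrite mul1r; apply: le_trans (lerD h1 h2) _.
suff h : n.+1%:R^-1 <= e / 2 by rewrite [leRHS]splitr lerD.
rewrite -[e / 2]/((PosNum e2)%:num) ltW//.
by near: n; exact: near_infty_natSinv_lt.
Unshelve. all: by end_near. Qed.

End Masks.

(** * Linear combinations and Hilbert-Schmidt norms of kernels *)

Section KernelAlgebra.
Context {R : realType} {I : choiceType}.
Local Notation C := R[i].
Local Notation H := (ell2 R I).
Implicit Types (K L m : I * I -> C) (T : H -> H).

Lemma l2_mask (J : choiceType) (m K : J -> C) (M : R) :
  (forall p, normc (m p) <= M) -> l2 K -> l2 (fun p => m p * K p).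
Proof.
move=> mM lK; have := abs_summableZ (M ^+ 2) lK.
apply: abs_summable_le => p; rewrite ger0_norm ?sqr_ge0// normcM exprMn.
by rewrite ler_wpM2r ?sqr_ge0// ler_pXn2r ?nnegrE ?normc_ge0// (le_trans (normc_ge0 _) (mM p)).
Qed.

Lemma kop_lin c K L : l2 K -> l2 L ->
  kop (fun p => c * K p + L p) = c *: kop K + kop L :> (H -> H).
Proof.
move=> lK lL; apply/funext => x; apply: ell2_ext => i.
have lKL : l2 (fun p => c * K p + L p) by exact: l2D (l2Z c lK) lL.
rewrite kopE// -[RHS]/(c * kop K x i + kop L x i) !kopE//.
rewrite -csumZ -?csumD; first last.
- exact: csummable_row.
- exact: csummable_row.
- apply: csummable_le (abs_summableZ (normc c) (csummable_row i x lK)) => j.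
  by rewrite normcM.
by apply: csum_ext => j; ring.
Qed.

Lemma kop_sum (T : eqType) (s : seq T) (c : T -> C) (K : T -> I * I -> C) :
  (forall t, t \in s -> l2 (K t)) ->
  l2 (fun p => \sum_(t <- s) c t * K t p) /\
  kop (fun p => \sum_(t <- s) c t * K t p) = \sum_(t <- s) c t *: kop (K t) :> (H -> H).
Proof.
elim: s => [|t s IH] lK.
  have l0 : l2 (fun _ : I * I => 0 : C).
    by apply/l2P; exists 0 => A; rewrite big1// => i _; rewrite normc0 expr0n.
  have -> : (fun p : I * I => \sum_(t <- [::]) c t * K t p) = fun=> 0.
    by apply/funext => p; rewrite big_nil.
  split=> //; rewrite big_nil; apply/funext => x; apply: ell2_ext => i.
  by rewrite kopE// (@csum_ext _ _ _ (fun=> 0)) ?csum0// => j; rewrite mul0r.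
have [|l1 e1] := IH; first by move=> t' h; apply: lK; rewrite inE h orbT.
have lt : l2 (K t) by apply: lK; rewrite mem_head.
have -> : (fun p : I * I => \sum_(t' <- t :: s) c t' * K t' p) =
    fun p => c t * K t p + \sum_(t' <- s) c t' * K t' p.
  by apply/funext => p; rewrite big_cons.
split; first exact: l2D (l2Z _ lt) l1.
by rewrite kop_lin// e1 big_cons.
Qed.

Lemma kernel_of_lin c S T p :
  kernel_of (c *: S + T) p = c * kernel_of S p + kernel_of T p.
Proof. by []. Qed.

Lemma hs_norm_le K (M : R) : 0 <= M -> l2 K ->
  (forall D : {fset I * I}, \sum_(p <- D) normc (K p) ^+ 2 <= M) ->
  ip_norm (hs_dot (H := ell2_hilbert R I) (@ebasis R I)) (kop K) <= Num.sqrt M.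
Proof.
move=> M0 lK KM; rewrite /ip_norm; apply: ler_wsqrtr.
rewrite /hs_dot /summability.sum; set f := partial_sum _.
have fM A : complex.Re (f A) <= M.
  rewrite /f /partial_sum -(big_seq_fsetE _ A xpredT
    (fun i => hdot (ell2_hilbert R I) (kop K (ebasis i)) (kop K (ebasis i)))) /=.
  rewrite (_ : \sum_(i <- A) _ = (\sum_(i <- A) ell2_nsq (kop K (ebasis i)))%:C); last first.
    rewrite rmorph_sum; apply: eq_bigr => i _; exact: ell2_dotxx.
  have [s h] := rsum_sum A (fun j => ell2P (kop K (ebasis j))).
  rewrite [leLHS](_ : _ = \sum_(i <- A) rsum (fun j => normc (kop K (ebasis i) j) ^+ 2))//.
  rewrite -h; apply: rsum_le_ub => // B.
  under eq_bigr do under eq_bigr do rewrite kop_ebasis//.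
  rewrite (_ : \sum_(i <- B) _ = \sum_(p <- [seq (i, j) | i <- B, j <- A])
    normc (K p) ^+ 2); last by rewrite big_allpairs.
  by rewrite ge0_sum_seq_fset//; apply: allpairs_uniq => // -[? ?] [].
(* [hs_dot] is a limit; a divergent net would have the default limit [0], for which the bound is
   trivial. *)
have [cf|/dvgP ->] := pselect (cvg (f @ totally)); last by rewrite /=.
apply/ler_addgt0Pr => e e0.
have /cvgrPdist_le/(_ e%:C) := cf; rewrite ltcR => /(_ e0)[A _ /(_ A (fsubset_refl A))] /=.
rewrite normcE' lecR => h; have := fM A.
have := le_trans (ler_norm _) (le_trans (ler_Re_normc _) h).
set z := lim _; move: (f A) z => [a b] [a' b'] /=; lra.
Qed.

End KernelAlgebra.

(** Outside a finite set the squares of [K] sum to at most [e], and on that set the mask eventually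
    vanishes. The map [w] lets one statement serve both vectors and kernels. *)
Lemma tail_mask_sum_le {R : realType} {J : choiceType} d (X : measurableType d)
    (w : J -> X) (F : nat -> set X) (K : J -> R[i]) (e : R) :
  trivIset setT F -> l2 K -> 0 < e ->
  \forall n \near \oo, forall D : {fset J},
    \sum_(p <- D) normc (tail_mask F n (w p) * K p) ^+ 2 <= e.
Proof.
move=> tF lK e0.
have [A AP] := abs_summable_tail (fun p => sqr_ge0 (normc (K p))) lK e0.
have : \forall n \near \oo, forall p, p \in enum_fset A -> tail_mask F n (w p) = 0 :> R[i].
  by apply: near_seq_all => p; exact: tail_mask_near.
apply: filterS => n hn D; apply: AP => p; last first.
  by move=> pA; rewrite hn// mul0r normc0 expr0n.
rewrite sqr_ge0 normcM exprMn ler_piMl ?sqr_ge0//.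
by rewrite expr_le1 ?normc_ge0// normc_tail_mask.
Qed.

(** * Diagonal spectral measures *)

Section DiagonalSpectralMeasure.
Context {R : realType} {I : choiceType} d (X : measurableType d) (z : I -> X).
Local Notation C := R[i].
Local Notation H := (ell2 R I).
Implicit Types (x u v : H) (K : I * I -> C) (T : H -> H).

Lemma indic_conj (Y : Type) (A : set Y) y : Num.conj (\1_A y : C) = \1_A y.
Proof. by rewrite indicE; case: (y \in A); rewrite ?rmorph1 ?rmorph0. Qed.

Lemma indic_idem (Y : Type) (A : set Y) y (c : C) : \1_A y * (\1_A y * c) = \1_A y * c.
Proof. by rewrite indicE; case: (y \in A); rewrite ?mul1r ?mul0r. Qed.

(** The pure point spectral measure that places the basis vector [ebasis i] at the point [z i];
    several vectors may share a point. *)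
Definition diag_measure (A : set X) (x : H) : H := mkell2 (fun i => \1_A (z i) * x i).

Lemma diag_measureE A x i : diag_measure A x i = \1_A (z i) * x i.
Proof.
rewrite mkell2E//; apply: (l2_mask (M := 1)) (ell2P x) => j.
exact: normc_indic.
Qed.

Lemma ip_normE x : ip_norm (hdot (ell2_hilbert R I)) x = Num.sqrt (ell2_nsq x).
Proof. by rewrite /ip_norm -[hdot _ _ _]/(ell2_dot x x) ell2_dotxx. Qed.

Lemma diag_spectral_measure :
  spectral_measure setT (hdot (ell2_hilbert R I)) diag_measure.
Proof.
split => //.
- move=> A mA c u v _ _; apply: ell2_ext => i.
  rewrite diag_measureE -[RHS]/(c * diag_measure A u i + diag_measure A v i).
  by rewrite !diag_measureE ell2DE ell2ZE; ring.
- by move=> A mA v _; apply: ell2_ext => i; rewrite !diag_measureE indic_idem.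
- move=> A mA u v _ _; rewrite -[LHS]/(ell2_dot _ _) -[RHS]/(ell2_dot _ _).
  by apply: csum_ext => i; rewrite !diag_measureE rmorphM /= indic_conj; ring.
- move=> v _; apply: ell2_ext => i.
  by rewrite diag_measureE indicE mem_set// mul1r.
- move=> F mF tF v _; apply/cvgrPdist_le => e e0.
  have e2 : 0 < e ^+ 2 by rewrite exprn_gt0.
  have := tail_mask_sum_le z tF (ell2P v) e2; apply: filterS => n hn.
  rewrite sub0r normrN ip_normE ger0_norm ?sqrtr_ge0//.
  rewrite -[leRHS](ger0_norm (ltW e0)) -sqrtr_sqr ler_wsqrtr//.
  apply: ell2_nsq_le => A; apply: le_trans (hn A).
  rewrite le_eqVlt; apply/orP; left; apply/eqP; apply: eq_bigr => i _.
  congr (normc _ ^+ 2); rewrite ell2DE ell2NE ell2_sumE /tail_mask mulrBl.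
  rewrite diag_measureE; congr (_ - _); rewrite mulr_suml.
  by apply: eq_bigr => k _; rewrite diag_measureE.
Qed.

Let zz (p : I * I) := (z p.1, z p.2).

(** Composing [T] with the projections of [A] and [B] multiplies its entry [(i, j)] by the indicator
    of the rectangle at [(z i, z j)]. The formula extends this from rectangles to all measurable
    sets. *)
Definition mask_measure (D : set (X * X)) (T : H -> H) : H -> H :=
  kop (fun p => \1_D (zz p) * kernel_of T p).

Lemma l2_mask_measure D T : hilbert_schmidt (H := ell2_hilbert R I) (@ebasis R I) T ->
  l2 (fun p => \1_D (zz p) * kernel_of T p).
Proof. by move=> /hs_kernel; apply: l2_mask => p; exact: normc_indic. Qed.

Lemma mask_spectral_measure : spectral_measure
  (hilbert_schmidt (H := ell2_hilbert R I) (@ebasis R I))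
  (hs_dot (H := ell2_hilbert R I) (@ebasis R I)) mask_measure.
Proof.
split.
- by move=> D mD T hT; apply: kop_hilbert_schmidt; exact: l2_mask_measure.
- move=> D mD c u v hu hv; rewrite /mask_measure.
  rewrite -kop_lin; [|exact: l2_mask_measure|exact: l2_mask_measure].
  congr kop; apply/funext => p; rewrite kernel_of_lin; ring.
- move=> D mD T hT; rewrite /mask_measure kernel_of_kop; last exact: l2_mask_measure.
  by congr kop; apply/funext => p; exact: indic_idem.
- move=> D mD u v hu hv; rewrite /hs_dot.
  apply: f_equal; apply/funext => j.
  rewrite -[LHS]/(ell2_dot _ _) -[RHS]/(ell2_dot _ _).
  apply: csum_ext => i.
  rewrite !kop_ebasis; [|exact: l2_mask_measure|exact: l2_mask_measure].
  by rewrite rmorphM /= indic_conj /kernel_of /=; ring.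
- move=> T hT; rewrite -[RHS](kop_of_kernel hT); congr kop.
  by apply/funext => p; rewrite indicE mem_set// mul1r.
- move=> F mF tF T hT; apply/cvgrPdist_le => e e0.
  have e2 : 0 < e ^+ 2 by rewrite exprn_gt0.
  have := tail_mask_sum_le zz tF (hs_kernel hT) e2; apply: filterS => n hn.
  rewrite sub0r normrN ger0_norm ?sqrtr_ge0//.
  have lFT k : l2 (fun p => \1_(F k) (zz p) * kernel_of T p) by exact: l2_mask_measure.
  have [l1 E] := kop_sum (s := index_iota 0 n) (fun=> 1) (fun k _ => lFT k).
  have -> : mask_measure (\bigcup_k F k) T - \sum_(0 <= k < n) mask_measure (F k) T =
      kop (fun p => tail_mask F n (zz p) * kernel_of T p).
    have -> : \sum_(0 <= k < n) mask_measure (F k) T =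
        \sum_(k <- index_iota 0 n) 1 *: kop (fun p => \1_(F k) (zz p) * kernel_of T p).
      by apply: eq_bigr => k _; rewrite scale1r.
    rewrite -E addrC -scaleN1r -kop_lin//; last exact: l2_mask_measure.
    congr kop; apply/funext => p; rewrite /tail_mask mulrBl addrC mulN1r mulr_suml.
    by congr (_ - _); apply: eq_bigr => k _; rewrite mul1r.
  rewrite -[leRHS](ger0_norm (ltW e0)) -sqrtr_sqr.
  apply: hs_norm_le => //; first exact: ltW.
  by apply/l2P; exists (e ^+ 2).
Qed.

Lemma mask_double_spectral_measure :
  is_double_spectral_measure (H := ell2_hilbert R I) (@ebasis R I)
    diag_measure diag_measure mask_measure.
Proof.
split; first exact: mask_spectral_measure.
move=> A B mA mB T hT; apply/funext => x; apply: ell2_ext => i.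
rewrite -[RHS]/(diag_measure A (T (diag_measure B x)) i) diag_measureE.
have lT := hs_kernel hT.
rewrite -[in RHS](kop_of_kernel hT) [in RHS]kopE// -csumZ; last exact: csummable_row.
rewrite [LHS]kopE; last exact: l2_mask_measure.
apply: csum_ext => j; rewrite diag_measureE /= [\1_(_ `*` _) _]indicE in_setX.
by rewrite !indicE; case: (z i \in A); case: (z j \in B); rewrite /= ?(mul0r, mul1r, mulr0).
Qed.

(** For atomic measures the double operator integral is entrywise multiplication by
    [Phi (z i, z j)]: uniform convergence of the simple functions gives convergence of the masked
    kernels in Hilbert-Schmidt norm. *)
Lemma mask_double_operator_integral (Phi : X * X -> C) T :
  cmeasurable Phi -> cbounded Phi ->
  hilbert_schmidt (H := ell2_hilbert R I) (@ebasis R I) T ->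
  is_double_operator_integral (H := ell2_hilbert R I) (@ebasis R I)
    diag_measure diag_measure Phi T (kop (fun p => Phi (zz p) * kernel_of T p)).
Proof.
move=> mP bP hT; exists mask_measure; first exact: mask_double_spectral_measure.
have lT := hs_kernel hT; have [M PM] := bP.
have lP : l2 (fun p => Phi (zz p) * kernel_of T p).
  apply: (l2_mask (m := fun p => Phi (zz p)) (M := M)) lT => p.
  by rewrite -lecR -normcE'.
split; first exact: kop_hilbert_schmidt.
have [s [ms hs]] := simple_fun_approx mP bP; exists s; split=> //.
apply/cvgrPdist_le => e e0.
have N0 : 0 <= knsq (kernel_of T) by exact: knsq_ge0.
(* The added [1] keeps the denominator positive when [T] is zero. *)
pose eps := e / (Num.sqrt (knsq (kernel_of T)) + 1).
have S0 : 0 < Num.sqrt (knsq (kernel_of T)) + 1 by rewrite ltr_wpDl ?sqrtr_ge0.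
have eps0 : 0 < eps by rewrite divr_gt0.
have := hs _ eps0; apply: filterS => n hn.
rewrite sub0r normrN ger0_norm ?sqrtr_ge0//.
have [l1 E] := kop_sum (s := s n) (fun p => p.1)
  (fun p (_ : p \in s n) => l2_mask_measure p.2 hT).
rewrite /mask_measure -E addrC -scaleN1r -kop_lin//.
set K := (fun p => _).
have KE p : K p = (Phi (zz p) - simple_fun (s n) (zz p)) * kernel_of T p.
  rewrite /K mulrBl addrC mulN1r /simple_fun mulr_suml; congr (_ - _).
  by apply: eq_bigr => q _; rewrite mulrA.
have KD (D : {fset I * I}) : \sum_(p <- D) normc (K p) ^+ 2 <= eps ^+ 2 * knsq (kernel_of T).
  apply: (@le_trans _ _ (\sum_(p <- D) eps ^+ 2 * normc (kernel_of T p) ^+ 2)).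
    apply: ler_sum => p _; rewrite KE normcM exprMn ler_wpM2r ?sqr_ge0//.
    rewrite ler_pXn2r ?nnegrE ?normc_ge0 ?(ltW eps0)//.
    by have := hn (zz p); rewrite normcE' lecR.
  rewrite -mulr_sumr ler_wpM2l ?sqr_ge0//; apply: rsum_ge_fset lT => p; exact: sqr_ge0.
have lK : l2 K by apply/l2P; exists (eps ^+ 2 * knsq (kernel_of T)).
apply: le_trans (hs_norm_le _ lK KD) _; first by rewrite mulr_ge0// sqr_ge0.
rewrite sqrtrM ?sqr_ge0// sqrtr_sqr ger0_norm ?(ltW eps0)// /eps mulrAC ler_pdivrMr//.
by rewrite ler_wpM2l ?(ltW e0)// lerDl.
Qed.

End DiagonalSpectralMeasure.

(** * Diagonal coefficients of trace class operators *)

Section MatrixTrace.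
Context {R : realType}.
Local Notation C := R[i].
Local Notation adj M := (map_mx Num.conj M^T).

Lemma conj_mxM m n p (A : 'M[C]_(m, n)) (B : 'M[C]_(n, p)) : adj (A *m B) = adj B *m adj A.
Proof. by rewrite trmx_mul map_mxM. Qed.

Lemma conj_mxK m n (A : 'M[C]_(m, n)) : adj (adj A) = A.
Proof. by apply/matrixP => i j; rewrite !mxE conjCK. Qed.

Lemma gram_diagonalization n (a : 'M[C]_n) : exists W : 'M[C]_n, exists D : 'rV[C]_n,
  [/\ W *m adj W = 1%:M, adj W *m W = 1%:M & W *m (adj a *m a) *m adj W = diag_mx D].
Proof.
have nb : (adj a *m a) \is normalmx by apply/normalmxP; rewrite conj_mxM conj_mxK.
have uW := spectral_unitarymx (adj a *m a).
have W1 := unitarymxP uW.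
have W2 : adj (spectralmx (adj a *m a)) *m spectralmx (adj a *m a) = 1%:M.
  by rewrite -(invmx_unitary uW) mulVmx ?spectral_unit.
exists (spectralmx (adj a *m a)), (spectral_diag (adj a *m a)); split=> //.
have /orthomx_spectralP := nb; rewrite (invmx_unitary uW) => {2}->.
by rewrite !mulmxA W1 mul1mx -mulmxA W1 mulmx1.
Qed.

Lemma gram_diagE n (B : 'M[C]_n) k :
  complex.Re ((adj B *m B) k k) = \sum_(m < n) normc (B m k) ^+ 2.
Proof.
rewrite mxE (_ : \sum_(j < n) _ = (\sum_(m < n) normc (B m k) ^+ 2)%:C)//.
rewrite rmorph_sum; apply: eq_bigr => m _.
by rewrite !mxE mulrC -normCK normcE' -rmorphXn.
Qed.

(** The right side is the sum of the singular values of [a]. In [X a (adj X) = B U] column [k] of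
    [B] has norm [sqrt (D 0 k)] and row [k] of [U] has norm [1]; Cauchy-Schwarz is applied for each
    [k]. *)
Lemma diagonal_sum_le n (a X W : 'M[C]_n) (D : 'rV[C]_n) :
  X *m adj X = 1%:M -> W *m adj W = 1%:M ->
  W *m (adj a *m a) *m adj W = diag_mx D ->
  \sum_(m < n) normc ((X *m a *m adj X) m m) <=
  \sum_(k < n) Num.sqrt (complex.Re (D 0 k)).
Proof.
move=> X1 W1 WD; have X2 := mulmx1C X1; have W2 := mulmx1C W1.
pose B := X *m a *m adj W; pose U := W *m adj X.
have BU : X *m a *m adj X = B *m U.
  by rewrite /B /U -!mulmxA; congr (_ *m (_ *m _)); rewrite mulmxA W2 mul1mx.
have BB : adj B *m B = diag_mx D.
  rewrite -WD /B !conj_mxM conj_mxK -!mulmxA; congr (_ *m (_ *m _)).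
  by rewrite !mulmxA X2 mul1mx.
have DE k : complex.Re (D 0 k) = \sum_(m < n) normc (B m k) ^+ 2.
  by rewrite -gram_diagE BB mxE eqxx mulr1n.
have UE k : \sum_(m < n) normc (U k m) ^+ 2 = 1.
  have := gram_diagE (adj U) k; rewrite conj_mxK.
  have -> : U *m adj U = 1%:M.
    by rewrite /U conj_mxM conj_mxK -mulmxA (mulmxA (adj X)) X2 mul1mx.
  rewrite mxE eqxx /= => ->; apply: eq_bigr => m _.
  by rewrite !mxE normcJ'.
apply: (@le_trans _ _ (\sum_(m < n) \sum_(k < n) normc (B m k) * normc (U k m))).
  apply: ler_sum => m _; rewrite BU mxE.
  elim/big_ind2 : _ => [|x y u v h1 h2|k _].
  - by rewrite normc0.
  - by apply: le_trans (le_normcD _ _) _; exact: lerD.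
  - by rewrite normcM.
rewrite exchange_big; apply: ler_sum => k _.
rewrite -[leRHS]mulr1 -[X in _ <= _ * X]sqrtr1.
by apply: sum_mul_le => [m|m||]; rewrite ?normc_ge0 ?DE ?UE.
Qed.

End MatrixTrace.

Lemma Re_sum {R : realType} (T : Type) (s : seq T) (F : T -> R[i]) :
  complex.Re (\sum_(t <- s) F t) = \sum_(t <- s) complex.Re (F t).
Proof.
elim: s => [|t s IH]; first by rewrite !big_nil.
by rewrite !big_cons -IH; case: (F t) (\sum_(i <- s) F i) => a b [].
Qed.

Lemma Im_sum {R : realType} (T : Type) (s : seq T) (F : T -> R[i]) :
  complex.Im (\sum_(t <- s) F t) = \sum_(t <- s) complex.Im (F t).
Proof.
elim: s => [|t s IH]; first by rewrite !big_nil.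
by rewrite !big_cons -IH; case: (F t) (\sum_(i <- s) F i) => a b [].
Qed.

Section TraceClassBlocks.
Context {R : realType} {I : choiceType}.
Local Notation C := R[i].
Local Notation H := (ell2 R I).
Local Notation adj M := (map_mx Num.conj M^T).
Local Notation dot := (@ell2_dot R I).

Lemma dotDl (x y z : H) : dot (x + y) z = dot x z + dot y z.
Proof. exact: linearDl. Qed.
Lemma dotZl c (x z : H) : dot (c *: x) z = c * dot x z.
Proof. exact: linearZl_LR. Qed.
Lemma dotDr (x y z : H) : dot z (x + y) = dot z x + dot z y.
Proof. exact: linearDr. Qed.
Lemma dotZr c (x z : H) : dot z (c *: x) = Num.conj c * dot z x.
Proof. exact: linearZr_LR. Qed.
Lemma dot_suml (T : Type) (s : seq T) (F : T -> H) z :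
  dot (\sum_(t <- s) F t) z = \sum_(t <- s) dot (F t) z.
Proof.
elim: s => [|t s IH]; last by rewrite !big_cons dotDl IH.
by rewrite !big_nil; have := dotZl 0 0 z; rewrite scale0r mul0r.
Qed.
Lemma dot_sumr (T : Type) (s : seq T) (F : T -> H) z :
  dot z (\sum_(t <- s) F t) = \sum_(t <- s) dot z (F t).
Proof.
elim: s => [|t s IH]; last by rewrite !big_cons dotDr IH.
by rewrite !big_nil; have := dotZr 0 0 z; rewrite scale0r rmorph0 mul0r.
Qed.

Lemma rsum_fset (f : I -> R) (A : {fset I}) :
  (forall i, i \notin A -> f i = 0) -> rsum f = \sum_(i <- A) f i.
Proof.
move=> fA; apply: rsum_eq; apply: cvg_near_cst.
apply: filterS (totally_ge A) => B AB.
by rewrite -(big_fset_incl _ AB)// => i _; exact: fA.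
Qed.

Lemma csum_codom (n : nat) (b : 'I_n -> I) (f : I -> C) : injective b ->
  (forall q, q \notin codom b -> f q = 0) -> csum f = \sum_(i < n) f (b i).
Proof.
move=> injb fb; pose A := [fset i in [seq b i | i <- enum 'I_n]]%fset.
have fA q : q \notin A -> f q = 0.
  by rewrite inE => qA; apply: fb.
have sumA (V : nmodType) (g : I -> V) : \sum_(i <- A) g i = \sum_(i < n) g (b i).
  transitivity (\sum_(i <- [seq b i | i <- enum 'I_n]) g i); last by rewrite big_map big_enum.
  apply: perm_big; apply: uniq_perm => //; last by move=> i; rewrite inE.
  by rewrite map_inj_uniq ?enum_uniq.
rewrite /csum (@rsum_fset _ A) => [|q /fA ->]//.
rewrite (@rsum_fset _ A) => [|q /fA ->]//.
rewrite !sumA.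
by rewrite -Re_sum -Im_sum; case: (\sum_(i < n) f (b i)).
Qed.

Lemma dot_ge0 (x : H) : 0 <= dot x x.
Proof. by rewrite ell2_dotxx ler0c ell2_nsq_ge0. Qed.

Lemma dot_eq0 (x : H) : dot x x = 0 -> x = 0.
Proof.
move=> x0; apply/eqP; apply: contraTT (isT) => /ell2_dot_gt0.
by rewrite x0 ltxx.
Qed.

Lemma linear_sumE (T : Type) (s : seq T) (c : T -> C) (F : T -> H) (P : H -> H) :
  linear P -> P (\sum_(t <- s) c t *: F t) = \sum_(t <- s) c t *: P (F t).
Proof.
move=> linP; have P0 : P 0 = 0.
  by have := linP (-1) 0 0; rewrite scaleN1r addNr scaleN1r addNr.
elim: s => [|t s IH]; first by rewrite !big_nil.
by rewrite !big_cons -IH; exact: linP.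
Qed.

(* An eigenvector of [P \o P] for the eigenvalue [m ^+ 2] with [0 < m] is an
   eigenvector of the positive operator [P] for [m]. *)
Lemma positive_sqrt_eigen (P : H -> H) (v : H) (m : R) :
  linear P -> (forall x, 0 <= dot (P x) x) -> 0 <= m ->
  P (P v) = (m ^+ 2)%:C *: v -> dot v v = 1 -> m <= complex.Re (dot (P v) v).
Proof.
move=> linP posP m0 PPv v1.
have [->|mn0] := eqVneq m 0.
  by have := posP v; rewrite lecE => /andP[].
(* [P y = - m y], which positivity of [P] allows only for [y = 0]. *)
pose y := P v - m%:C *: v.
have Py : P y = - m%:C *: y.
  have -> : P y = P (P v) - m%:C *: P v.
    by rewrite /y addrC -scaleNr linP scaleNr addrC.
  by rewrite PPv /y scalerBr scalerA mulNr !scaleNr opprK -rmorphM -expr2 addrC.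
have y0 : y = 0.
  apply: dot_eq0; have := posP y; rewrite Py dotZl ell2_dotxx -rmorphN -rmorphM ler0c.
  rewrite mulNr oppr_ge0 pmulr_rle0 ?lt_neqAle 1?eq_sym ?mn0// => h.
  by congr (_%:C); apply/eqP; rewrite eq_le h ell2_nsq_ge0.
have -> : P v = m%:C *: v by apply/eqP; rewrite -subr_eq0; apply/eqP.
by rewrite dotZl v1 mulr1.
Qed.

(** No nonzero entry of the kernel links the block to its complement, so the right singular vectors
    of the block are eigenvectors of [P \o P]. The trace of [P] over the block therefore dominates
    the sum of the singular values. *)
Lemma trace_class_blocks (K : I * I -> C) (n : nat) (b : 'I_n -> I)
  (P : H -> H) (M : R) : l2 K -> injective b ->
  (forall p q, K (p, q) != 0 -> (p \in codom b) = (q \in codom b)) ->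
  is_modulus (H := ell2_hilbert R I) (kop K) P ->
  (forall A : {fset I}, \sum_(i <- A) complex.Re (dot (P (ebasis i)) (ebasis i)) <= M) ->
  forall X : 'M[C]_n, X *m adj X = 1%:M ->
  \sum_(m < n) normc ((X *m (\matrix_(i, j) K (b i, b j)) *m adj X) m m) <= M.
Proof.
move=> lK injb Kb [[linP _] posP PP] PM X X1.
set a := \matrix_(i, j) _.
have [W [D [W1 W2 WD]]] := gram_diagonalization a.
apply: le_trans (diagonal_sum_le X1 W1 WD) _.
pose w i k : C := (adj W) i k.
(* Column [k] of [adj W], an eigenvector of [adj a *m a] for [D 0 k], extended by zero outside the
   block. *)
pose v k : H := \sum_(i < n) w i k *: ebasis (b i).
have dot_eb i j : dot (ebasis (b i)) (ebasis (b j)) = (i == j)%:R.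
  by rewrite dot_ebasis ebasisE eq_sym (inj_eq injb).
have vE k j : dot (v k) (ebasis (b j)) = w j k.
  rewrite /v dot_suml (bigD1 j)//= dotZl dot_eb eqxx mulr1 big1 ?addr0// => i ij.
  by rewrite dotZl dot_eb (negbTE ij) mulr0.
have v1 k : dot (v k) (v k) = 1.
  rewrite {2}/v dot_sumr; under eq_bigr do rewrite dotZr vE.
  have <- : (W *m adj W) k k = 1 by rewrite W1 mxE eqxx.
  by rewrite mxE; apply: eq_bigr => i _; rewrite /w !mxE conjCK.
have Kv k : kop K (v k) = \sum_(i < n) w i k *: kop K (ebasis (b i)).
  exact: linear_sumE (kop_linear lK).
have dotKb i j : dot (kop K (ebasis (b i))) (kop K (ebasis (b j))) = (adj a *m a) j i.
  rewrite mxE /ell2_dot (@csum_codom _ b _ injb) => [|q qb].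
    by apply: eq_bigr => l _; rewrite !kop_ebasis// !mxE mulrC.
  rewrite !kop_ebasis//; have [->|Kqi] := eqVneq (K (q, b i)) 0; first by rewrite mul0r.
  by move: qb; rewrite (Kb _ _ Kqi) codom_f.
(* Checked coordinate by coordinate through the defining identity of the modulus; off the block both
   sides vanish by [Kb]. *)
have PPv k : P (P (v k)) = D 0 k *: v k.
  apply: ell2_ext => p; rewrite -!dot_ebasis dotZl.
  rewrite -[dot _ _]/(hdot (ell2_hilbert R I) _ _) PP -[hdot _ _ _]/(dot _ _).
  rewrite Kv dot_suml; under eq_bigr do rewrite dotZl.
  have [/codomP[j ->]|pb] := boolP (p \in codom b).
    rewrite vE (eq_bigr (fun i => (adj a *m a) j i * w i k)); last first.
      by move=> i _; rewrite dotKb mulrC.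
    have /matrixP/(_ j k) : adj a *m a *m adj W = adj W *m diag_mx D.
      by rewrite -WD !mulmxA W2 mul1mx.
    by rewrite mul_mx_diag [LHS]mxE [RHS]mxE [RHS]mulrC => <-.
  rewrite (_ : dot (v k) (ebasis p) = 0) ?mulr0; last first.
    rewrite /v dot_suml big1// => i _; rewrite dotZl dot_ebasis ebasisE.
    rewrite (_ : (p == b i) = false) ?mulr0//.
    by apply: contraNF pb => /eqP ->; exact: codom_f.
  rewrite big1// => i _; rewrite [dot _ _](_ : _ = 0) ?mulr0//.
  rewrite /ell2_dot (@csum_ext _ _ _ (fun=> 0)) ?csum0// => q; rewrite !kop_ebasis//.
  have [->|Kqi] := eqVneq (K (q, b i)) 0; first by rewrite mul0r.
  have [->|Kqp] := eqVneq (K (q, p)) 0; first by rewrite rmorph0 mulr0.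
  by move: pb; rewrite -(Kb _ _ Kqp) (Kb _ _ Kqi) codom_f.
have D0 k : D 0 k = (Num.sqrt (complex.Re (D 0 k)) ^+ 2)%:C.
  have : 0 <= D 0 k.
    rewrite -[D 0 k]mulr1 -(v1 k) -dotZl -PPv.
    by rewrite -[dot _ _]/(hdot (ell2_hilbert R I) _ _) PP; exact: dot_ge0.
  by case: (D 0 k) => x y; rewrite lecE /= => /andP[/eqP -> x0]; rewrite sqr_sqrtr.
apply: (@le_trans _ _ (\sum_(k < n) complex.Re (dot (P (v k)) (v k)))).
  apply: ler_sum => k _.
  apply: (positive_sqrt_eigen linP posP (sqrtr_ge0 _) _ (v1 k)).
  by rewrite -D0 PPv.
pose p i j := dot (P (ebasis (b i))) (ebasis (b j)).
(* The [v k] and the [ebasis (b i)] are orthonormal bases of the same finite-dimensional space, so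
   the traces of [P] agree. *)
have trP : \sum_(k < n) dot (P (v k)) (v k) = \sum_(i < n) p i i.
  transitivity (\sum_(k < n) \sum_(i < n) \sum_(j < n) p i j * (w i k * Num.conj (w j k))).
    apply: eq_bigr => k _; rewrite {1}/v linear_sumE// dot_suml; apply: eq_bigr => i _.
    rewrite dotZl /v dot_sumr mulr_sumr; apply: eq_bigr => j _.
    by rewrite dotZr /p; ring.
  rewrite exchange_big; apply: eq_bigr => i _ /=.
  rewrite exchange_big (bigD1 i)//= [X in _ + X]big1 ?addr0.
    rewrite -mulr_sumr (_ : \sum_(k < n) _ = (adj W *m W) i i).
      by rewrite W2 mxE eqxx mulr1.
    by rewrite mxE; apply: eq_bigr => k _; rewrite /w !mxE conjCK.
  move=> j ji; rewrite -mulr_sumr (_ : \sum_(k < n) _ = (adj W *m W) i j).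
    by rewrite W2 mxE eq_sym (negbTE ji) mulr0.
  by rewrite mxE; apply: eq_bigr => k _; rewrite /w !mxE conjCK.
rewrite -Re_sum trP Re_sum.
have := PM [fset i in [seq b i | i <- enum 'I_n]]%fset.
rewrite -ge0_sum_seq_fset; last by rewrite map_inj_uniq ?enum_uniq.
by rewrite big_map big_enum.
Qed.

End TraceClassBlocks.

(** A convergent net keeps its limit along a cofinal family, so partial sums can be arranged to
    contain whole blocks. *)
Lemma rsum_cofinal_ge {R : realType} {I : choiceType} (f : I -> R) (c : R) :
  abs_summable f ->
  (forall A : {fset I}, exists2 A' : {fset I}, (A `<=` A')%fset & c <= \sum_(i <- A') f i) ->
  c <= rsum f.
Proof.
move=> sf fc; apply/ler_addgt0Pr => e e0.
have /cvgrPdist_le/(_ e e0)[A _ AP] := cvg_rsum sf.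
have [A' AA' cA'] := fc A.
apply: le_trans cA' _; have := AP _ AA'; rewrite /= ler_norml => /andP[h _].
by lra.
Qed.

(** Joining the first [L] full blocks to [A] leaves, apart from them, only pairs outside all blocks,
    where [F] vanishes. *)
Lemma block_cofinal (N : nat -> nat) (A : {fset nat * nat}) :
  exists L : nat, exists2 A' : {fset nat * nat}, (A `<=` A')%fset &
  forall (V : nmodType) (F : nat * nat -> V),
    (forall p, ~~ (p.2 < N p.1)%N -> F p = 0) ->
    \sum_(p <- A') F p = \sum_(0 <= n < L) \sum_(0 <= i < N n) F (n, i).
Proof.
pose L := (\max_(p <- A) p.1).+1.
pose s := [seq (n, i) | n <- index_iota 0 L, i <- index_iota 0 (N n)].
have mems n i : (n < L)%N -> (i < N n)%N -> (n, i) \in s.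
  by move=> nL iN; rewrite /s; apply/allpairsPdep; exists n, i; rewrite !mem_index_iota.
have us : uniq s.
  apply: allpairs_uniq_dep => [|n _|[a b] [c d] _ _ /= [-> ->]]//; exact: iota_uniq.
have sums (V : nmodType) (F : nat * nat -> V) :
    \sum_(p <- s) F p = \sum_(0 <= n < L) \sum_(0 <= i < N n) F (n, i).
  exact: big_allpairs_dep.
have AL p : p \in A -> (p.1 < L)%N.
  by move=> pA; rewrite ltnS; exact: (@leq_bigmax_seq _ _ _ (fun p => p.1)).
move: (s) (L) mems us sums AL => {L} {}s L mems us sums AL.
exists L; exists (A `|` [fset p in s])%fset; first exact: fsubsetUl.
move=> V F F0.
rewrite -(big_fset_incl _ (fsubsetUr A [fset p in s]%fset)) => [|p]; last first.
  rewrite !inE => /orP[pA|->]// ps; apply: F0; apply: contra ps => pN.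
  by case: p pA pN => n i /AL nL iN; exact: mems.
rewrite -sums.
by apply: perm_big; apply: uniq_perm => // p; rewrite inE.
Qed.

(** * Characters and roots of unity *)

Section Cis.
Context {R : realType}.
Local Notation C := R[i].

Definition cis (x : R) : C := cos x +i* sin x.

Lemma cis0 : cis 0 = 1. Proof. by rewrite /cis cos0 sin0. Qed.

Lemma cisD x y : cis (x + y) = cis x * cis y.
Proof. by apply/eqP; rewrite eq_complex /= cosD sinD eqxx /= addrC [sin x * _]mulrC mulrC. Qed.

Lemma cis_conj x : Num.conj (cis x) = cis (- x).
Proof. by rewrite /cis cosN sinN. Qed.

Lemma cisX x n : cis x ^+ n = cis (n%:R * x).
Proof.
elim: n => [|n IH]; first by rewrite mul0r cis0.
by rewrite exprS IH -cisD -natr1 mulrDl mul1r addrC.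
Qed.

Lemma cis_2pi n : cis (n%:R * (pi *+ 2)) = 1.
Proof. by rewrite -cisX /cis cos2pi sin2pi expr1n. Qed.

Lemma cis_neq1 x : 0 < x < pi *+ 2 -> cis x != 1.
Proof.
move=> /andP[x0 x2]; rewrite eq_complex /= negb_and; apply/orP; left.
have -> : x = (x / 2) *+ 2 by rewrite -mulr_natr divfK.
rewrite cos_mulr2n cos2sin2.
have s0 : 0 < sin (x / 2).
  by apply: sin_gt0_pi; rewrite divr_gt0//= ltr_pdivrMr// mulr_natr.
apply/negP => /eqP h; have : sin (x / 2) ^+ 2 = 0.
  by move: h; rewrite mulrnBl => h; lra.
by move/eqP; rewrite expf_eq0 /= gt_eqF.
Qed.

Lemma sum_roots_of_unity (N : nat) (m k : nat) : (m < N)%N -> (k < N)%N -> m != k ->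
  \sum_(i < N) cis (i%:R * ((m%:R - k%:R) * (pi *+ 2) / N%:R)) = 0.
Proof.
move=> mN kN mk; have N0 : (0 < N)%N by exact: leq_ltn_trans mN.
have NR : N%:R != 0 :> R by rewrite pnatr_eq0 -lt0n.
set x := (_ * (pi *+ 2) / _).
under eq_bigr do rewrite -cisX.
have w1 : cis x != 1.
  (* For [k < m] this applies directly; the case [m < k] follows by conjugation. *)
  have H (a b : nat) : (b < a < N)%N -> cis ((a%:R - b%:R) * (pi *+ 2) / N%:R) != 1.
    move=> /andP[ba aN]; apply: cis_neq1.
    have p2 : 0 < pi *+ 2 :> R by rewrite pmulrn_lgt0// pi_gt0.
    rewrite divr_gt0 ?ltr0n// ?mulr_gt0 ?subr_gt0 ?ltr_nat//=.
    rewrite ltr_pdivrMr ?ltr0n// mulrC ltr_pM2l//.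
    by rewrite ltrBlDr ltr_wpDr// ltr_nat.
  have [km|mk'|e] := ltngtP k m; first by apply: H; rewrite km.
    apply/negP => /eqP e; have /negP := H _ _ (introT andP (conj mk' kN)); apply.
    rewrite -[_ / _]opprK -cis_conj -[X in _ == X](rmorph1 Num.conj).
    rewrite (_ : - _ = x) ?e// /x.
    by rewrite -!mulNr opprB.
  by rewrite e eqxx in mk.
have : (cis x - 1) * (\sum_(i < N) cis x ^+ i) = 0.
  rewrite -subrX1 cisX (_ : _ * x = (m%:R - k%:R) * (pi *+ 2)).
    by rewrite mulrBl cisD cis_2pi -cis_conj cis_2pi rmorph1 mulr1 subrr.
  by rewrite /x mulrC divfK.
by move/eqP; rewrite mulf_eq0 subr_eq0 (negbTE w1) => /eqP.
Qed.

End Cis.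

Lemma conj_real {R : realType} (r : R) : Num.conj (r%:C : R[i]) = r%:C.
Proof. exact: conjc_real. Qed.

(** * The Toeplitz bound *)

Section BlockOperator.
Context {R : realType} (N : nat -> nat) (N0 : forall n, (0 < N n)%N).
Local Notation C := R[i].
Local Notation I := (nat * nat)%type.
Local Notation H := (ell2 R (nat * nat)%type).
Local Notation dot := (@ell2_dot R (nat * nat)%type).

(** Block [n] is [2 ^- n] times the projection onto constant vectors: its trace [2 ^- n] is spread
    evenly over [N n] diagonal entries. *)
Definition bweight (n : nat) : R := (2 ^+ n)^-1 / (N n)%:R.

Lemma bweight_ge0 n : 0 <= bweight n.
Proof. by rewrite divr_ge0 ?invr_ge0 ?exprn_ge0. Qed.

Lemma bweightM n : bweight n * (N n)%:R = (2 ^+ n)^-1.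
Proof. by rewrite divfK// pnatr_eq0 -lt0n. Qed.

Definition bkernel (p : I * I) : C :=
  if [&& p.1.1 == p.2.1, (p.1.2 < N p.1.1)%N & (p.2.2 < N p.2.1)%N]
  then (bweight p.1.1)%:C else 0.

Lemma sum_inv2X (L : nat) : \sum_(0 <= n < L) (2 ^+ n)^-1 <= 2 :> R.
Proof.
suff -> : \sum_(0 <= n < L) (2 ^+ n)^-1 = 2 - 2 * (2 ^+ L)^-1 :> R.
  by rewrite lerBlDr lerDl mulr_ge0// invr_ge0 exprn_ge0.
elim: L => [|L IH]; first by rewrite big_nil expr0 invr1 mulr1 subrr.
rewrite big_nat_recr//= IH exprS invfM mulrA divff ?mul1r; last by rewrite pnatr_eq0.
by rewrite mulr_natl mulr2n; lra.
Qed.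

Lemma bweight_sum_le (A : {fset I}) :
  \sum_(p <- A) (if (p.2 < N p.1)%N then bweight p.1 else 0) <= 2.
Proof.
have [L [A' AA' E]] := block_cofinal N A.
apply: (@le_trans _ _ (\sum_(p <- A') (if (p.2 < N p.1)%N then bweight p.1 else 0))).
  by apply: ler_sum_fset => // p; case: ifP => // _; exact: bweight_ge0.
rewrite E => [|p /negbTE ->]//; apply: le_trans (sum_inv2X L).
rewrite le_eqVlt; apply/orP; left; apply/eqP; apply: eq_bigr => n _.
rewrite (eq_big_nat _ _ (F2 := fun=> bweight n)) => [|i /andP[_ ->]]//.
by rewrite sumr_const_nat subn0 -[_ *+ N _]mulr_natr bweightM.
Qed.

Lemma l2_bkernel : l2 bkernel.
Proof.
suff H (A B : {fset I}) : \sum_(p <- A) \sum_(q <- B) normc (bkernel (p, q)) ^+ 2 <= 2.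
  by have [] := l2_prodP H.
apply: le_trans (bweight_sum_le A); apply: ler_sum => p _.
have [L [B' BB' E]] := block_cofinal N B.
apply: (@le_trans _ _ (\sum_(q <- B') normc (bkernel (p, q)) ^+ 2)).
  by apply: ler_sum_fset => // q; exact: sqr_ge0.
rewrite E => [|q /negbTE qN]; last by rewrite /bkernel /= qN !andbF normc0 expr0n.
case: p => n i; rewrite /bkernel /=.
have [iN|iN] := boolP (i < N n)%N; last first.
  by rewrite big1// => m _; rewrite big1// => j _; rewrite andbF normc0 expr0n.
apply: (@le_trans _ _ (\sum_(0 <= m < L) (if m == n then bweight n else 0))).
  apply: ler_sum => m _; have [<-|mn] := eqVneq n m; last first.
    by rewrite big1// => j _; rewrite normc0 expr0n.
  rewrite (eq_big_nat _ _ (F2 := fun=> bweight n ^+ 2)) => [|j /andP[_ ->]]; last first.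
    by rewrite normc_real ger0_norm// bweight_ge0.
  rewrite sumr_const_nat subn0 -[_ *+ N _]mulr_natr expr2 -mulrA bweightM ler_piMr ?bweight_ge0//.
  by rewrite invf_le1 ?exprn_gt0// exprn_ege1// ler1n.
rewrite -big_mkcond /=; elim: L {E} => [|L IH]; first by rewrite big_geq// bweight_ge0.
rewrite big_mkcond big_nat_recr//= -big_mkcond.
case: eqP => [->|_]; last by rewrite addr0.
rewrite big_nat_cond big1 ?add0r// => m /andP[/andP[_ mn] /eqP e].
by rewrite e ltnn in mn.
Qed.

Definition bop : H -> H := kop bkernel.

Definition bsum (x : H) (n : nat) : C := \sum_(0 <= j < N n) x (n, j).

Lemma bopE x n i :
  bop x (n, i) = if (i < N n)%N then (bweight n)%:C * bsum x n else 0.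
Proof.
rewrite /bop kopE; last exact: l2_bkernel.
have injb : injective (fun j : 'I_(N n) => (n, nat_of_ord j)).
  by move=> j k [/val_inj].
rewrite (@csum_codom _ _ _ _ _ injb) => [|[m j] mj]; last first.
  rewrite /bkernel /=; case: ifP => [/and3P[/eqP nm iN jN]|_]; last by rewrite mul0r.
  exfalso; move/negP: mj; apply; apply/codomP; subst m.
  by exists (Ordinal jN).
rewrite /bkernel /=; case: ifP => iN; last first.
  by rewrite big1// => j _; rewrite andbF mul0r.
rewrite /bsum big_mkord mulr_sumr; apply: eq_bigr => j _.
by rewrite eqxx ltn_ord.
Qed.

Lemma csummable_dot (x y : H) : csummable (fun p => x p * Num.conj (y p)).
Proof. exact: csummableM (ell2P x) (l2J (ell2P y)). Qed.

Lemma bop_partial (x y : H) L : 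
  \sum_(0 <= n < L) \sum_(0 <= i < N n) bop x (n, i) * Num.conj (y (n, i)) =
  \sum_(0 <= n < L) (bweight n)%:C * (bsum x n * Num.conj (bsum y n)).
Proof.
apply: eq_bigr => n _.
rewrite /(bsum y n) rmorph_sum !mulr_sumr big_nat_cond [RHS]big_nat_cond.
by apply: eq_bigr => i /andP[/andP[_ iN] _]; rewrite bopE iN mulrA.
Qed.

Lemma bop_sym x y : dot (bop x) y = dot x (bop y).
Proof.
have s1 := csummable_dot (bop x) y; have s2 := csummable_dot x (bop y).
(* The two families of terms agree only after summation over whole blocks, so their sums are
   compared along a cofinal family, by inequalities in both directions. *)
have E (A : {fset I}) : exists2 A' : {fset I}, (A `<=` A')%fset &
   \sum_(p <- A') bop x p * Num.conj (y p) = \sum_(p <- A') x p * Num.conj (bop y p).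
  have [L [A' AA' EA]] := block_cofinal N A; exists A' => //.
  rewrite !EA; last 2 first.
    by move=> [n i] /negbTE iN; rewrite bopE iN rmorph0 mulr0.
    by move=> [n i] /negbTE iN; rewrite bopE iN mul0r.
  rewrite bop_partial -[RHS]conjCK rmorph_sum.
  under [in RHS]eq_bigr => n _.
    rewrite rmorph_sum (eq_bigr (fun i => bop y (n, i) * Num.conj (x (n, i)))); last first.
      by move=> i _; rewrite rmorphM /= conjCK mulrC.
    over.
  rewrite bop_partial rmorph_sum; apply: eq_bigr => n _.
  by rewrite !(rmorphM Num.conj) /= conjCK conj_real; ring.
have eqsum (pr : C -> R) : {morph pr : a b / a + b >-> a + b} -> pr 0 = 0 ->
    abs_summable (fun p => pr (bop x p * Num.conj (y p))) ->
    abs_summable (fun p => pr (x p * Num.conj (bop y p))) ->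
    rsum (fun p => pr (bop x p * Num.conj (y p))) =
    rsum (fun p => pr (x p * Num.conj (bop y p))).
  move=> prD pr0 a1 a2.
  have le0 (f g : I -> C) : abs_summable (fun p => pr (f p)) ->
      abs_summable (fun p => pr (g p)) ->
      (forall A : {fset I}, exists2 A' : {fset I}, (A `<=` A')%fset &
        \sum_(p <- A') f p = \sum_(p <- A') g p) ->
      rsum (fun p => pr (f p)) <= rsum (fun p => pr (g p)).
    move=> sf sg fg; have sN := abs_summableZ (-1) sf.
    rewrite -subr_ge0 -mulN1r -rsumZ// -rsumD//.
    apply: rsum_cofinal_ge => [|A]; first exact: abs_summableD.
    have [A' AA' e] := fg A; exists A' => //.
    rewrite big_split /= -mulr_sumr -!(big_morph pr prD pr0) e mulN1r.
    by rewrite subrr.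
  apply/eqP; rewrite eq_le !le0// => A; have [A' AA' e] := E A; exists A' => //.
rewrite /ell2_dot /csum; congr Complex; apply: eqsum => //.
- by move=> [? ?] [].
- exact: csummable_Re.
- exact: csummable_Re.
- by move=> [? ?] [].
- exact: csummable_Im.
- exact: csummable_Im.
Qed.

Lemma bop_ge0 x : 0 <= dot (bop x) x.
Proof.
have s1 := csummable_dot (bop x) x.
have Im0 : complex.Im (dot (bop x) x) = 0.
  have : Num.conj (dot (bop x) x) = dot (bop x) x.
    by rewrite [RHS]bop_sym [RHS]ell2_dot_herm mul1r.
  case: (dot (bop x) x) => a b; rewrite -[Num.conj _]/(a -i* b) => -[h].
  by rewrite /=; lra.
rewrite lecE Im0 eqxx /=; apply: rsum_cofinal_ge => [|A]; first exact: csummable_Re.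
have [L [A' AA' EA]] := block_cofinal N A; exists A' => //.
rewrite -Re_sum EA; last by move=> [n i] /negbTE iN; rewrite bopE iN mul0r.
rewrite bop_partial Re_sum; apply: sumr_ge0 => n _.
by rewrite -normCK normcE' -rmorphXn -rmorphM /= mulr_ge0 ?bweight_ge0 ?sqr_ge0.
Qed.

(** A positive operator is its own modulus, and the diagonal entries here sum to at most [2]. *)
Lemma bop_trace_class : trace_class (H := ell2_hilbert R I) (@ebasis R I) bop.
Proof.
split; first exact/kop_bounded/l2_bkernel.
exists bop.
  split; [exact/kop_bounded/l2_bkernel|exact: bop_ge0|].
  by move=> x y; exact: bop_sym.
suff : abs_summable (fun p : I => if (p.2 < N p.1)%N then bweight p.1 else 0).
  rewrite -(propext (esum_ltyP _)); last first.
    by move=> p; case: ifP => // _; exact: bweight_ge0.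
  rewrite (_ : (fun j => _) = fun p => (complex.Re (hdot (ell2_hilbert R I)
    (bop (ebasis p)) (ebasis p)))%:E)//.
  apply/funext => p; rewrite -[hdot _ _ _]/(dot _ _) dot_ebasis.
  rewrite /bop kop_ebasis; last exact: l2_bkernel.
  by rewrite /bkernel /= eqxx andbb; case: ifP.
apply/ge0_abs_summableP; last by exists 2 => A; exact: bweight_sum_le.
by move=> p; case: ifP => // _; exact: bweight_ge0.
Qed.

End BlockOperator.

Section ToeplitzBound.
Context {R : realType}.
Local Notation C := R[i].

(* [N * toeplitz_mean h N delta xi] is the Fejer mean at [xi] of the samples of [h] on the
   grid of step [delta]. *)
Definition toeplitz_mean (h : R -> C) (N : nat) (delta xi : R) : C :=
  ((N%:R ^+ 2)^-1)%:C * \sum_(i < N) \sum_(j < N)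
    h ((i%:R - j%:R) * delta) * cis (- ((i%:R - j%:R) * delta * xi)).

(** Without a bound, sizes, steps and phases with sums above [4 ^ n] exist for every [n]. Against
    the weights [2 ^- n] of the trace class operator [bop], block [n] of its transform would still
    force a trace above [2 ^ n]. *)
Lemma toeplitz_bound d (X : measurableType d) (Phi : X * X -> C) (t : R -> X) (h : R -> C) :
  schur_multipliers R X X Phi -> (forall r s, Phi (t r, t s) = h (s - r)) ->
  exists M : R, forall (N : nat) (delta eta : R), (0 < N)%N -> 0 < delta ->
    \sum_(m < N) normc (toeplitz_mean h N delta
      (eta + m%:R * (pi *+ 2) / (N%:R * delta))) <= M.
Proof.
move=> [mP bP schurP] Ph; apply: contrapT => nobound.
have /choice[Nde hNde] : forall n : nat, exists Nde : nat * R * R,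
    [/\ (0 < Nde.1.1)%N, 0 < Nde.1.2 & 4 ^+ n < \sum_(m < Nde.1.1) normc
     (toeplitz_mean h Nde.1.1 Nde.1.2
      (Nde.2 + m%:R * (pi *+ 2) / (Nde.1.1%:R * Nde.1.2)))].
  move=> n; apply: contrapT => hn; apply: nobound; exists (4 ^+ n) => N delta eta N0 d0.
  by rewrite leNgt; apply/negP => lt; apply: hn; exists (N, delta, eta).
pose N n := (Nde n).1.1; pose de n := (Nde n).1.2; pose eta n := (Nde n).2.
have N0 n : (0 < N n)%N by case: (hNde n).
have d0 n : 0 < de n by case: (hNde n).
(* The minus sign turns [h (s - r)] into [h ((i - j) delta)] at the entry [(i, j)]. *)
pose z (p : nat * nat) : X := t (- (p.2%:R * de p.1)).
have TT := bop_trace_class (R := R) N0.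
have lK := l2_bkernel (R := R) N0.
have hT : hilbert_schmidt (H := ell2_hilbert R _) (@ebasis R _) (@bop R N).
  exact: kop_hilbert_schmidt.
have := schurP _ _ _ (@orthonormal_ebasis R (nat * nat)%type) _ _
  (diag_spectral_measure z) (diag_spectral_measure z) _ _ TT
  (mask_double_operator_integral z mP bP hT).
set K := (fun p => _); have KE p q : K (p, q) = Phi (z p, z q) * bkernel N (p, q).
  by rewrite /K kernel_of_kop.
have [M PM] := bP.
have lK' : l2 K.
  apply: (l2_mask (m := fun p => Phi (z p.1, z p.2)) (M := M)) _ => [p|].
    by rewrite -lecR -normcE'.
  by rewrite kernel_of_kop.
move=> [_ [P modP]]; have [[linP _] posP _] := modP.
have P0 i : 0 <= complex.Re (ell2_dot (P (ebasis i)) (ebasis i)).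
  by have := posP (ebasis i); rewrite lecE => /andP[].
move=> /(esum_ltyP P0)/(ge0_abs_summableP P0)[B PB].
have main n : 2 ^+ n <= B.
  pose b (i : 'I_(N n)) : nat * nat := (n, nat_of_ord i).
  have injb : injective b by move=> i j [/val_inj].
  have bE (p : nat * nat) : (p \in codom b) = (p.1 == n) && (p.2 < N p.1)%N.
    apply/codomP/andP => [[i ->]|[/eqP p1 p2]]; first by rewrite eqxx ltn_ord.
    by case: p p1 p2 => m j /= -> jN; exists (Ordinal jN).
  pose xi (m : nat) := eta n + m%:R * (pi *+ 2) / ((N n)%:R * de n).
  (* The rows are normalized characters with frequencies [xi m]. These differ by multiples of
     [2 pi / (N delta)], which makes the rows orthonormal whatever the phase [eta n]. *)
  pose Xm : 'M[C]_(N n) := \matrix_(m, i)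
    (((Num.sqrt (N n)%:R)^-1)%:C * cis (- (i%:R * de n * xi m))).
  have NR : (N n)%:R != 0 :> R by rewrite pnatr_eq0 -lt0n.
  have sqN : ((Num.sqrt (N n)%:R)^-1)%:C * ((Num.sqrt (N n)%:R)^-1)%:C =
      (((N n)%:R)^-1)%:C :> C.
    by rewrite -rmorphM /= -invfM -expr2 sqr_sqrtr.
  have X1 : Xm *m (map_mx Num.conj Xm^T) = 1%:M.
    apply/matrixP => m k; rewrite mxE.
    rewrite (eq_bigr (fun i : 'I_(N n) => (((N n)%:R)^-1)%:C *
        cis (i%:R * (((k:nat)%:R - (m:nat)%:R) * (pi *+ 2) / (N n)%:R)))); last first.
      move=> i _; rewrite !mxE rmorphM /= cis_conj conj_real mulrACA sqN -cisD.
      congr (_ * cis _); rewrite /xi.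
      have dn := lt0r_neq0 (d0 n). field. exact/andP.
    rewrite -mulr_sumr mxE; have [->|mk] := eqVneq m k.
      rewrite (eq_bigr (fun=> 1)) => [|i _]; last first.
        by rewrite subrr !mul0r mulr0 cis0.
      rewrite sumr_const card_ord -[1 *+ _]/((N n)%:R) -(rmorph_nat (real_complex R)).
      by rewrite -rmorphM /= mulVf.
    rewrite sum_roots_of_unity ?mulr0//.
    by rewrite eq_sym.
  have Kb p q : K (p, q) != 0 -> (p \in codom b) = (q \in codom b).
    rewrite KE !bE /bkernel /=; case: ifP => [/and3P[/eqP -> -> ->]//|_].
    by rewrite mulr0 eqxx.
  have := trace_class_blocks lK' injb Kb modP PB X1.
  apply: le_trans.
  rewrite (eq_bigr (fun m : 'I_(N n) => (2 ^+ n)^-1 * normc (toeplitz_mean h (N n) (de n) (xi m)))).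
    rewrite -mulr_sumr ler_pdivlMl ?exprn_gt0// -exprMn ltW//.
    by have [_ _] := hNde n; rewrite -natrM.
  move=> m _.
  rewrite (_ : (Xm *m _ *m _) m m = ((2 ^+ n)^-1)%:C * toeplitz_mean h (N n) (de n) (xi m)).
    by rewrite normcM normc_real ger0_norm// invr_ge0 exprn_ge0.
  rewrite mxE /toeplitz_mean mulrA exchange_big mulr_sumr.
  apply: eq_bigr => j _; rewrite mxE mulr_suml mulr_sumr.
  apply: eq_bigr => i _; rewrite !mxE KE Ph /bkernel /= eqxx !ltn_ord /=.
  rewrite (_ : - (_ * de n) - - (_ * de n) = (i%:R - j%:R) * de n); last by ring.
  rewrite (_ : cis (- ((i%:R - j%:R) * de n * xi m)) =
    cis (- (i%:R * de n * xi m)) * cis (j%:R * de n * xi m)); last first.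
    by rewrite -cisD; congr cis; ring.
  rewrite (rmorphM Num.conj) /= cis_conj opprK conj_real.
  rewrite (_ : (bweight N n)%:C = ((2 ^+ n)^-1)%:C * (((N n)%:R)^-1)%:C); last first.
    by rewrite -rmorphM.
  rewrite (_ : (((N n)%:R ^+ 2)^-1)%:C = (((N n)%:R)^-1)%:C * (((N n)%:R)^-1)%:C); last first.
    by rewrite -rmorphM /= -invfM expr2.
  by rewrite -{2}sqN; ring.
have h1 := main (Num.truncn B).+1; have h2 := truncnS_gt B.
have h3 : (Num.truncn B).+1%:R <= 2 ^+ (Num.truncn B).+1 :> R.
  by rewrite -natrX ler_nat ltnW// ltn_expl.
by have := lt_le_trans h2 (le_trans h3 h1); rewrite ltxx.
Qed.

End ToeplitzBound.

(** * Integrals on the line *)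

Section RintegralLemmas.
Context d (T : measurableType d) {R : realType} (mu : {measure set T -> \bar R}).
Implicit Types f g : T -> R.

Definition rintegrable f := mu.-integrable setT (EFin \o f).

Lemma rintegrable_measurable f : rintegrable f -> measurable_fun setT f.
Proof. by move=> /measurable_int /measurable_EFinP. Qed.

Lemma rintegrable_le f g : measurable_fun setT f -> (forall x, `|f x| <= g x) ->
  rintegrable g -> rintegrable f.
Proof.
move=> mf fg; apply: le_integrable => //; first exact/measurable_EFinP.
by move=> x _; rewrite /= lee_fin (le_trans (fg x))// ler_norm.
Qed.

Lemma rintegrable_norm f : rintegrable f -> rintegrable (fun x => `|f x|).
Proof. exact: integrable_norm. Qed.

Lemma rintegrableD f g : rintegrable f -> rintegrable g -> rintegrable (fun x => f x + g x).
Proof. exact: integrableD. Qed.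

Lemma rintegrableZ c f : rintegrable f -> rintegrable (fun x => c * f x).
Proof. exact: integrableZl. Qed.

Lemma rintegrable0 : rintegrable (fun=> 0).
Proof. exact: integrable0. Qed.

Lemma rintegrable_sum (I : Type) (s : seq I) (f : I -> T -> R) :
  (forall i, rintegrable (f i)) ->
  rintegrable (fun x => \sum_(i <- s) f i x) /\
  \int[mu]_x (\sum_(i <- s) f i x) = \sum_(i <- s) \int[mu]_x f i x.
Proof.
move=> hf; elim: s => [|i s [IH1 IH2]].
  have -> : (fun x => \sum_(i <- [::]) f i x) = fun=> 0.
    by apply/funext => x; rewrite big_nil.
  by rewrite big_nil; split; [exact: rintegrable0|rewrite Rintegral_cst// mul0r].
have -> : (fun x => \sum_(i <- i :: s) f i x) = fun x => f i x + \sum_(i <- s) f i x.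
  by apply/funext => x; rewrite big_cons.
split; first exact: rintegrableD.
by rewrite big_cons -IH2; apply: RintegralD => //; exact: hf.
Qed.

Lemma rdominated_convergence (f_ : nat -> T -> R) f g :
  (forall n, measurable_fun setT (f_ n)) ->
  (forall x, f_ n x @[n --> \oo] --> f x) -> rintegrable g ->
  (forall n x, `|f_ n x| <= g x) ->
  rintegrable f /\ \int[mu]_x f_ n x @[n --> \oo] --> \int[mu]_x f x.
Proof.
move=> mf cf ig fg.
have mlim : measurable_fun setT f.
  exact: (measurable_fun_cvg (h := f_)).
have mE n : measurable_fun setT (EFin \o f_ n) by exact/measurable_EFinP.
have mEf : measurable_fun setT (EFin \o f) by exact/measurable_EFinP.
have cE : {ae mu, forall x, setT x -> (fun n => (EFin \o f_ n) x) @ \oo --> (EFin \o f) x}.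
  by apply: aeW => x _; apply: cvg_EFin; [exact: nearW|exact: cf].
have bE : {ae mu, forall x n, setT x -> (`|(EFin \o f_ n) x| <= (EFin \o g) x)%E}.
  by apply: aeW => x n _; rewrite /= lee_fin.
have [i1 _ c1] := dominated_convergence measurableT mE mEf cE ig bE.
split=> //; apply: (fine_cvg (f := fun n => (\int[mu]_x (f_ n x)%:E)%E)).
rewrite fineK//; exact: integrable_fin_num.
Qed.

Lemma Rintegral_norm_le f g : rintegrable f -> rintegrable g ->
  (forall x, `|f x| <= g x) -> `|\int[mu]_x f x| <= \int[mu]_x g x.
Proof.
move=> fi gi fg; apply: le_trans (le_normr_Rintegral _ _) _ => //.
by apply: le_Rintegral => //; exact: integrable_norm.
Qed.

Lemma rintegrable_mul_bounded f g (M : R) :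
  rintegrable f -> measurable_fun setT g ->
  (forall x, `|g x| <= M) -> rintegrable (fun x => f x * g x).
Proof.
move=> fi mg gM; have mf := rintegrable_measurable fi.
apply: (@rintegrable_le _ (fun x => M * `|f x|)).
- exact: measurable_funM.
- by move=> x; rewrite normrM mulrC ler_wpM2r.
- exact: rintegrableZ (rintegrable_norm fi).
Qed.

End RintegralLemmas.

Section LebesgueLine.
Context {R : realType}.
Local Notation mu := (@lebesgue_measure R).
Implicit Types f F : R -> R.

Lemma oneDsqr_gt0 (x : R) : 0 < oneDsqr x.
Proof. exact: lt_le_trans ltr01 (oneDsqr_ge1 x). Qed.

Lemma rintegrable_oneDsqrV : rintegrable mu (fun x : R => (oneDsqr x)^-1).
Proof.
have m1 : measurable_fun setT (fun x : R => (oneDsqr x)^-1).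
  by apply: continuous_measurable_fun; exact: continuous_oneDsqrV.
apply/integrableP; split; first exact/measurable_EFinP.
rewrite [X in (X < _)%E](_ : _ = \int[mu]_x ((oneDsqr x)^-1)%:E)%E; last first.
  by apply: eq_integral => x _; rewrite /= ger0_norm// invr_ge0 ltW// oneDsqr_gt0.
rewrite ge0_symfun_integralT.
- by rewrite -set_itvcy integral0y_oneDsqr -EFinM ltry.
- by move=> x; rewrite invr_ge0 ltW// oneDsqr_gt0.
- exact: continuous_oneDsqrV.
- by move=> x /=; rewrite /oneDsqr sqrrN.
Qed.

(** [oneDsqr x] is [1 + x ^ 2], whose inverse is integrable. This class contains both the Schwartz
    functions and their transforms. *)
Definition decaying f := exists K : R, forall x, `|f x| <= K * (oneDsqr x)^-1.

Lemma decaying_rintegrable f : measurable_fun setT f -> decaying f -> rintegrable mu f.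
Proof.
move=> mf [K fK].
apply: (@rintegrable_le _ _ _ mu f (fun x => K * (oneDsqr x)^-1)) => //.
exact: rintegrableZ rintegrable_oneDsqrV.
Qed.

Definition window (r : R) : R -> R := \1_(`[-r, r]%classic).

Lemma windowE r x : window r x = (`|x| <= r)%R%:R.
Proof.
by rewrite /window indicE ler_norml mem_setE in_itv.
Qed.

Lemma measurable_window r : measurable_fun setT (window r).
Proof. by apply: measurable_indic; exact: measurable_itv. Qed.

Lemma window_cvg f (r : nat -> R) x :
  r n @[n --> \oo] --> +oo -> (f x * window (r n) x) @[n --> \oo] --> f x.
Proof.
move=> ry; apply: cvg_near_cst.
have /cvgryPge/(_ `|x|) := ry; apply: filterS => n xn.
by rewrite windowE xn mulr1.
Qed.

Lemma window_rintegral f (r : nat -> R) : rintegrable mu f ->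
  r n @[n --> \oo] --> +oo ->
  \int[mu]_x (f x * window (r n) x) @[n --> \oo] --> \int[mu]_x f x.
Proof.
move=> fi ry; have mf := rintegrable_measurable fi.
apply: (rdominated_convergence _ _ (rintegrable_norm fi) _).2.
- by move=> n; apply: measurable_funM => //; exact: measurable_window.
- by move=> x; exact: window_cvg.
- move=> n x; rewrite windowE normrM ler_piMr//.
  by rewrite normr_nat lern1 leq_b1.
Qed.

(** The integral over [[-n, n]] is [F n - F (- n)] and converges to the integral over the line. Used
    with explicit primitives, this replaces integration by parts. *)
Lemma FTC_line F f : (forall x : R, is_derive x 1 F (f x)) -> continuous f ->
  rintegrable mu f -> F n%:R @[n --> \oo] --> 0 -> F (- n%:R) @[n --> \oo] --> 0 ->
  \int[mu]_x f x = 0.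
Proof.
move=> dF cf fi F0 FN0.
have ny : n%:R @[n --> \oo] --> (+oo : set_system R) by exact: cvgr_idn.
have cF : continuous F.
  by move=> x; apply: differentiable_continuous; apply/derivable1_diffP; case: (dF x).
have := window_rintegral fi ny.
have E (n : nat) : (0 < n)%N ->
    \int[mu]_x (f x * window n%:R x) = F n%:R - F (- n%:R).
  move=> n0; have nn : - n%:R < n%:R :> R by rewrite -subr_gt0 opprK addr_gt0 ?ltr0n.
  have := @continuous_FTC2 R f F _ _ nn.
  move=> /(_ _ _ _)/(congr1 fine) /= <-.
  - rewrite -[LHS]/(Rintegral mu setT (fun x => f x * window n%:R x)).
    rewrite -[RHS]/(Rintegral mu `[- n%:R, n%:R] f) [RHS]Rintegral_mkcond.
    apply: eq_Rintegral => x _; rewrite windowE patchE mem_setE in_itv /= -ler_norml.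
    by case: ifP => _; rewrite ?mulr1 ?mulr0.
  - exact: continuous_subspaceT.
  - split.
    + by move=> x _; case: (dF x).
    + by apply: cvg_at_right_filter; exact: cF.
    + by apply: cvg_at_left_filter; exact: cF.
  - by move=> x _; rewrite derive1E; case: (dF x).
have c0 : (F n%:R - F (- n%:R)) @[n --> \oo] --> (0 - 0 : R) by exact: cvgB.
move=> cI; rewrite subr0 in c0.
apply: (cvg_unique _ cI) => //.
apply: cvg_trans c0; apply: near_eq_cvg.
by exists 1%N => // n /= n0; rewrite E.
Qed.

End LebesgueLine.

Section Calculus.
Context {R : realType}.
Local Notation mu := (@lebesgue_measure R).
Implicit Types a f : R -> R.

Lemma lipschitz_of_derive (f df : R -> R) (K : R) :
  (forall x : R, is_derive x 1 f (df x)) -> (forall x, `|df x| <= K) ->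
  forall x y, `|f x - f y| <= K * `|x - y|.
Proof.
move=> dF dK.
have H x y : x < y -> `|f y - f x| <= K * `|y - x|.
  move=> xy; have [|c _ ->] := @MVT R f df x y xy (fun z _ => dF z).
    apply: continuous_subspaceT => z.
    by apply: differentiable_continuous; apply/derivable1_diffP; case: (dF z).
  by rewrite normrM ler_wpM2r.
move=> x y; have [xy|yx|->] := ltgtP x y.
- by rewrite distrC (distrC x y) H.
- exact: H.
- by rewrite !subrr normr0 mulr0.
Qed.

Lemma ler_norm_cosB (u v : R) : `|cos u - cos v| <= `|u - v|.
Proof.
rewrite -[leRHS]mul1r; apply: (lipschitz_of_derive (df := fun x => - sin x)) => x.
by rewrite normrN ler_norml sin_geN1 sin_le1.
Qed.

Lemma ler_norm_sinB (u v : R) : `|sin u - sin v| <= `|u - v|.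
Proof.
rewrite -[leRHS]mul1r; apply: (lipschitz_of_derive (df := fun x => cos x)) => x.
by rewrite ler_norml cos_geN1 cos_le1.
Qed.

Lemma ler_norm_cos (x : R) : `|cos x| <= 1.
Proof. by rewrite ler_norml cos_geN1 cos_le1. Qed.

Lemma ler_norm_sin (x : R) : `|sin x| <= 1.
Proof. by rewrite ler_norml sin_geN1 sin_le1. Qed.

Lemma lipschitz_continuous f (K : R) :
  (forall x y, `|f x - f y| <= K * `|x - y|) -> continuous f.
Proof.
move=> fK x; apply/cvgrPdist_le => e e0.
have K0 : 0 < `|K| + 1 by rewrite ltr_wpDl.
near=> y; apply: le_trans (fK x y) _.
apply: (@le_trans _ _ ((`|K| + 1) * `|x - y|)).
  by rewrite ler_wpM2r// (le_trans (ler_norm _))// lerDl.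
rewrite mulrC -ler_pdivlMr//; near: y.
by apply: cvgr_dist_le => //; exact: divr_gt0.
Unshelve. all: by end_near. Qed.

Lemma decaying_cvg0 f (u : nat -> R) : decaying f ->
  (forall n, n%:R <= `|u n|) -> f (u n) @[n --> \oo] --> 0.
Proof.
move=> [K fK] nu; apply/cvgrPdist_le => e e0; near=> n.
rewrite sub0r normrN; apply: le_trans (fK _) _.
rewrite ler_pdivrMr ?oneDsqr_gt0//.
have n0 : `|K| / e <= n%:R by near: n; exact: nbhs_infty_ger.
rewrite ler_pdivrMr// in n0.
apply: le_trans (ler_norm _) (le_trans n0 _).
rewrite mulrC ler_wpM2l ?(ltW e0)//; apply: le_trans (nu n) _.
rewrite /oneDsqr -real_normK ?num_real//.
by have := sqr_ge0 (`|u n| - 1); have := normr_ge0 (u n); nra.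
Unshelve. all: by end_near. Qed.

Lemma decayingD f g : decaying f -> decaying g -> decaying (fun x => f x + g x).
Proof.
move=> [K fK] [L gL]; exists (K + L) => x; rewrite mulrDl.
by apply: le_trans (ler_normD _ _) _; exact: lerD.
Qed.

Lemma decayingM f g (M : R) : decaying f -> (forall x, `|g x| <= M) ->
  decaying (fun x => f x * g x).
Proof.
move=> [K fK] gM; exists (K * M) => x; rewrite normrM mulrAC.
exact: ler_pM.
Qed.

End Calculus.

(** * Fourier transforms of Schwartz functions *)

Section FourierSchwartz.
Context {R : realType}.
Local Notation mu := (@lebesgue_measure R).
Implicit Types a f : R -> R.

Definition real_schwartz a := smooth a /\ rapidly_decreasing a.

Lemma smooth_is_derive a n (x : R) : smooth a ->
  is_derive x 1 (derive1n n a) (derive1n n.+1 a x).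
Proof.
move=> sa; rewrite derive1nS derive1E.
by apply: derivableP; exact: sa.
Qed.

Lemma smooth_continuous a n : smooth a -> continuous (derive1n n a).
Proof.
move=> sa x; apply: differentiable_continuous; apply/derivable1_diffP.
exact: sa.
Qed.

Lemma schwartz_decaying a n k : real_schwartz a ->
  decaying (fun x => x ^+ k * derive1n n a x).
Proof.
move=> [_ ra]; have [M1 h1] := ra n k; have [M2 h2] := ra n k.+2.
exists (M1 + M2) => x; rewrite ler_pdivlMr ?oneDsqr_gt0//.
rewrite /oneDsqr mulrDr mulr1; apply: lerD => //.
rewrite -[x ^+ 2]ger0_norm ?sqr_ge0// -normrM mulrAC -exprD.
by rewrite addn2; exact: h2.
Qed.

Lemma schwartz_decaying0 a n : real_schwartz a -> decaying (derive1n n a).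
Proof.
move=> sa; have [K hK] := schwartz_decaying n 0 sa; exists K => x.
by have := hK x; rewrite expr0 mul1r.
Qed.

Lemma schwartz_rintegrable a n k : real_schwartz a ->
  rintegrable mu (fun x => x ^+ k * derive1n n a x).
Proof.
move=> sa; apply: decaying_rintegrable; last exact: schwartz_decaying.
apply: continuous_measurable_fun => x; apply: cvgM.
  exact: exprn_continuous.
by apply: smooth_continuous; case: sa.
Qed.

Lemma is_derive_scale (xi x : R) : is_derive x 1 (fun y : R => y * xi) xi.
Proof.
have h : is_derive x 1 (id * cst xi : R -> R) (x *: 0 + xi *: 1) by exact: is_deriveM.
by apply: (is_derive_eq h); rewrite /GRing.scale /= mulr0 add0r mulr1.
Qed.

Lemma is_derive_cosM (xi x : R) :
  is_derive x 1 (fun y : R => cos (y * xi)) (- sin (x * xi) * xi).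
Proof. by apply: is_derive1_comp; exact: is_derive_scale. Qed.

Lemma is_derive_sinM (xi x : R) :
  is_derive x 1 (fun y : R => sin (y * xi)) (cos (x * xi) * xi).
Proof. by apply: is_derive1_comp; exact: is_derive_scale. Qed.

Lemma is_derive_prod (f g : R -> R) (x df dg : R) :
  is_derive x 1 f df -> is_derive x 1 g dg ->
  is_derive x 1 (fun y : R => f y * g y) (f x * dg + g x * df).
Proof. by move=> hf hg; exact: is_deriveM. Qed.

Lemma is_derive_comb (f g : R -> R) (c x df dg : R) :
  is_derive x 1 f df -> is_derive x 1 g dg ->
  is_derive x 1 (fun y : R => f y + c * g y) (df + c * dg).
Proof.
move=> hf hg; have hcg : is_derive x 1 (c *: g : R -> R) (c *: dg) by exact: is_deriveZ.
exact: is_deriveD.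
Qed.

Definition fourier_cos a (xi : R) := \int[mu]_x (a x * cos (x * xi)).
Definition fourier_sin a (xi : R) := \int[mu]_x (a x * sin (x * xi)).

Lemma continuous_cosM (xi : R) : continuous (fun x : R => cos (x * xi)).
Proof.
move=> x; apply: continuous_comp; last exact: continuous_cos.
by apply: cvgMl; exact: cvg_id.
Qed.

Lemma continuous_sinM (xi : R) : continuous (fun x : R => sin (x * xi)).
Proof.
move=> x; apply: continuous_comp; last exact: continuous_sin.
by apply: cvgMl; exact: cvg_id.
Qed.

Lemma rintegrable_mul_cos f xi : rintegrable mu f -> rintegrable mu (fun x => f x * cos (x * xi)).
Proof.
move=> fi; apply: (rintegrable_mul_bounded (M := 1)) => // [|x]; last exact: ler_norm_cos.
by apply: continuous_measurable_fun; exact: continuous_cosM.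
Qed.

Lemma rintegrable_mul_sin f xi : rintegrable mu f -> rintegrable mu (fun x => f x * sin (x * xi)).
Proof.
move=> fi; apply: (rintegrable_mul_bounded (M := 1)) => // [|x]; last exact: ler_norm_sin.
by apply: continuous_measurable_fun; exact: continuous_sinM.
Qed.

Section Bounds.
Variables (a : R -> R) (sa : real_schwartz a).
Let a1 : R -> R := derive1n 1 a.
Let a2 : R -> R := derive1n 2 a.

Let da (x : R) : is_derive x 1 a (a1 x).
Proof. by apply: (smooth_is_derive 0); case: sa. Qed.
Let da1 (x : R) : is_derive x 1 a1 (a2 x).
Proof. by apply: (smooth_is_derive 1); case: sa. Qed.

Lemma schwartz_rintegrable0 n : rintegrable mu (derive1n n a).
Proof.
have := schwartz_rintegrable n 0 sa; congr (rintegrable _ _).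
by apply/funext => x; rewrite expr0 mul1r.
Qed.

Let i0 : rintegrable mu a := schwartz_rintegrable0 0.
Let i2 : rintegrable mu a2 := schwartz_rintegrable0 2.
Let c0 : continuous a. Proof. exact: (@smooth_continuous a 0 sa.1). Qed.
Let c1 : continuous a1. Proof. exact: (@smooth_continuous a 1 sa.1). Qed.
Let c2 : continuous a2. Proof. exact: (@smooth_continuous a 2 sa.1). Qed.
Let d0 : decaying a := schwartz_decaying0 0 sa.
Let d1 : decaying a1 := schwartz_decaying0 1 sa.

(** Two integrations by parts at once: [F] is a primitive of [f] that vanishes at infinity, so the
    two terms of [f] have opposite integrals. *)
Lemma fourier_cos_derive2 xi : xi ^+ 2 * fourier_cos a xi = - fourier_cos a2 xi.
Proof.
pose F x := a1 x * cos (x * xi) + xi * (a x * sin (x * xi)).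
pose f x := a2 x * cos (x * xi) + xi ^+ 2 * (a x * cos (x * xi)).
have fi : rintegrable mu f.
  by apply: rintegrableD; [|apply: rintegrableZ]; exact: rintegrable_mul_cos.
have dF : decaying F.
  apply: decayingD; first by apply: (decayingM (M := 1)) => // x; exact: ler_norm_cos.
  have [K hK] : decaying (fun x => a x * sin (x * xi)).
    by apply: (decayingM (M := 1)) => // x; exact: ler_norm_sin.
  by exists (`|xi| * K) => x; rewrite normrM -mulrA ler_wpM2l.
have : \int[mu]_x f x = 0.
  apply: (FTC_line (F := F)) => //.
  - move=> x; apply: is_derive_eq.
      by apply: is_derive_comb; apply: is_derive_prod;
        do ?[exact: da|exact: da1|exact: is_derive_cosM|exact: is_derive_sinM].
    by rewrite /f /GRing.scale /=; ring.
  - by move=> x; apply: cvgD; [|apply: cvgMr]; apply: cvgM; do ?[exact: c0|exact: c2];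
      exact: continuous_cosM.
  - by apply: decaying_cvg0 dF _ => n; rewrite ger0_norm.
  - by apply: decaying_cvg0 dF _ => n; rewrite normrN ger0_norm.
rewrite /f RintegralD//; last 2 first.
- exact: rintegrable_mul_cos.
- by apply: rintegrableZ; exact: rintegrable_mul_cos.
rewrite RintegralZl//; last exact: rintegrable_mul_cos.
by rewrite -/(fourier_cos a2 xi) -/(fourier_cos a xi) addrC => /eqP; rewrite addr_eq0 => /eqP.
Qed.

Lemma fourier_sin_derive2 xi : xi ^+ 2 * fourier_sin a xi = - fourier_sin a2 xi.
Proof.
pose F x := a1 x * sin (x * xi) + (- xi) * (a x * cos (x * xi)).
pose f x := a2 x * sin (x * xi) + xi ^+ 2 * (a x * sin (x * xi)).
have fi : rintegrable mu f.
  by apply: rintegrableD; [|apply: rintegrableZ]; exact: rintegrable_mul_sin.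
have dF : decaying F.
  apply: decayingD; first by apply: (decayingM (M := 1)) => // x; exact: ler_norm_sin.
  have [K hK] : decaying (fun x => a x * cos (x * xi)).
    by apply: (decayingM (M := 1)) => // x; exact: ler_norm_cos.
  by exists (`|xi| * K) => x; rewrite normrM normrN -mulrA ler_wpM2l.
have : \int[mu]_x f x = 0.
  apply: (FTC_line (F := F)) => //.
  - move=> x; apply: is_derive_eq.
      by apply: is_derive_comb; apply: is_derive_prod;
        do ?[exact: da|exact: da1|exact: is_derive_cosM|exact: is_derive_sinM].
    by rewrite /f /GRing.scale /=; ring.
  - by move=> x; apply: cvgD; [|apply: cvgMr]; apply: cvgM; do ?[exact: c0|exact: c2];
      exact: continuous_sinM.
  - by apply: decaying_cvg0 dF _ => n; rewrite ger0_norm.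
  - by apply: decaying_cvg0 dF _ => n; rewrite normrN ger0_norm.
rewrite /f RintegralD//; last 2 first.
- exact: rintegrable_mul_sin.
- by apply: rintegrableZ; exact: rintegrable_mul_sin.
rewrite RintegralZl//; last exact: rintegrable_mul_sin.
by rewrite -/(fourier_sin a2 xi) -/(fourier_sin a xi) addrC => /eqP; rewrite addr_eq0 => /eqP.
Qed.

Lemma fourier_cos_le f xi : rintegrable mu f -> `|fourier_cos f xi| <= \int[mu]_x `|f x|.
Proof.
move=> fi; apply: Rintegral_norm_le; [exact: rintegrable_mul_cos|exact: rintegrable_norm|].
by move=> x; rewrite normrM ler_piMr// ler_norm_cos.
Qed.

Lemma fourier_sin_le f xi : rintegrable mu f -> `|fourier_sin f xi| <= \int[mu]_x `|f x|.
Proof.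
move=> fi; apply: Rintegral_norm_le; [exact: rintegrable_mul_sin|exact: rintegrable_norm|].
by move=> x; rewrite normrM ler_piMr// ler_norm_sin.
Qed.

(** The trivial bound for the transform is added to the one for its product with [xi ^+ 2], which is
    a transform of the second derivative up to sign. *)
Lemma fourier_cos_decaying : decaying (fourier_cos a).
Proof.
exists (\int[mu]_x `|a x| + \int[mu]_x `|a2 x|) => xi.
rewrite ler_pdivlMr ?oneDsqr_gt0// /oneDsqr mulrDr mulr1.
apply: lerD; first exact: fourier_cos_le.
rewrite -[xi ^+ 2]ger0_norm ?sqr_ge0// -normrM mulrC fourier_cos_derive2 normrN.
exact: fourier_cos_le.
Qed.

Lemma fourier_sin_decaying : decaying (fourier_sin a).
Proof.
exists (\int[mu]_x `|a x| + \int[mu]_x `|a2 x|) => xi.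
rewrite ler_pdivlMr ?oneDsqr_gt0// /oneDsqr mulrDr mulr1.
apply: lerD; first exact: fourier_sin_le.
rewrite -[xi ^+ 2]ger0_norm ?sqr_ge0// -normrM mulrC fourier_sin_derive2 normrN.
exact: fourier_sin_le.
Qed.

Let ix : rintegrable mu (fun x => `|x * a x|).
Proof.
apply: rintegrable_norm; have := schwartz_rintegrable 0 1 sa.
by congr (rintegrable _ _); apply/funext => x; rewrite expr1.
Qed.

(** The function [cos (x * xi)] varies with [xi] at rate at most [|x|], and [x * a x] is integrable,
    so the transform is Lipschitz. *)
Lemma fourier_cos_continuous : continuous (fourier_cos a).
Proof.
apply: (lipschitz_continuous (K := \int[mu]_x `|x * a x|)) => xi eta.
rewrite /fourier_cos -RintegralB//; [|exact: rintegrable_mul_cos|exact: rintegrable_mul_cos].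
rewrite -RintegralZr//; apply: Rintegral_norm_le.
- rewrite /rintegrable (_ : _ \o _ =
    EFin \o (fun x => a x * cos (x * xi) + (-1) * (a x * cos (x * eta)))); last first.
    by apply/funext => x /=; rewrite mulN1r.
  by apply: rintegrableD; [|apply: rintegrableZ]; exact: rintegrable_mul_cos.
- rewrite (_ : (fun x => _) = fun x => `|xi - eta| * `|x * a x|); last first.
    by apply/funext => x; rewrite mulrC.
  exact: rintegrableZ.
- move=> x; rewrite -mulrBr !normrM (mulrC `|x|) -mulrA ler_wpM2l//.
  by apply: le_trans (ler_norm_cosB _ _) _; rewrite -mulrBr normrM.
Qed.

Lemma fourier_sin_continuous : continuous (fourier_sin a).
Proof.
apply: (lipschitz_continuous (K := \int[mu]_x `|x * a x|)) => xi eta.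
rewrite /fourier_sin -RintegralB//; [|exact: rintegrable_mul_sin|exact: rintegrable_mul_sin].
rewrite -RintegralZr//; apply: Rintegral_norm_le.
- rewrite /rintegrable (_ : _ \o _ =
    EFin \o (fun x => a x * sin (x * xi) + (-1) * (a x * sin (x * eta)))); last first.
    by apply/funext => x /=; rewrite mulN1r.
  by apply: rintegrableD; [|apply: rintegrableZ]; exact: rintegrable_mul_sin.
- rewrite (_ : (fun x => _) = fun x => `|xi - eta| * `|x * a x|); last first.
    by apply/funext => x; rewrite mulrC.
  exact: rintegrableZ.
- move=> x; rewrite -mulrBr !normrM (mulrC `|x|) -mulrA ler_wpM2l//.
  by apply: le_trans (ler_norm_sinB _ _) _; rewrite -mulrBr normrM.
Qed.

End Bounds.
End FourierSchwartz.

Lemma sum_ord_eq (N m : nat) : (\sum_(i < N) (i == m :> nat) = (m < N))%N.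
Proof.
elim: N => [|N IH]; first by rewrite big_ord0.
by rewrite big_ord_recr /= IH; case: (ltngtP m N) => h; rewrite ?h; lia.
Qed.

Lemma sum_ord_lt (N m : nat) : (\sum_(i < N) (i < m) = minn N m)%N.
Proof.
elim: N => [|N IH]; first by rewrite big_ord0 min0n.
by rewrite big_ord_recr /= IH; case: (ltnP N m) => h /=; lia.
Qed.

(** This count is the triangular Fejer weight; truncated subtraction gives [0] once [N <= |k|]. *)
Lemma sum_diff_eq (N : nat) (k : int) :
  (\sum_(i < N) \sum_(j < N) (((i:nat)%:Z - (j:nat)%:Z)%R == k) = N - `|k|)%N.
Proof.
have H (K : nat) : (\sum_(i < N) \sum_(j < N) (i + K == j :> nat) = N - K)%N.
  transitivity (\sum_(i < N) (i < N - K))%N; last by rewrite sum_ord_lt; lia.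
  apply: eq_bigr => i _; rewrite (eq_bigr (fun j : 'I_N => (j == (i + K)%N :> nat) : nat)).
    by rewrite sum_ord_eq; congr (nat_of_bool _); lia.
  by move=> j _; rewrite eq_sym.
case: k => K; rewrite -[RHS]H.
  rewrite exchange_big; apply: eq_bigr => i _; apply: eq_bigr => j _.
  by congr (nat_of_bool _); lia.
apply: eq_bigr => i _; apply: eq_bigr => j _.
by congr (nat_of_bool _); lia.
Qed.

(** * Riemann sums and Fejer densities *)

Section RiemannSums.
Context {R : realType}.
Local Notation mu := (@lebesgue_measure R).

Lemma cvg_le_invS (u : nat -> R) (l C : R) :
  (forall n, `|l - u n| <= C / n.+1%:R) -> u n @[n --> \oo] --> l.
Proof.
move=> H; apply/cvgrPdist_le => e e0; near=> n.
apply: le_trans (H n) _; rewrite ler_pdivrMr ?ltr0n//.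
rewrite mulrC -ler_pdivrMr//; apply: (@le_trans _ _ n%:R); last by rewrite ler_nat.
by near: n; exact: nbhs_infty_ger.
Unshelve. all: by end_near. Qed.

Lemma rintegrable_indic_itv (c e : R) : c <= e ->
  rintegrable mu (\1_(`[c, e[%classic) : R -> R) /\
  \int[mu]_x (\1_(`[c, e[%classic) x) = e - c.
Proof.
move=> ce; split; first exact: (integrable_indic_itv c e true true).
rewrite /Rintegral integral_indic// ?setIT.
rewrite [X in fine X](_ : _ = lebesgue_measure ([set` `[c, e[] : set R))//.
rewrite lebesgue_measure_itv /= lte_fin.
by case: ltP => //= ec; apply/eqP; rewrite eq_sym subr_eq0 eq_le ec ce.
Qed.

(* For [(i - j) * delta <= x < (i - j + 1) * delta] exactly [N - |k|] pairs [i, j < N]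
   contribute, where [k] is the integer part of [x / delta]. *)
Lemma riemann_fejer (F : R -> R) : continuous F -> decaying F ->
  (((n.+1 ^ 2)%:R)^-1 / n.+1%:R * \sum_(i < n.+1 ^ 2) \sum_(j < n.+1 ^ 2)
     F ((i%:R - j%:R) * n.+1%:R^-1)) @[n --> \oo] --> \int[mu]_x F x.
Proof.
move=> cF [K FK].
pose N n := (n.+1 ^ 2)%N; pose de n : R := n.+1%:R^-1.
have de0 n : 0 < de n by rewrite invr_gt0 ltr0n.
have N0 n : 0 < (N n)%:R :> R by rewrite ltr0n expn_gt0.
pose cell n (i j : nat) : set R :=
  `[(i%:R - j%:R) * de n, (i%:R - j%:R) * de n + de n[%classic.
(* A step function whose integral is the normalized double sum: each pair [(i, j)] spreads the value
   of [F] at its grid point over the cell of width [1 / n.+1] to the right. *)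
pose G n (x : R) := ((N n)%:R)^-1 * \sum_(i < N n) \sum_(j < N n)
  F ((i%:R - j%:R) * de n) * \1_(cell n i j) x.
have cellI n i j : rintegrable mu (\1_(cell n i j) : R -> R) /\
    \int[mu]_x (\1_(cell n i j) x) = de n.
  have ce : (i%:R - j%:R) * de n <= (i%:R - j%:R) * de n + de n by rewrite lerDl ltW.
  have [h1 h2] := rintegrable_indic_itv ce; split=> //.
  by rewrite h2 addrC addKr.
have GI n : rintegrable mu (G n) /\ \int[mu]_x G n x =
    ((N n)%:R)^-1 / n.+1%:R * \sum_(i < N n) \sum_(j < N n) F ((i%:R - j%:R) * de n).
  have h1 i := rintegrable_sum (mu := mu) (index_enum 'I_(N n))
    (f := fun (j : 'I_(N n)) x => F ((i%:R - j%:R) * de n) * \1_(cell n i j) x)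
    (fun j => rintegrableZ _ (cellI n i j).1).
  have [h2 h3] := rintegrable_sum (mu := mu) (index_enum 'I_(N n)) (fun i : 'I_(N n) => (h1 i).1).
  split; first exact: rintegrableZ.
  rewrite RintegralZl// h3 -mulrA; congr (_ * _).
  rewrite mulr_sumr; apply: eq_bigr => i _; rewrite (h1 i).2 mulr_sumr.
  apply: eq_bigr => j _; rewrite RintegralZl//; last exact: (cellI n i j).1.
  by rewrite (cellI n i j).2 mulrC.
(* [k] is the index of the grid cell of [x], [t] its left end and [c] the Fejer weight, so that
   [G n x = c n x * F (t n x)]. *)
pose k (n : nat) (x : R) : int := Num.floor (x * n.+1%:R).
pose t (n : nat) (x : R) : R := (k n x)%:~R * de n.
pose c (n : nat) (x : R) : R := (N n - `|k n x|)%:R / (N n)%:R.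
have n1 n : 0 < n.+1%:R :> R by rewrite ltr0n.
have kx n x : (k n x)%:~R <= x * n.+1%:R < (k n x)%:~R + 1.
  by have := @floor_itv R (x * n.+1%:R); rewrite intrD.
have tx n x : `|x - t n x| <= de n.
  have -> : x - t n x = (x * n.+1%:R - (k n x)%:~R) * de n.
    by rewrite /t mulrBl mulfK// gt_eqF.
  rewrite normrM [X in _ * X]ger0_norm ?(ltW (de0 n))// ler_piMl ?(ltW (de0 n))//.
  by have /andP[l1 l2] := kx n x; rewrite ger0_norm ?subr_ge0// lerBlDl ltW.
have cellE n (i j : nat) x : \1_(cell n i j) x = ((i%:Z - j%:Z)%R == k n x)%:R :> R.
  rewrite indicE; congr (nat_of_bool _)%:R.
  have -> : cell n i j = `[(i%:R - j%:R) * de n, (i%:R - j%:R + 1) * de n[%classic.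
    by rewrite /cell [in RHS](mulrDl _ 1) mul1r.
  rewrite mem_setE in_itv /= ler_pdivrMr// ltr_pdivlMr//.
  have -> : i%:R - j%:R = (i%:Z - j%:Z)%:~R :> R by rewrite intrB.
  apply/idP/eqP => [h|->]; last exact: kx.
  by apply/esym/floor_def; rewrite [(_ + 1)%:~R]intrD.
have GE n x : G n x = c n x * F (t n x).
  rewrite /G /c [RHS]mulrAC [RHS]mulrC; congr (_ * _).
  rewrite -sum_diff_eq natr_sum mulr_suml; apply: eq_bigr => i _.
  rewrite natr_sum mulr_suml; apply: eq_bigr => j _; rewrite cellE.
  case: eqP => [e|_]; rewrite ?mulr0 ?mul0r// mulr1 mul1r; congr F.
  by rewrite /t -e intrB.
have c01 n x : 0 <= c n x <= 1.
  by rewrite /c divr_ge0 ?ler0n//= ler_pdivrMr// mul1r ler_nat leq_subr.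
have K0 : 0 <= K.
  have i0 : 0 < (oneDsqr (0 : R))^-1 by rewrite invr_gt0 oneDsqr_gt0.
  by have := le_trans (normr_ge0 _) (FK 0); rewrite pmulr_lge0.
have de1 n : de n <= 1 by rewrite invf_le1// ler1n.
(* From [|x - t| <= 1] follows [1 + x ^ 2 <= 3 (1 + t ^ 2)], a majorant independent of [n]. *)
have Gg n x : `|G n x| <= 3 * K * (oneDsqr x)^-1.
  have /andP[c0 c1] := c01 n x; rewrite GE normrM (ger0_norm c0).
  apply: le_trans (ler_piMl (normr_ge0 _) c1) _; apply: le_trans (FK _) _.
  rewrite [3 * K]mulrC -mulrA ler_wpM2l//.
  rewrite ler_pdivlMr ?oneDsqr_gt0// mulrC ler_pdivrMr ?oneDsqr_gt0// /oneDsqr.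
  have h : (x - t n x) ^+ 2 <= 1.
    rewrite -real_normK ?num_real// expr_le1//.
    exact: le_trans (tx n x) (de1 n).
  by have := sqr_ge0 (x - 2 * t n x); have := sqr_ge0 (t n x); lra.
have cG x : G n x @[n --> \oo] --> F x.
  rewrite -[F x]mul1r (_ : (fun n => G n x) = fun n => c n x * F (t n x)); last first.
    by apply/funext => n; rewrite GE.
  apply: cvgM.
    (* [1 - c] is at most [|k| / N] with [|k| <= |x| * n.+1 + 1] and [N = n.+1 ^ 2]. Here it matters
       that the length [N / n.+1] of the sampled stretch grows. *)
    apply: (cvg_le_invS (C := `|x| + 1)) => n.
    have /andP[c0 c1] := c01 n x; rewrite ger0_norm ?subr_ge0//.
    have kle : (`|k n x|%N)%:R <= `|x| * n.+1%:R + 1 :> R.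
      have -> : (`|k n x|%N)%:R = `|(k n x)%:~R| :> R by rewrite -intr_norm natr_absz.
      rewrite -[X in `|x| * X]ger0_norm ?ler0n// -normrM.
      have /andP[l1 l2] := kx n x; have := ler_norm (x * n.+1%:R).
      have := ler_norm (- (x * n.+1%:R)); rewrite normrN ler_norml => m1 m2.
      by apply/andP; split; lra.
    have h : (N n)%:R - (`|k n x|%N)%:R <= (N n - `|k n x|)%:R :> R.
      by rewrite lerBlDr -natrD ler_nat; lia.
    apply: (@le_trans _ _ ((`|x| * n.+1%:R + 1) / (N n)%:R)).
      rewrite lerBlDr -lerBlDl /c -[X in X - _](@divff _ (N n)%:R) ?gt_eqF//.
      rewrite -mulrBl ler_wpM2r ?invr_ge0 ?ler0n//.
      by apply: le_trans h; lra.
    rewrite ler_pdivrMr// /N natrX expr2 mulrA divfK ?gt_eqF// mulrDl mul1r lerD2l.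
    by rewrite ler1n.
  apply: (@cvg_comp _ _ _ (fun n => t n x) F _ (nbhs x)); last exact: cF.
  by apply: (cvg_le_invS (C := 1)) => n; rewrite mul1r.
have [_ H] := rdominated_convergence (mu := mu) (fun n => rintegrable_measurable (GI n).1) cG
  (rintegrableZ (3 * K) rintegrable_oneDsqrV) Gg.
rewrite (_ : (fun n => _) = (fun n => \int[mu]_x G n x))//.
by apply/funext => n; rewrite (GI n).2.
Qed.

End RiemannSums.

(** * Folding an integral over equal cells *)

Section Cells.
Context {R : realType}.
Local Notation mu := (@lebesgue_measure R).
Implicit Types f : R -> R.

Lemma itv_integrable f (a b : R) : continuous f -> mu.-integrable `[a, b] (EFin \o f).
Proof.
move=> cf; apply: continuous_compact_integrable; first exact: segment_compact.
exact: continuous_subspaceT.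
Qed.

Lemma Rintegral_shift f (c d : R) : continuous f -> 0 <= d ->
  \int[mu]_(x in `[c, c + d]) f x = \int[mu]_(x in `[0, d]) f (c + x).
Proof.
move=> cf d0.
have dF (x : R) : is_derive x 1 (fun y : R => c + y) 1.
  have h : is_derive x 1 (cst c + id : R -> R) (0 + 1) by exact: is_deriveD.
  by apply: (is_derive_eq h); rewrite add0r.
have E : derive1 (fun y : R => c + y) = cst 1.
  by apply/funext => x; rewrite derive1E; case: (dF x).
rewrite /Rintegral; congr fine.
have := @integration_by_substitution_increasing R (fun y => c + y) f 0 d d0.
rewrite addr0 E => ->.
- by apply: eq_integral => x _; rewrite /= mulr1.
- by move=> x y _ _; rewrite ltrD2l.
- by move=> x _; exact: cvg_cst.
- exact: is_cvg_cst.
- exact: is_cvg_cst.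
- split => [x _||].
  + by case: (dF x).
  + by apply: cvg_at_right_filter; apply: cvgD; [exact: cvg_cst|exact: cvg_id].
  + by apply: cvg_at_left_filter; apply: cvgD; [exact: cvg_cst|exact: cvg_id].
- exact: continuous_subspaceT.
Qed.

Lemma continuous_shift f (c : R) : continuous f -> continuous (fun x => f (c + x)).
Proof.
move=> cf x; apply: (@cvg_comp _ _ _ (fun y => c + y) f _ (nbhs (c + x))); last exact: cf.
by apply: cvgD; [exact: cvg_cst|exact: cvg_id].
Qed.

(** Translating all cells onto [[0, d]] produces sums over equally spaced points, the shape in which
    the Toeplitz bound is available for every phase. *)
Lemma Rintegral_cells f (a d : R) (N : nat) : continuous f -> 0 <= d ->
  \int[mu]_(x in `[a, a + N%:R * d]) f x =
  \int[mu]_(x in `[0, d]) \sum_(m < N) f (a + m%:R * d + x).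
Proof.
move=> cf d0.
have cs (c : R) := @continuous_shift f c cf.
elim: N => [|N IH].
  rewrite mul0r addr0 set_itv1 Rintegral_set1; apply/esym.
  by under eq_Rintegral do rewrite big_ord0; rewrite Rintegral_cst// mul0r.
under [RHS]eq_Rintegral do rewrite big_ord_recr /=.
rewrite RintegralD//; last 2 first.
- apply: itv_integrable => x.
  apply: cvg_big; [exact: add_continuous|move=> i _; exact: cs].
- exact: itv_integrable.
rewrite -IH -(Rintegral_shift (a + N%:R * d) cf d0) -natr1 mulrDl mul1r addrA.
have Nd : a <= a + N%:R * d by rewrite lerDl mulr_ge0.
have h := @Rintegral_itvB R f (BLeft a) (BRight (a + N%:R * d + d)) (a + N%:R * d).
rewrite -(@Rintegral_itv_obnd_cbnd R (a + N%:R * d)); last first.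
  apply: (@integrableS _ _ _ mu `[a + N%:R * d, a + N%:R * d + d]%classic) => //.
  - exact: subset_itv_oc_cc.
  - exact: itv_integrable.
rewrite -h ?bnd_simp ?lerDl//; first by rewrite [RHS]addrC subrK.
- exact: itv_integrable.
- exact: mulr_ge0.
Qed.
End Cells.

(** * Fejer densities of a bounded continuous function *)

Section ToeplitzDensity.
Context {R : realType}.
Local Notation mu := (@lebesgue_measure R).
Variables (al be : R -> R) (B M : R).
Hypotheses (cal : continuous al) (cbe : continuous be).
Hypotheses (alB : forall x, `|al x| <= B) (beB : forall x, `|be x| <= B).
Hypothesis hM : forall (N : nat) (delta eta : R), (0 < N)%N -> 0 < delta ->
    \sum_(m < N) normc (toeplitz_mean (fun r => al r +i* be r) N delta
      (eta + m%:R * (pi *+ 2) / (N%:R * delta))) <= M.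

(** For [h = al + i be], the real part of [delta] times the Fejer mean, with [N = n.+1 ^ 2] and
    [delta = 1 / n.+1]. The factor [delta] makes it a Riemann sum for the Fourier integral of
    [h]. *)
Definition toeplitz_density (n : nat) (xi : R) : R :=
  ((n.+1 ^ 2)%:R)^-1 / n.+1%:R * \sum_(i < n.+1 ^ 2) \sum_(j < n.+1 ^ 2)
   (al ((i%:R - j%:R) * n.+1%:R^-1) * cos (xi * ((i%:R - j%:R) * n.+1%:R^-1)) +
    be ((i%:R - j%:R) * n.+1%:R^-1) * sin (xi * ((i%:R - j%:R) * n.+1%:R^-1))).

Lemma continuous_sum (I : Type) (s : seq I) (f : I -> R -> R) :
  (forall i, continuous (f i)) -> continuous (fun x => \sum_(i <- s) f i x).
Proof.
by move=> cf x; apply: cvg_big; [exact: add_continuous|move=> i _; exact: cf].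
Qed.

Lemma continuous_scale (c : R) (f : R -> R) : continuous f -> continuous (fun x => c * f x).
Proof. by move=> cf x; apply: cvgMl_tmp; exact: cf. Qed.

Lemma toeplitz_density_continuous n : continuous (toeplitz_density n).
Proof.
apply: continuous_scale; apply: continuous_sum => i; apply: continuous_sum => j x.
by apply: cvgD; apply: continuous_scale; [exact: continuous_cosM|exact: continuous_sinM].
Qed.

Lemma toeplitz_densityE n xi : toeplitz_density n xi =
  n.+1%:R * complex.Re (toeplitz_mean (fun r => al r +i* be r) (n.+1 ^ 2) n.+1%:R^-1 xi).
Proof.
rewrite /toeplitz_mean.
have E (r : R) (z : R[i]) : complex.Re (r%:C * z) = r * complex.Re z.
  by case: z => a b /=; rewrite mul0r subr0.
rewrite E mulrA; congr (_ * _).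
  have n0 : n.+1%:R != 0 :> R by rewrite pnatr_eq0.
  by rewrite natrX; field.
rewrite Re_sum; apply: eq_bigr => i _; rewrite Re_sum; apply: eq_bigr => j _.
by rewrite /= cosN sinN mulrN opprK ![xi * _]mulrC.
Qed.

Lemma toeplitz_density_normc n xi : `|toeplitz_density n xi| <=
  n.+1%:R * normc (toeplitz_mean (fun r => al r +i* be r) (n.+1 ^ 2) n.+1%:R^-1 xi).
Proof.
rewrite toeplitz_densityE normrM ger0_norm// ler_wpM2l//; exact: ler_Re_normc.
Qed.

(** The interval is one period, cut into [n.+1 ^ 2] cells of length [d = 2 pi / n.+1]. For each
    phase the sum over the cells is at most [n.+1 * M], and [d * n.+1 = 2 pi]. *)
Lemma toeplitz_density_L1 n :
  \int[mu]_(x in `[- (pi * n.+1%:R), pi * n.+1%:R]) `|toeplitz_density n x| <= pi *+ 2 * M.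
Proof.
have n0 : 0 < n.+1%:R :> R by rewrite ltr0n.
have p0 : 0 < (pi : R) by exact: pi_gt0.
pose d : R := pi *+ 2 / n.+1%:R.
have d0 : 0 <= d by rewrite divr_ge0 ?(ltW n0)// mulrn_wge0 ?(ltW p0).
have -> : `[- (pi * n.+1%:R), pi * n.+1%:R]%classic =
    `[- (pi * n.+1%:R), - (pi * n.+1%:R) + (n.+1 ^ 2)%:R * d]%classic :> set R.
  suff -> : - (pi * n.+1%:R) + (n.+1 ^ 2)%:R * d = pi * n.+1%:R by [].
  by rewrite /d natrX; field; rewrite nat1r gt_eqF.
have cn : continuous (fun x => `|toeplitz_density n x|).
  by move=> x; apply: cvg_norm; exact: toeplitz_density_continuous.
rewrite Rintegral_cells//.
have -> : pi *+ 2 * M = \int[mu]_(x in `[0, d]) (n.+1%:R * M).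
  rewrite Rintegral_cst// [X in fine X](_ : _ = lebesgue_measure ([set` `[0, d]] : set R))//.
  rewrite lebesgue_measure_itv /= lte_fin.
  suff -> : fine (if 0 < d then (d%:E - 0%:E)%E else 0%E) = d.
    by rewrite /d; field; rewrite nat1r gt_eqF.
  by case: ltP => //= [_|d00]; [rewrite subr0|apply/esym/eqP; rewrite eq_le d00].
apply: le_Rintegral => //.
- apply: itv_integrable; apply: continuous_sum => m x.
  exact: (@continuous_shift _ _ _ cn).
- apply: itv_integrable => x; exact: cvg_cst.
move=> x _.
have N0 : (0 < n.+1 ^ 2)%N by rewrite expn_gt0.
have de0 : 0 < n.+1%:R^-1 :> R by rewrite invr_gt0.
apply: (@le_trans _ _ (n.+1%:R *
    \sum_(m < n.+1 ^ 2) normc (toeplitz_mean (fun r => al r +i* be r) (n.+1 ^ 2) n.+1%:R^-1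
      (- (pi * n.+1%:R) + x + m%:R * (pi *+ 2) / ((n.+1 ^ 2)%:R * n.+1%:R^-1))))); last first.
  by rewrite ler_wpM2l//; exact: hM.
rewrite mulr_sumr; apply: ler_sum => m _.
have -> : - (pi * n.+1%:R) + x + m%:R * (pi *+ 2) / ((n.+1 ^ 2)%:R * n.+1%:R^-1) =
   - (pi * n.+1%:R) + m%:R * d + x :> R.
  by rewrite /d natrX; field; rewrite gt_eqF.
exact: toeplitz_density_normc.
Qed.

(** There are [N ^ 2] terms of size at most [2 B], divided by [N * n.+1] where [N = n.+1 ^ 2]. So
    crude a bound suffices outside the window, where [n.+1 <= |x|]. *)
Lemma toeplitz_density_le n xi : `|toeplitz_density n xi| <= 2 * B * n.+1%:R.
Proof.
have n0 : 0 < n.+1%:R :> R by rewrite ltr0n.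
have N0 : 0 < (n.+1 ^ 2)%:R :> R by rewrite ltr0n expn_gt0.
rewrite normrM ger0_norm; last by rewrite divr_ge0// ?invr_ge0// ltW.
have H : `|\sum_(i < n.+1 ^ 2) \sum_(j < n.+1 ^ 2)
   (al ((i%:R - j%:R) * n.+1%:R^-1) * cos (xi * ((i%:R - j%:R) * n.+1%:R^-1)) +
    be ((i%:R - j%:R) * n.+1%:R^-1) * sin (xi * ((i%:R - j%:R) * n.+1%:R^-1)))| <=
   \sum_(i < n.+1 ^ 2) \sum_(j < n.+1 ^ 2) (2 * B).
  apply: le_trans (ler_norm_sum _ _ _) _; apply: ler_sum => i _.
  apply: le_trans (ler_norm_sum _ _ _) _; apply: ler_sum => j _.
  apply: le_trans (ler_normD _ _) _; rewrite !normrM (_ : 2 * B = B + B); last by ring.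
  apply: lerD; rewrite -[leRHS]mulr1; apply: ler_pM => //.
    exact: ler_norm_cos.
  exact: ler_norm_sin.
apply: le_trans (ler_wpM2l _ H) _; first by rewrite divr_ge0// ?invr_ge0// ltW.
rewrite !sumr_const !card_ord -(mulr_natr _ (n.+1 ^ 2)) -(mulr_natr (2 * B)) natrX.
rewrite le_eqVlt; apply/orP; left; apply/eqP; field; rewrite nat1r gt_eqF//.
Qed.

Definition cut_density n xi := toeplitz_density n xi * window (pi * n.+1%:R) xi.

Lemma cut_densityE n xi :
  cut_density n xi = (toeplitz_density n \_ `[- (pi * n.+1%:R), pi * n.+1%:R]%classic) xi.
Proof.
rewrite /cut_density windowE patchE mem_setE in_itv /= ler_norml.
by case: ifP => _; rewrite ?mulr1 ?mulr0.
Qed.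

Lemma cut_density_rintegrable n : rintegrable mu (cut_density n).
Proof.
rewrite /rintegrable (_ : _ \o _ =
  (EFin \o toeplitz_density n) \_ `[- (pi * n.+1%:R), pi * n.+1%:R]%classic); last first.
  apply/funext => x; rewrite /= cut_densityE !patchE; by case: ifP.
rewrite -integrable_mkcond//; exact/itv_integrable/toeplitz_density_continuous.
Qed.

Lemma cut_density_L1 n : \int[mu]_x `|cut_density n x| <= pi *+ 2 * M.
Proof.
apply: le_trans (toeplitz_density_L1 n); rewrite le_eqVlt; apply/orP; left; apply/eqP.
rewrite [RHS]Rintegral_mkcond; apply: eq_Rintegral => x _.
by rewrite cut_densityE !patchE; case: ifP => //; rewrite normr0.
Qed.

Lemma toeplitz_density_schwartz a n : real_schwartz a ->
  rintegrable mu (fun x => a x * toeplitz_density n x) /\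
  \int[mu]_x (a x * toeplitz_density n x) =
  ((n.+1 ^ 2)%:R)^-1 / n.+1%:R * \sum_(i < n.+1 ^ 2) \sum_(j < n.+1 ^ 2)
   (al ((i%:R - j%:R) * n.+1%:R^-1) * fourier_cos a ((i%:R - j%:R) * n.+1%:R^-1) +
    be ((i%:R - j%:R) * n.+1%:R^-1) * fourier_sin a ((i%:R - j%:R) * n.+1%:R^-1)).
Proof.
move=> sa; have ia := schwartz_rintegrable0 sa 0.
pose t (i j : nat) : R := (i%:R - j%:R) * n.+1%:R^-1.
pose F i j x := al (t i j) * (a x * cos (x * t i j)) + be (t i j) * (a x * sin (x * t i j)).
have ic i j : rintegrable mu (fun x => al (t i j) * (a x * cos (x * t i j))).
  by apply: rintegrableZ; exact: rintegrable_mul_cos.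
have is_ i j : rintegrable mu (fun x => be (t i j) * (a x * sin (x * t i j))).
  by apply: rintegrableZ; exact: rintegrable_mul_sin.
have iF i j : rintegrable mu (F i j) by exact: rintegrableD.
have eF i j : \int[mu]_x F i j x =
    al (t i j) * fourier_cos a (t i j) + be (t i j) * fourier_sin a (t i j).
  rewrite RintegralD//; [|exact: ic|exact: is_].
  rewrite !RintegralZl//; [exact: rintegrable_mul_sin|exact: rintegrable_mul_cos].
have h1 (i : 'I_(n.+1 ^ 2)) := rintegrable_sum (mu := mu) (index_enum 'I_(n.+1 ^ 2))
    (f := fun (j : 'I_(n.+1 ^ 2)) x => F i j x) (fun j => iF i j).
have [h2 h3] := rintegrable_sum (mu := mu) (index_enum 'I_(n.+1 ^ 2)) (fun i => (h1 i).1).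
have -> : (fun x => a x * toeplitz_density n x) = fun x => ((n.+1 ^ 2)%:R)^-1 / n.+1%:R *
    \sum_(i < n.+1 ^ 2) \sum_(j < n.+1 ^ 2) F i j x.
  apply/funext => x; rewrite mulrCA; congr (_ * _); rewrite mulr_sumr; apply: eq_bigr => i _.
  rewrite mulr_sumr; apply: eq_bigr => j _; rewrite /F /t; ring.
split; first exact: rintegrableZ.
rewrite RintegralZl// h3; congr (_ * _); apply: eq_bigr => i _.
by rewrite (h1 i).2; apply: eq_bigr => j _; rewrite eF.
Qed.

(** For the uncut density this is [riemann_fejer], once the transform has been moved onto [a]. The
    cut costs at most [2 B] times the integral of [|x * a x|] outside the window, which tends to
    zero. *)
Lemma cut_density_cvg a : real_schwartz a ->
  (\int[mu]_x (a x * cut_density n x)) @[n --> \oo] -->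
  \int[mu]_x (al x * fourier_cos a x + be x * fourier_sin a x).
Proof.
move=> sa.
pose F x := al x * fourier_cos a x + be x * fourier_sin a x.
have cF : continuous F.
  move=> x; apply: cvgD; apply: cvgM;
    [exact: cal|exact: fourier_cos_continuous|exact: cbe|exact: fourier_sin_continuous].
have dF : decaying F.
  rewrite (_ : F = fun x => fourier_cos a x * al x + fourier_sin a x * be x); last first.
    by apply/funext => x; rewrite /F; ring.
  apply: decayingD; apply: decayingM; try eassumption.
    exact: fourier_cos_decaying.
  exact: fourier_sin_decaying.
have h1 : (\int[mu]_x (a x * toeplitz_density n x)) @[n --> \oo] --> \int[mu]_x F x.
  have := riemann_fejer cF dF.
  rewrite (_ : (fun n => _) = (fun n => \int[mu]_x (a x * toeplitz_density n x)))//.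
  by apply/funext => n; rewrite (toeplitz_density_schwartz n sa).2.
pose w n x := `|x * a x| * window (pi * n.+1%:R) x.
have ix : rintegrable mu (fun x => `|x * a x|).
  exact/rintegrable_norm/(schwartz_rintegrable 0 1 sa).
have pn n : n.+1%:R <= pi * n.+1%:R :> R.
  by apply: ler_peMl => //; have := pi_ge2 R; lra.
have mw n : measurable_fun setT (w n).
  by apply: measurable_funM; [exact: rintegrable_measurable ix|exact: measurable_window].
have iw n : rintegrable mu (w n).
  apply: (@rintegrable_le _ _ _ mu (w n) (fun x => `|x * a x|) (mw n) _ ix) => x.
  by rewrite /w normrM normr_id windowE normr_nat ler_piMr// lern1 leq_b1.
have wc : (\int[mu]_x w n x) @[n --> \oo] --> \int[mu]_x `|x * a x|.
  apply: window_rintegral => //; apply/cvgryPge => A; near=> n.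
  apply: (@le_trans _ _ n%:R); first by near: n; exact: nbhs_infty_ger.
  by apply: le_trans (pn n); rewrite ler_nat.
have d0 : (2 * B * (\int[mu]_x `|x * a x| - \int[mu]_x w n x)) @[n --> \oo] --> 0.
  rewrite -(mulr0 (2 * B)); apply: cvgMl_tmp.
  by rewrite -(subrr (\int[mu]_x `|x * a x|)); apply: cvgB => //; exact: cvg_cst.
have le n : `|\int[mu]_x (a x * toeplitz_density n x) - \int[mu]_x (a x * cut_density n x)| <=
    2 * B * (\int[mu]_x `|x * a x| - \int[mu]_x w n x).
  have ip := (toeplitz_density_schwartz n sa).1.
  have ic : rintegrable mu (fun x => a x * cut_density n x).
    rewrite (_ : (fun x => _) = fun x => a x * toeplitz_density n x * window (pi * n.+1%:R) x).
      apply: (rintegrable_mul_bounded (M := 1)) => //; first exact: measurable_window.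
      by move=> x; rewrite windowE normr_nat lern1 leq_b1.
    by apply/funext => x; rewrite mulrA.
  rewrite -RintegralB//.
  have iD : rintegrable mu (fun x => `|x * a x| - w n x).
    exact: (integrableB measurableT ix (iw n)).
  have -> : 2 * B * (\int[mu]_x `|x * a x| - \int[mu]_x w n x) =
      \int[mu]_x (2 * B * (`|x * a x| - w n x)).
    by rewrite (RintegralZl (2 * B) measurableT iD) (RintegralB measurableT ix (iw n)).
  apply: Rintegral_norm_le.
  - exact: (integrableB measurableT ip ic).
  - exact: rintegrableZ.
  move=> x; rewrite /cut_density /w windowE; case: (leP `|x| (pi * n.+1%:R)) => [_|xn].
    by rewrite /= !mulr1 !subrr normr0 mulr0.
  rewrite /= !mulr0 !subr0 normrM [X in _ <= _ * X]normrM [leRHS]mulrA [leLHS]mulrC ler_wpM2r//.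
  apply: le_trans (toeplitz_density_le n x) _; apply: ler_wpM2l.
    by apply: mulr_ge0 => //; exact: le_trans (normr_ge0 _) (alB 0).
  exact: le_trans (pn n) (ltW xn).
apply/cvgrPdist_le => e e0; near=> n.
have h2 : `|\int[mu]_x F x - \int[mu]_x (a x * toeplitz_density n x)| <= e / 2.
  by near: n; move/cvgrPdist_le : h1; apply; rewrite divr_gt0.
have h3 : `|0 - 2 * B * (\int[mu]_x `|x * a x| - \int[mu]_x w n x)| <= e / 2.
  by near: n; move/cvgrPdist_le : d0; apply; rewrite divr_gt0.
rewrite sub0r normrN in h3.
have := le_trans (ler_norm _) h3; have := le n => h4 h5.
rewrite [e]splitr; apply: le_trans (ler_distD (\int[mu]_x (a x * toeplitz_density n x)) _ _) _.
by apply: lerD => //; exact: le_trans h4 h5.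
Unshelve. all: by end_near. Qed.

End ToeplitzDensity.

(** * Helly selection *)

Section StepApproximation.
Context {R : realType}.
Implicit Types (c t a : nat -> R).

Definition step_fun c t (N : nat) (x : R) : R :=
  \sum_(i < N) c i * \1_(`]t i, t i.+1]%classic) x.

Lemma step_funP c t N x : {homo t : i j / (i <= j)%N >-> i <= j} ->
  (step_fun c t N x = 0 /\ ~~ (t 0 < x <= t N)) \/
  exists i, [/\ (i < N)%N, t i < x <= t i.+1 & step_fun c t N x = c i].
Proof.
move=> ht; elim: N => [|N IH].
  left; rewrite /step_fun big_ord0; split=> //.
  by apply/negP => /andP[h1 h2]; have := lt_le_trans h1 h2; rewrite ltxx.
rewrite /step_fun big_ord_recr /= -/(step_fun c t N x) indicE mem_setE in_itv /=.
case: (ltP (t N) x) => tx /=; last first.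
  rewrite mulr0 addr0; case: IH => [[-> nx]|[i [iN ix ->]]].
    by left; split=> //; apply: contra nx => /andP[-> _].
  by right; exists i; split=> //; exact: ltnW.
have S0 : step_fun c t N x = 0.
  case: IH => [[]//|[i [iN /andP[_ ix] _]]].
  by have := lt_le_trans tx (le_trans ix (ht _ _ iN)); rewrite ltxx.
rewrite S0 add0r; case: (leP x (t N.+1)) => xt.
  by right; exists N; split=> //=; rewrite ?tx ?xt// mulr1.
by left; rewrite mulr0; split=> //; rewrite andbF.
Qed.

(** Cells of width [1 / m.+1] take care of the Lipschitz part, the range from [- m.+1] to [m.+1] of
    the decay. The estimate is uniform in the shift [s], which is later sent to zero from the right
    to reach right limits. *)
Lemma step_approx (a : R -> R) (K : R) : (forall x y, `|a x - a y| <= K * `|x - y|) ->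
  decaying a -> forall e, 0 < e -> exists (t : nat -> R) (N : nat),
  {homo t : i j / (i <= j)%N >-> i <= j} /\
  forall s, 0 <= s <= 1 -> forall x,
    `|a x - step_fun (fun i => a (t i + s)) (fun i => t i + s) N x| <= e.
Proof.
move=> aK [L aL] e e0.
pose m := Num.truncn ((`|K| + `|L|) / e).
have me : (`|K| + `|L|) / m.+1%:R <= e.
  rewrite ler_pdivrMr ?ltr0n// mulrC -ler_pdivrMr//; apply/ltW.
  exact: truncnS_gt.
have m0 : 0 < m.+1%:R :> R by rewrite ltr0n.
pose t i : R := - m.+1%:R + i%:R / m.+1%:R.
exists t, (2 * m.+1 ^ 2)%N; split.
  by move=> i j ij; rewrite lerD2l ler_wpM2r ?invr_ge0 ?ler0n// ler_nat.
move=> s /andP[s0 s1] x.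
have ht : {homo (fun i => t i + s) : i j / (i <= j)%N >-> i <= j}.
  by move=> i j ij; rewrite lerD2r lerD2l ler_wpM2r ?invr_ge0 ?ler0n// ler_nat.
have [[-> nx]|[i [iN /andP[i1 i2] ->]]] :=
  step_funP (fun i => a (t i + s)) (2 * m.+1 ^ 2) x ht.
  rewrite subr0; apply: le_trans (aL x) _; apply: le_trans me.
  (* The shift may use up one unit of the range, hence [m] in place of [m.+1]. *)
  have xm : m%:R <= `|x|.
    rewrite leNgt; apply: contra nx; rewrite ltr_norml => /andP[x1 x2].
    rewrite /t mul0r addr0.
    have -> : (2 * m.+1 ^ 2)%:R / m.+1%:R = 2 * m.+1%:R :> R.
      by rewrite natrM natrX; field; rewrite nat1r gt_eqF.
    by rewrite -[m.+1%:R]natr1 in m0 *; apply/andP; split; lra.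
  apply: (@le_trans _ _ (`|L| / m.+1%:R)); last first.
    by rewrite ler_wpM2r ?invr_ge0 ?ler0n// lerDr.
  apply: (@le_trans _ _ (`|L| * (oneDsqr x)^-1)).
    by rewrite ler_wpM2r ?ler_norm// invr_ge0 ltW// oneDsqr_gt0.
  rewrite ler_wpM2l// lef_pV2 ?posrE ?oneDsqr_gt0// /oneDsqr -real_normK ?num_real//.
  rewrite -natr1 addrC lerD2l; apply: (@le_trans _ _ (m%:R ^+ 2)).
    by rewrite -natrX ler_nat; case: (m) => // k; rewrite expnS leq_pmulr// expn_gt0.
  by rewrite lerXn2r// nnegrE.
apply: le_trans (aK _ _) _; apply: le_trans me.
have h : `|x - (t i + s)| <= m.+1%:R^-1.
  rewrite gtr0_norm ?subr_gt0// lerBlDl (le_trans i2)// [leRHS]addrAC lerD2r /t -addrA lerD2l.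
  by rewrite -natr1 mulrDl mul1r.
apply: (@le_trans _ _ (`|K| * m.+1%:R^-1)).
  by apply: le_trans (ler_wpM2r _ (ler_norm K)) _ => //; exact: ler_wpM2l.
by rewrite ler_wpM2r ?invr_ge0 ?ler0n// lerDl.
Qed.

End StepApproximation.

Section StepIntegral.
Context {R : realType}.
Variables (mu : {measure set (measurableTypeR R) -> \bar R}) (g : R -> R) (C : R).
Hypotheses (g0 : forall x, 0 <= g x) (ig : rintegrable mu g) (gC : \int[mu]_x g x <= C).

(** The measure is left general because two cases occur: a density against Lebesgue measure, and the
    constant density [1] against the limit measure. *)
Definition cumul (t : R) : R := \int[mu]_x (g x * \1_(`]-oo, t]%classic) x).

Lemma measurable_indic_itv (i : interval R) : measurable_fun setT (\1_([set` i]) : R -> R).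
Proof. by apply: measurable_indic; exact: measurable_itv. Qed.

Lemma rintegrable_indic (i : interval R) : rintegrable mu (fun x => g x * \1_([set` i]) x).
Proof.
apply: (rintegrable_mul_bounded (M := 1) ig (measurable_indic_itv _)) => x.
by rewrite indicE normr_nat lern1 leq_b1.
Qed.

Lemma cumulB u v : u <= v ->
  \int[mu]_x (g x * \1_(`]u, v]%classic) x) = cumul v - cumul u.
Proof.
move=> uv; rewrite -RintegralB//; [|exact: rintegrable_indic|exact: rintegrable_indic].
apply: eq_Rintegral => x _; rewrite -mulrBr !indicE !mem_setE !in_itv /=; congr (_ * _).
case: (leP x u) => [xu|ux]; last by rewrite subr0.
by rewrite (le_trans xu uv) subrr.
Qed.

Lemma cumul_ge0 t : 0 <= cumul t.
Proof. by apply: Rintegral_ge0 => x _; rewrite mulr_ge0// indicE. Qed.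

Lemma cumul_le t : cumul t <= C.
Proof.
apply: le_trans gC; apply: le_Rintegral => //; first exact: rintegrable_indic.
by move=> x _; rewrite ler_piMr// indicE lern1 leq_b1.
Qed.

Lemma cumul_nd u v : u <= v -> cumul u <= cumul v.
Proof.
move=> uv; rewrite -subr_ge0 -cumulB//.
by apply: Rintegral_ge0 => x _; rewrite mulr_ge0// indicE.
Qed.

(** A uniform error [e] integrates to at most [e * C]. The approximating Stieltjes sum sees the
    density only through finitely many values of [cumul], so it survives pointwise limits. *)
Lemma step_integral (a : R -> R) c t N e : {homo t : i j / (i <= j)%N >-> i <= j} ->
  measurable_fun setT a -> (exists M, forall x, `|a x| <= M) -> 0 <= e ->
  (forall x, `|a x - step_fun c t N x| <= e) ->
  `|\int[mu]_x (a x * g x) - \sum_(i < N) c i * (cumul (t i.+1) - cumul (t i))| <= e * C.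
Proof.
move=> ht ma [M aM] e0 ae.
have iag : rintegrable mu (fun x => a x * g x).
  rewrite (_ : (fun x => _) = fun x => g x * a x); first exact: (rintegrable_mul_bounded ig ma aM).
  by apply/funext => x; rewrite mulrC.
have [h1 h2] := rintegrable_sum (mu := mu) (index_enum 'I_N)
  (f := fun (i : 'I_N) x => c i * (g x * \1_(`]t i, t i.+1]%classic) x))
  (fun i => rintegrableZ (c i) (rintegrable_indic _)).
have E : \int[mu]_x (\sum_(i < N) c i * (g x * \1_(`]t i, t i.+1]%classic) x)) =
    \sum_(i < N) c i * (cumul (t i.+1) - cumul (t i)).
  rewrite h2; apply: eq_bigr => i _; rewrite RintegralZl//; last exact: rintegrable_indic.
  by rewrite cumulB// ht.
rewrite -E -RintegralB//.
apply: (@le_trans _ _ (\int[mu]_x (e * g x))); last by rewrite RintegralZl// ler_wpM2l.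
apply: Rintegral_norm_le; [exact: (integrableB measurableT iag h1)|exact: rintegrableZ|].
move=> x.
have -> : \sum_(i < N) c i * (g x * \1_(`]t i, t i.+1]%classic) x) = step_fun c t N x * g x.
  by rewrite mulr_suml; apply: eq_bigr => i _; rewrite mulrA mulrAC.
by rewrite -mulrBl normrM (ger0_norm (g0 x)) ler_wpM2r.
Qed.

End StepIntegral.

Section UltrafilterLimit.
Context {R : realType}.

(** An ultrafilter on a compact set converges. One ultrafilter serves every bounded sequence, so all
    distribution functions converge at all points without extracting subsequences. *)
Lemma ultra_bounded_cvg (T : Type) (U : set_system T) (UU : UltraFilter U) (u : T -> R) (C : R) :
  (forall n, `|u n| <= C) -> exists l : R, u @ U --> l.
Proof.
move=> uC; have cpt : compact (`[- C, C]%classic : set R) by exact: segment_compact.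
have [|l [_ lU]] := cpt (u @ U) _.
  by apply: (@filterS _ U _ setT) filterT => n _ /=; rewrite in_itv /= -ler_norml.
exists l; move=> B /= lB; have [//|UnB] := in_ultra_setVsetC (u @^-1` B) UU.
by have [x []] := lU (~` B) B UnB lB.
Qed.

End UltrafilterLimit.

Section StieltjesMass.
Context {R : realType}.
Variables (F : R -> R) (C : R).
Hypotheses (Fnd : {homo F : x y / x <= y}) (F0 : forall x, 0 <= F x) (FC : forall x, F x <= C).

(** A pointwise limit of distribution functions is monotone but need not be right continuous; this
    regularization is, as a Stieltjes measure requires. *)
Definition right_limit (t : R) : R := inf (F @` `]t, +oo[%classic).

Let has_inf_right t : has_inf (F @` `]t, +oo[%classic).
Proof.
split; first by exists (F (t + 1)), (t + 1) => //=; rewrite in_itv /= andbT ltrDl.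
by exists 0 => _ [u _ <-].
Qed.

Lemma right_limit_le t u : t < u -> right_limit t <= F u.
Proof.
move=> tu; apply: ge_inf; first by case: (has_inf_right t).
by exists u => //=; rewrite in_itv /= andbT.
Qed.

Lemma right_limit_ge t : F t <= right_limit t.
Proof.
apply: lb_le_inf; first by case: (has_inf_right t).
by move=> _ [u /= + <-]; rewrite in_itv /= andbT => /ltW/Fnd.
Qed.

Lemma right_limit_adherent t e : 0 < e -> exists2 u, t < u & F u < right_limit t + e.
Proof.
move=> e0; have [_ [u + <-]] := inf_adherent e0 (has_inf_right t).
by rewrite /= in_itv /= andbT => tu ?; exists u.
Qed.

Lemma right_limit_nd : {homo right_limit : x y / x <= y}.
Proof.
move=> s t st; apply: lb_le_inf; first by case: (has_inf_right t).
move=> _ [u /= + <-]; rewrite in_itv /= andbT => tu.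
exact: right_limit_le (le_lt_trans st tu).
Qed.

Lemma right_limit_rc t : right_limit x @[x --> t^'+] --> right_limit t.
Proof.
apply/cvgrPdist_le => e e0; have [u tu ue] := right_limit_adherent t e0.
near=> x; rewrite distrC ger0_norm ?subr_ge0; last exact/right_limit_nd/ltW.
rewrite lerBlDl; apply: le_trans (ltW ue); apply: right_limit_le.
by near: x; exact: nbhs_right_lt.
Unshelve. all: by end_near. Qed.

Lemma right_limit_cvg (u : nat -> R) t : (forall n, 0 < u n) -> u n @[n --> \oo] --> 0 ->
  F (t + u n) @[n --> \oo] --> right_limit t.
Proof.
move=> u0 cu; apply/cvgrPdist_le => e e0; have [v tv ve] := right_limit_adherent t e0.
near=> n.
have h1 : right_limit t <= F (t + u n) by apply: right_limit_le; rewrite ltrDl.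
rewrite distrC ger0_norm ?subr_ge0// lerBlDl; apply: le_trans (ltW ve); apply: Fnd.
rewrite -lerBrDl; near: n; apply: (cvgr_le _ cu); by rewrite subr_gt0.
Unshelve. all: by end_near. Qed.

#[local] HB.instance Definition _ := isCumulative.Build R _ R right_limit
  right_limit_nd right_limit_rc.

Definition stieltjes_mass := lebesgue_stieltjes_measure right_limit.

#[local] HB.instance Definition _ := Measure.on stieltjes_mass.

Lemma stieltjes_mass_itv s t : s <= t ->
  stieltjes_mass `]s, t]%classic = (right_limit t - right_limit s)%:E.
Proof.
move=> st; rewrite /stieltjes_mass /lebesgue_stieltjes_measure /measure_extension/=.
by rewrite measurable_mu_extE/= ?wlength_itv_bnd//; exact: is_ocitv.
Qed.

Lemma stieltjes_mass_setT : (stieltjes_mass setT <= C%:E)%E.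
Proof.
have -> : setT = \bigcup_n `]- n%:R, n%:R]%classic :> set R.
  apply/esym; rewrite -subTset => x _; exists (Num.truncn `|x|).+1 => //=.
  have := truncnS_gt `|x|; rewrite in_itv /= ltr_norml => /andP[-> /ltW ->] //.
have h : stieltjes_mass `]- n%:R, n%:R]%classic @[n --> \oo] -->
    stieltjes_mass (\bigcup_n `]- n%:R, n%:R]%classic).
  apply: nondecreasing_cvg_mu => //.
  - by apply: bigcup_measurable.
  - move=> m n mn; apply/subsetPset => x /=; rewrite !in_itv /= => /andP[h1 h2].
    have mn' : m%:R <= n%:R :> R by rewrite ler_nat.
    by rewrite (le_trans h2)// (le_lt_trans _ h1)// lerN2.
apply: (cvge_to_le h); apply: nearW => n; rewrite stieltjes_mass_itv; last first.
  by have := ler0n R n; lra.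
rewrite lee_fin; apply: (@le_trans _ _ (right_limit n%:R)).
  by rewrite gerBl; exact: le_trans (F0 _) (right_limit_ge _).
by apply: le_trans (FC (n%:R + 1)); apply: right_limit_le; rewrite ltrDl.
Qed.

Let fin_mass : fin_num_fun stieltjes_mass.
Proof.
apply: lty_fin_num_fun; exact: le_lt_trans stieltjes_mass_setT (ltry _).
Qed.

#[local] HB.instance Definition _ := Measure_isFinite.Build _ _ _ stieltjes_mass fin_mass.

Lemma finite_measure_right_limit :
  exists mu : {finite_measure set (measurableTypeR R) -> \bar R}, (mu setT <= C%:E)%E /\
    forall s t, s <= t -> mu `]s, t]%classic = (right_limit t - right_limit s)%:E.
Proof.
exists stieltjes_mass; split; first exact: stieltjes_mass_setT.
exact: stieltjes_mass_itv.
Qed.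

End StieltjesMass.

Section Helly.
Context {R : realType}.
Local Notation leb := (@lebesgue_measure R).

Lemma decaying_bounded (a : R -> R) : decaying a -> exists M, forall x, `|a x| <= M.
Proof.
move=> [K aK]; exists `|K| => x; apply: le_trans (aK x) _.
apply: (@le_trans _ _ (`|K| * (oneDsqr x)^-1)).
  by rewrite ler_wpM2r ?ler_norm// invr_ge0 ltW// oneDsqr_gt0.
by rewrite ler_piMr// invf_le1 ?oneDsqr_gt0// oneDsqr_ge1.
Qed.

(** No tightness is available, so the test functions must decay; as they are also Lipschitz, a step
    function with finitely many steps approximates them uniformly on the whole line. *)
Lemma helly_ge0 (U : set_system nat) (UU : UltraFilter U) (g : nat -> R -> R) (C : R) :
  (forall n x, 0 <= g n x) -> (forall n, rintegrable leb (g n)) ->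
  (forall n, \int[leb]_x g n x <= C) ->
  exists mu : {finite_measure set (measurableTypeR R) -> \bar R},
    forall (a : R -> R) K A, (forall x y, `|a x - a y| <= K * `|x - y|) -> decaying a ->
    (\int[leb]_x (a x * g n x)) @[n --> U] --> A -> A = \int[mu]_x a x.
Proof.
move=> g0 ig gC.
have C0 : 0 <= C by apply: le_trans (gC 0%N); apply: Rintegral_ge0.
pose Fn n := cumul leb (g n).
have Fn0 n t : 0 <= Fn n t by exact: cumul_ge0.
have FnC n t : Fn n t <= C by exact: (cumul_le (g0 n) (ig n) (gC n)).
have /choice[F FE] : forall t, exists l : R, Fn n t @[n --> U] --> l.
  move=> t; apply: (ultra_bounded_cvg UU (C := C)) => n.
  by rewrite ger0_norm.
have F0 t : 0 <= F t by apply: (cvgr_to_ge (FE t)); apply: nearW.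
have FC t : F t <= C by apply: (cvgr_to_le (FE t)); apply: nearW.
have Fnd : {homo F : x y / x <= y}.
  by move=> x y xy; apply: (ler_cvg_to (FE x) (FE y)); apply: nearW => n; exact: cumul_nd.
have [mu [muT muI]] := finite_measure_right_limit Fnd F0 FC.
exists mu => a K A aK da cA.
have ca := lipschitz_continuous aK.
have ma : measurable_fun setT a by exact: continuous_measurable_fun.
have ba := decaying_bounded da.
have i1 : rintegrable mu (fun=> 1 : R).
  apply/integrableP; split; first by apply/measurable_EFinP.
  under eq_integral do rewrite /= normr1.
  by rewrite integral_cst// mul1e (le_lt_trans muT)// ltry.
have C1 : \int[mu]_x (1 : R) <= C.
  rewrite Rintegral_cst// mul1r -lee_fin fineK//.
  by apply: fin_num_measure.
have muG s t : s <= t ->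
    cumul mu (fun=> 1) t - cumul mu (fun=> 1) s = right_limit F t - right_limit F s.
  move=> st; rewrite -cumulB//; under eq_Rintegral do rewrite mul1r.
  by rewrite /Rintegral integral_indic// setIT; exact: (congr1 fine (muI _ _ st)).
have key e : 0 < e -> `|A - \int[mu]_x a x| <= 2 * (e * C).
  move=> e0; have [t [N [ht tN]]] := step_approx aK da e0.
  have hts s : {homo (fun i => t i + s) : i j / (i <= j)%N >-> i <= j}.
    by move=> i j ij; rewrite lerD2r ht.
  pose S (G : R -> R) s := \sum_(i < N) a (t i + s) * (G (t i.+1 + s) - G (t i + s)).
  (* For fixed [n] the integral is within [e * C] of a Stieltjes sum of [Fn n], a finite sum that
     passes to the limit along [U]. *)
  have h1 s : 0 <= s <= 1 -> `|A - S F s| <= e * C.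
    move=> s01.
    have cS : (\int[leb]_x (a x * g n x) - S (Fn n) s) @[n --> U] --> A - S F s.
      apply: cvgB => //; apply: cvg_big; first exact: add_continuous.
      by move=> i _; apply: cvgMl_tmp; apply: cvgB; exact: FE.
    apply: (cvgr_to_le (cvg_norm cS)); apply: nearW => n.
    exact: (step_integral (g0 n) (ig n) (gC n) (hts s) ma ba (ltW e0) (tN s s01)).
  (* [F] may differ from its right limit at jumps, so the grid points are approached from the right
     through the shifts [1 / k.+1]. *)
  have h2 : `|A - \sum_(i < N) a (t i) * (right_limit F (t i.+1) - right_limit F (t i))| <= e * C.
    pose u k : R := k.+1%:R^-1.
    have u0 k : 0 < u k by rewrite invr_gt0.
    have cu : u k @[k --> \oo] --> 0.
      by apply: (cvg_harmonic (R := R)).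
    have cS : (A - S F (u k)) @[k --> \oo] -->
        A - \sum_(i < N) a (t i) * (right_limit F (t i.+1) - right_limit F (t i)).
      apply: cvgB; first exact: cvg_cst.
      apply: cvg_big; first exact: add_continuous.
      move=> i _; apply: cvgM.
        apply: (@cvg_comp _ _ _ (fun k => t i + u k) a _ (nbhs (t i))); last exact: ca.
        have := cvgD (cvg_cst (t i)) cu; rewrite addr0; exact.
      by apply: cvgB; exact: right_limit_cvg.
    apply: (cvgr_to_le (cvg_norm cS)); apply: nearW => k; apply: h1.
    by rewrite (ltW (u0 k)) /= invf_le1// ler1n.
  (* The same estimate for the limit measure, with constant density [1] and no shift. *)
  have h3 : `|\int[mu]_x a x -
      \sum_(i < N) a (t i) * (right_limit F (t i.+1) - right_limit F (t i))| <= e * C.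
    have s0 : 0 <= (0 : R) <= 1 by rewrite lexx ler01.
    have := step_integral (fun=> ler01) i1 C1 (hts 0) ma ba (ltW e0) (tN 0 s0).
    under eq_Rintegral do rewrite mulr1.
    under eq_bigr do rewrite !addr0 muG ?ht//.
    by [].
  rewrite mulrDl mul1r; apply: le_trans (ler_distD _ _ _) (lerD h2 _).
  by rewrite distrC.
apply/eqP; rewrite -subr_eq0 -normr_le0; apply/ler_addgt0Pr => e e0.
have e1 : 0 < e / (2 * (C + 1)) by rewrite divr_gt0// mulr_gt0// ltr_wpDl.
apply: le_trans (key _ e1) _; rewrite add0r.
have -> : 2 * (e / (2 * (C + 1)) * C) = e * (C / (C + 1)).
  by field; rewrite gt_eqF// ltr_wpDl.
by rewrite ler_piMr ?(ltW e0)// ler_pdivrMr ?ltr_wpDl// mul1r lerDl.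
Qed.

End Helly.

Section SignedHelly.
Context {R : realType}.
Local Notation leb := (@lebesgue_measure R).

(** Positive and negative parts need not converge along [\oo] separately. Both are followed along
    one finer ultrafilter, where the assumed limit [A] persists and equals the difference of
    theirs. *)
Lemma helly (g : nat -> R -> R) (C : R) :
  (forall n, rintegrable leb (g n)) -> (forall n, \int[leb]_x `|g n x| <= C) ->
  exists mu1 mu2 : {finite_measure set (measurableTypeR R) -> \bar R},
    forall (a : R -> R) K A, (forall x y, `|a x - a y| <= K * `|x - y|) -> decaying a ->
    (\int[leb]_x (a x * g n x)) @[n --> \oo] --> A ->
    A = \int[mu1]_x a x - \int[mu2]_x a x.
Proof.
move=> ig gC; have [U [UU oU]] := ultraFilterLemma (F := \oo) _.
(* [s = 1] gives the positive part of [g n], [s = -1] the negative part. *)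
pose gp s n x := 2^-1 * (`|g n x| + s * g n x).
have ign n : rintegrable leb (fun x => `|g n x|) by exact: rintegrable_norm.
have igp s n : rintegrable leb (gp s n).
  by apply: rintegrableZ; apply: rintegrableD => //; exact: rintegrableZ.
have gp0 s n x : `|s| <= 1 -> 0 <= gp s n x.
  move=> s1; have h : `|s * g n x| <= `|g n x| by rewrite normrM ler_piMl.
  apply: mulr_ge0 => //; have := ler_norm (- (s * g n x)); rewrite normrN; lra.
have gple s n x : `|s| <= 1 -> gp s n x <= `|g n x|.
  move=> s1; rewrite ler_pdivrMl// mulr_natl mulr2n lerD2l.
  by apply: le_trans (ler_norm _) _; rewrite normrM ler_piMl.
have gpC s n : `|s| <= 1 -> \int[leb]_x gp s n x <= C.
  move=> s1; apply: le_trans (gC n).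
  by apply: (le_Rintegral measurableT (igp s n) (ign n)) => x _; exact: gple.
have n1 : `|1 : R| <= 1 by rewrite normr1.
have nN1 : `|-1 : R| <= 1 by rewrite normrN1.
have [mu1 h1] := helly_ge0 UU (fun n x => gp0 _ n x n1) (igp 1) (gpC 1 ^~ n1).
have [mu2 h2] := helly_ge0 UU (fun n x => gp0 _ n x nN1) (igp (-1)) (gpC (-1) ^~ nN1).
exists mu1, mu2 => a K A aK da cA.
have [M aM] := decaying_bounded da.
have ma : measurable_fun setT a.
  exact: (continuous_measurable_fun (lipschitz_continuous aK)).
have iag s n : rintegrable leb (fun x => a x * gp s n x).
  rewrite (_ : (fun x => _) = fun x => gp s n x * a x).
    exact: (rintegrable_mul_bounded (igp s n) ma aM).
  by apply/funext => x; rewrite mulrC.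
have cvgU s : `|s| <= 1 -> exists l : R, (\int[leb]_x (a x * gp s n x)) @[n --> U] --> l.
  move=> s1; apply: (ultra_bounded_cvg UU (C := `|M| * C)) => n.
  apply: le_trans (ler_wpM2l (normr_ge0 M) (gpC s n s1)).
  have <- : \int[leb]_x (`|M| * gp s n x) = `|M| * \int[leb]_x gp s n x.
    exact: (RintegralZl _ measurableT (igp s n)).
  apply: (Rintegral_norm_le (iag s n) (rintegrableZ `|M| (igp s n))).
  move=> x; rewrite normrM (ger0_norm (gp0 s n x s1)) ler_wpM2r ?gp0//.
  exact: le_trans (aM x) (ler_norm _).
have [A1 c1] := cvgU 1 n1; have [A2 c2] := cvgU (-1) nN1.
rewrite -(h1 a K A1 aK da c1) -(h2 a K A2 aK da c2).
have cAU : (\int[leb]_x (a x * g n x)) @[n --> U] --> A by move=> B /cA; exact: oU.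
apply: (cvg_unique _ cAU) => //.
rewrite (_ : (fun n => \int[leb]_x (a x * g n x)) =
  (fun n => \int[leb]_x (a x * gp 1 n x) - \int[leb]_x (a x * gp (-1) n x))).
  exact: cvgB.
apply/funext => n.
have <- := RintegralB measurableT (iag 1 n) (iag (-1) n).
by apply: eq_Rintegral => x _; rewrite /gp; field.
Qed.
End SignedHelly.

(** * Charges and the Fourier distribution *)

Section ChargeIntegral.
Context d (T : measurableType d) {R : realType}.

Lemma bounded_rintegrable (mu : {finite_measure set T -> \bar R}) (a : T -> R) (M : R) :
  measurable_fun setT a -> (forall x, `|a x| <= M) -> rintegrable mu a.
Proof.
move=> ma aM; have i1 : rintegrable mu (fun=> 1 : R).
  apply/integrableP; split; first by apply/measurable_EFinP.
  under eq_integral do rewrite /= normr1.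
  by rewrite integral_cst// mul1e; exact/fin_num_fun_lty/fin_num_measure.
have := rintegrable_mul_bounded i1 ma aM.
by under [X in rintegrable mu X]funext do rewrite mul1r.
Qed.

Lemma Rintegral_measure_add (m1 m2 : {measure set T -> \bar R}) (a : T -> R) :
  rintegrable m1 a -> rintegrable m2 a ->
  \int[measure_add m1 m2]_x a x = \int[m1]_x a x + \int[m2]_x a x.
Proof.
move=> i1 i2; rewrite /Rintegral integral_measure_add//.
by rewrite fineD//; exact: integrable_fin_num.
Qed.

(** [charge_integral] goes through a chosen Hahn decomposition. Whatever the choice, the Jordan
    parts satisfy [jp + mu2 = jn + mu1] on measurable sets, an equality of positive measures that
    can be integrated. *)
Lemma charge_integral_sub (mu1 mu2 : {finite_measure set T -> \bar R}) (a : T -> R) (M : R) :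
  measurable_fun setT a -> (forall x, `|a x| <= M) ->
  charge_integral (cadd (charge_of_finite_measure mu1) (copp (charge_of_finite_measure mu2))) a =
  \int[mu1]_x a x - \int[mu2]_x a x.
Proof.
have G (x y z w : \bar R) : x \is a fin_num -> y \is a fin_num -> z \is a fin_num ->
    w \is a fin_num -> (x - y = z - w -> z + y = w + x)%E.
  move: x y z w => [x| |] [y| |] [z| |] [w| |] //= _ _ _ _ [h].
  by rewrite -!EFinD; congr (_%:E); lra.
have alg (x y z w : R) : x + y = z + w -> x - z = w - y by lra.
move=> ma aM; set nu := cadd _ _; rewrite /charge_integral.
set hP := cid _; set hN := cid _.
have im (mu : {finite_measure set T -> \bar R}) := bounded_rintegrable mu ma aM.
set jp := jordan_pos _; set jn := jordan_neg _.
have E : \int[measure_add jp mu2]_x a x = \int[measure_add jn mu1]_x a x.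
  congr fine; apply: eq_measure_integral => A mA _.
  apply: (eq_trans (measure_addE jp mu2 A)); apply: (eq_trans _ (esym (measure_addE jn mu1 A))).
  have : (mu1 A - mu2 A)%E = (jp A - jn A)%E.
    transitivity (cadd jp (cscale (-1) jn) A); first exact: (jordan_decomp (projT2 hN) mA).
    by rewrite /cadd /= cscaleN1.
  by apply: G; exact: fin_num_measure.
rewrite !Rintegral_measure_add// in E; try exact: im.
exact: alg.
Qed.

End ChargeIntegral.

Section FiniteMeasureLine.
Context {R : realType}.
Variable mu : {finite_measure set (measurableTypeR R) -> \bar R}.

(* The measurable structure of [R] itself and that of [measurableTypeR R] have the same
   measurable sets but carry different displays. *)
Definition line_measure : set R -> \bar R := mu.

Let line_measure0 : line_measure set0 = 0%E. Proof. exact: (measure0 mu). Qed.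
Let line_measure_ge0 A : (0 <= line_measure A)%E. Proof. exact: (measure_ge0 mu). Qed.
Let line_measure_sigma : semi_sigma_additive line_measure.
Proof. exact: (@measure_semi_sigma_additive _ _ _ mu). Qed.

HB.instance Definition _ := isMeasure.Build _ _ _ line_measure
  line_measure0 line_measure_ge0 line_measure_sigma.

Let line_measure_fin : fin_num_fun line_measure.
Proof. by move=> A mA; exact: (@fin_num_measure _ _ _ mu A mA). Qed.

HB.instance Definition _ := Measure_isFinite.Build _ _ _ line_measure line_measure_fin.

Lemma Rintegral_line_measure (a : R -> R) (M : R) :
  measurable_fun setT (a : measurableTypeR R -> R) -> (forall x, `|a x| <= M) ->
  \int[line_measure]_x a x = \int[mu]_x a x.
Proof.
move=> ma aM.
have mid : measurable_fun setT (idfun : measurableTypeR R -> R) by move=> _ Y mY; rewrite setTI.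
have ia : mu.-integrable setT (EFin \o a) := bounded_rintegrable mu ma aM.
rewrite /Rintegral; congr fine.
have maR : measurable_fun setT (a : R -> R) by move=> _ Y mY; exact: (ma measurableT Y mY).
have maE : measurable_fun setT (EFin \o (a : R -> R)) by exact/measurable_EFinP.
exact: (integral_pushforward mid maE ia measurableT).
Qed.

End FiniteMeasureLine.

(** * A charge representing the real part of the distribution *)

Section RepresentingMeasure.
Context {R : realType}.
Local Notation mu := (@lebesgue_measure R).

Lemma real_schwartz_lipschitz (a : R -> R) : real_schwartz a ->
  exists K, forall x y, `|a x - a y| <= K * `|x - y|.
Proof.
move=> sa; have [K aK] := decaying_bounded (schwartz_decaying0 1 sa).
exists K; apply: lipschitz_of_derive aK => x.
exact: (smooth_is_derive 0 x sa.1).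
Qed.

(** For real [a] this is the real part of the Fourier distribution of [al + i be]; the imaginary
    part is the same expression for [be] and [- al]. *)
Definition real_distribution (al be : R -> R) (a : R -> R) : R :=
  \int[mu]_x (al x * fourier_cos a x + be x * fourier_sin a x).

Lemma real_distribution_charge (al be : R -> R) (B M : R) :
  continuous al -> continuous be ->
  (forall x, `|al x| <= B) -> (forall x, `|be x| <= B) ->
  (forall (N : nat) (delta eta : R), (0 < N)%N -> 0 < delta ->
    \sum_(m < N) normc (toeplitz_mean (fun r => al r +i* be r) N delta
      (eta + m%:R * (pi *+ 2) / (N%:R * delta))) <= M) ->
  exists nu : {charge set R -> \bar R}, forall a, real_schwartz a ->
    charge_integral nu a = real_distribution al be a.
Proof.
move=> cal cbe alB beB hM.
have [mu1 [mu2 H]] := helly (cut_density_rintegrable al be) (cut_density_L1 hM).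
exists (cadd (charge_of_finite_measure (line_measure mu1))
             (copp (charge_of_finite_measure (line_measure mu2)))) => a sa.
have [K aK] := real_schwartz_lipschitz sa.
have [L aL] := decaying_bounded (schwartz_decaying0 0 sa).
have ma := continuous_measurable_fun (lipschitz_continuous aK).
rewrite (charge_integral_sub (line_measure mu1) (line_measure mu2) ma aL).
rewrite !(Rintegral_line_measure _ (ma : measurable_fun setT (a : measurableTypeR R -> R)) aL).
apply/esym/(H a K) => //; first exact: (schwartz_decaying0 0 sa).
exact: (cut_density_cvg cal cbe alB beB).
Qed.

End RepresentingMeasure.

(** * The Fourier distribution and its dependence on the representative *)

Section FourierDistribution.
Context {R : realType}.
Local Notation mu := (@lebesgue_measure R).
Implicit Types (phi h g : R -> R[i]).

Lemma Re_fourier phi xi : schwartz phi -> complex.Re (fourier phi xi) =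
  fourier_cos (fun x => complex.Re (phi x)) xi + fourier_sin (fun x => complex.Im (phi x)) xi.
Proof.
move=> [[s1 s2] d1 d2]; rewrite /fourier /cintegral /=.
have i1 := schwartz_rintegrable0 (conj s1 d1 : real_schwartz _) 0.
have i2 := schwartz_rintegrable0 (conj s2 d2 : real_schwartz _) 0.
rewrite -(RintegralD measurableT (rintegrable_mul_cos xi i1) (rintegrable_mul_sin xi i2)).
by apply: eq_Rintegral => x _ /=; case: (phi x) => a b /=; ring.
Qed.

Lemma Im_fourier phi xi : schwartz phi -> complex.Im (fourier phi xi) =
  fourier_cos (fun x => complex.Im (phi x)) xi - fourier_sin (fun x => complex.Re (phi x)) xi.
Proof.
move=> [[s1 s2] d1 d2]; rewrite /fourier /cintegral /=.
have i1 := schwartz_rintegrable0 (conj s1 d1 : real_schwartz _) 0.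
have i2 := schwartz_rintegrable0 (conj s2 d2 : real_schwartz _) 0.
rewrite -(RintegralB measurableT (rintegrable_mul_cos xi i2) (rintegrable_mul_sin xi i1)).
by apply: eq_Rintegral => x _ /=; case: (phi x) => a b /=; ring.
Qed.

Lemma cmeasurable_fourier phi : schwartz phi -> cmeasurable (fourier phi).
Proof.
move=> sp; have [[s1 s2] d1 d2] := sp.
have r1 : real_schwartz (fun x => complex.Re (phi x)) by [].
have r2 : real_schwartz (fun x => complex.Im (phi x)) by [].
split.
  have -> : (fun xi => complex.Re (fourier phi xi)) = fun xi =>
      fourier_cos (fun x => complex.Re (phi x)) xi + fourier_sin (fun x => complex.Im (phi x)) xi.
    by apply/funext => xi; exact: Re_fourier.
  apply: measurable_funD; apply: continuous_measurable_fun.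
    exact: (fourier_cos_continuous r1).
  exact: (fourier_sin_continuous r2).
have -> : (fun xi => complex.Im (fourier phi xi)) = fun xi =>
    fourier_cos (fun x => complex.Im (phi x)) xi - fourier_sin (fun x => complex.Re (phi x)) xi.
  by apply/funext => xi; exact: Im_fourier.
apply: measurable_funB; apply: continuous_measurable_fun.
  exact: (fourier_cos_continuous r2).
exact: (fourier_sin_continuous r1).
Qed.

Lemma cmeasurableM g h : cmeasurable g -> cmeasurable h -> cmeasurable (fun x => g x * h x).
Proof.
move=> [g1 g2] [h1 h2]; split.
  rewrite (_ : (fun x => _) = fun x =>
    complex.Re (g x) * complex.Re (h x) - complex.Im (g x) * complex.Im (h x)).
    by apply: measurable_funB; exact: measurable_funM.
  by apply/funext => x; case: (g x) (h x) => [a b] [c d].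
rewrite (_ : (fun x => _) = fun x =>
    complex.Re (g x) * complex.Im (h x) + complex.Im (g x) * complex.Re (h x)).
  by apply: measurable_funD; exact: measurable_funM.
by apply/funext => x; case: (g x) (h x) => [a b] [c d].
Qed.

Lemma ae_eq_Rintegral (u v : R -> R) : measurable_fun setT u -> measurable_fun setT v ->
  {ae mu, forall x, u x = v x} -> \int[mu]_x u x = \int[mu]_x v x.
Proof.
move=> mu_ mv uv; congr fine; apply: ae_eq_integral => //; try exact/measurable_EFinP.
apply: filterS uv => [|x -> _ //]; exact: (ae_filter_ringOfSetsType mu).
Qed.

Lemma fourier_distribution_ae g h phi : cmeasurable g -> cmeasurable h ->
  {ae mu, forall x, h x = g x} -> schwartz phi ->
  fourier_distribution g phi = fourier_distribution h phi.
Proof.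
move=> mg mh hg sp.
have [g1 g2] := cmeasurableM mg (cmeasurable_fourier sp).
have [h1 h2] := cmeasurableM mh (cmeasurable_fourier sp).
rewrite /fourier_distribution /cintegral; congr (_ +i* _); apply: ae_eq_Rintegral => //;
  (apply: filterS hg => [|x -> //]; exact: (ae_filter_ringOfSetsType mu)).
Qed.

End FourierDistribution.

Section ToeplitzFourier.
Context {R : realType}.
Local Notation mu := (@lebesgue_measure R).

Lemma rintegrable_real_distribution (al be a : R -> R) (B : R) :
  continuous al -> continuous be -> (forall x, `|al x| <= B) -> (forall x, `|be x| <= B) ->
  real_schwartz a ->
  rintegrable mu (fun x => al x * fourier_cos a x + be x * fourier_sin a x).
Proof.
move=> cal cbe alB beB sa.
have H (v w : R -> R) : continuous v -> (forall x, `|v x| <= B) -> continuous w -> decaying w ->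
    rintegrable mu (fun x => v x * w x).
  move=> cv vB cw dw; rewrite (_ : (fun x => v x * w x) = fun x => w x * v x); last first.
    by apply/funext => x; rewrite mulrC.
  have iw := decaying_rintegrable (continuous_measurable_fun cw) dw.
  exact: (rintegrable_mul_bounded iw (continuous_measurable_fun cv) vB).
apply: rintegrableD; apply: H => //.
- exact: (fourier_cos_continuous sa).
- exact: fourier_cos_decaying.
- exact: (fourier_sin_continuous sa).
- exact: fourier_sin_decaying.
Qed.

(** Multiplying [h] by [- i] does not change the size of its Toeplitz means, so the bound also holds
    for the function that yields the imaginary part of the distribution. *)
Lemma toeplitz_mean_rotate (h : R -> R[i]) N delta xi :
  toeplitz_mean (fun r => complex.Im (h r) +i* - complex.Re (h r)) N delta xi =
  (0 -i* 1) * toeplitz_mean h N delta xi.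
Proof.
rewrite /toeplitz_mean mulrCA; congr (_ * _).
rewrite mulr_sumr; apply: eq_bigr => i _; rewrite mulr_sumr; apply: eq_bigr => j _.
rewrite mulrA; congr (_ * _); case: (h _) => a b /=.
by apply/eqP; rewrite eq_complex /=; apply/andP; split; apply/eqP; ring.
Qed.

(** On real test functions [nu1] represents the real part of the distribution and [nu2], obtained
    from [- i h], the imaginary part. Splitting [phi] into real and imaginary parts gives the
    general case. *)
Lemma toeplitz_bound_is_complex_measure (h : R -> R[i]) (B M : R) :
  continuous (fun x => complex.Re (h x)) -> continuous (fun x => complex.Im (h x)) ->
  (forall x, normc (h x) <= B) ->
  (forall (N : nat) (delta eta : R), (0 < N)%N -> 0 < delta ->
    \sum_(m < N) normc (toeplitz_mean h N delta
      (eta + m%:R * (pi *+ 2) / (N%:R * delta))) <= M) ->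
  is_complex_measure (fourier_distribution h).
Proof.
pose al x := complex.Re (h x); pose be x := complex.Im (h x).
move=> cal cbe hB hM.
have alB x : `|al x| <= B by exact: le_trans (ler_Re_normc _) (hB x).
have beB x : `|be x| <= B by exact: le_trans (ler_Im_normc _) (hB x).
have cN : continuous (fun x => - al x) by move=> x; apply: cvgN; exact: cal.
have NB x : `|- al x| <= B by rewrite normrN.
have hE : h = fun r => al r +i* be r by apply/funext => r; rewrite /al /be; case: (h r).
have [|nu1 h1] := real_distribution_charge cal cbe alB beB (M := M).
  by rewrite -/al -/be -hE.
have [|nu2 h2] := real_distribution_charge cbe cN beB NB (M := M).
  move=> N delta eta N0 d0; apply: le_trans (hM N delta eta N0 d0).
  rewrite le_eqVlt; apply/orP; left; apply/eqP; apply: eq_bigr => m _.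
  rewrite toeplitz_mean_rotate normcM; rewrite /normc /= expr0n /= add0r sqrrN expr1n sqrtr1.
  by rewrite mul1r.
exists nu1, nu2 => phi sp; have [[s1 s2] d1 d2] := sp.
have r1 : real_schwartz (fun x => complex.Re (phi x)) by [].
have r2 : real_schwartz (fun x => complex.Im (phi x)) by [].
rewrite /complex_measure_integral !h1// !h2// /fourier_distribution /cintegral /real_distribution.
congr (_ +i* _).
- rewrite -RintegralB//.
  + apply: eq_Rintegral => x _ /=; move: (Re_fourier x sp) (Im_fourier x sp).
    by rewrite /al /be; case: (fourier phi x) (h x) => [p q] [u v] /= -> ->; ring.
  + exact: (rintegrable_real_distribution cal cbe alB beB).
  + exact: (rintegrable_real_distribution cbe cN beB NB).
- rewrite -RintegralD//.
  + apply: eq_Rintegral => x _ /=; move: (Re_fourier x sp) (Im_fourier x sp).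
    by rewrite /al /be; case: (fourier phi x) (h x) => [p q] [u v] /= -> ->; ring.
  + exact: (rintegrable_real_distribution cal cbe alB beB).
  + exact: (rintegrable_real_distribution cbe cN beB NB).
Qed.

Lemma divided_difference2_sin (f : R * R * R -> R[i]) (h : R -> R[i])
    (f_def : forall x1 x2 x3 : R, f (x1, x2, x3) = h (x1 - x3) * (sin x2)%:C) (r s : R) :
  divided_difference2 f ((r, 0, r), (s, 0, s)) = h (s - r).
Proof.
rewrite /divided_difference2 eqxx /cderive.
have dsin (c : R) : derive1 (fun t : R => c * sin t) 0 = c.
  have h0 : is_derive (0 : R) 1 (c *: sin : R -> R) (c *: cos 0) by exact: is_deriveZ.
  by rewrite derive1E; case: h0 => _ ->; rewrite cos0 /GRing.scale /= mulr1.
have E u : f (s, u, r) = h (s - r) * (sin u)%:C := f_def s u r.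
case: (h (s - r)) E => a b E.
have -> : (fun t => complex.Re (f (s, t, r))) = fun t => a * sin t.
  by apply/funext => t; rewrite E /= mulr0 subr0.
have -> : (fun t => complex.Im (f (s, t, r))) = fun t => b * sin t.
  by apply/funext => t; rewrite E /= mulr0 add0r.
by rewrite !dsin.
Qed.

End ToeplitzFourier.

(* g is the bounded function as an element of L^infinity, h is its smooth
   representative. *)
Theorem theorem1p1 (R : realType) (g h : R -> R[i])
    (g_measurable : cmeasurable g) (g_bounded : cbounded g)
    (g_spectrum : compact (distribution_support (fourier_distribution g)))
    (g_not_measure : ~ is_complex_measure (fourier_distribution g))
    (h_smooth : csmooth h)
    (h_represents_g : {ae (@lebesgue_measure R), forall x, h x = g x})
    (f : R * R * R -> R[i])
    (f_def : forall x1 x2 x3 : R, f (x1, x2, x3) = h (x1 - x3) * (sin x2)%:C) :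
  ~ schur_multipliers R (R * R * R)%type (R * R * R)%type
      (divided_difference2 f).
Proof.
move=> schurf; apply: g_not_measure.
have dd (r s : R) : divided_difference2 f ((r, 0, r), (s, 0, s)) = h (s - r).
  exact: divided_difference2_sin.
have [M hM] := toeplitz_bound (X := (R * R * R)%type) (t := fun r : R => (r, 0, r)) schurf dd.
have [_ [B fB] _] := schurf.
(* The bound on [h] is inherited from the multiplier, evaluated at points with [r = 0]. *)
have hB x : normc (h x) <= B.
  by have := fB ((0, 0, 0), (x, 0, x)); rewrite dd subr0 normcE' lecR.
have [h1 h2] := h_smooth.
have c1 : continuous (fun x => complex.Re (h x)) by exact: (@smooth_continuous _ _ 0 h1).
have c2 : continuous (fun x => complex.Im (h x)) by exact: (@smooth_continuous _ _ 0 h2).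
have mh : cmeasurable h by split; exact: continuous_measurable_fun.
have [nu1 [nu2 H]] := toeplitz_bound_is_complex_measure c1 c2 hB hM.
(* The charges found for the continuous [h] also serve [g], whose distribution depends only on its
   almost everywhere class. *)
exists nu1, nu2 => phi sp; rewrite -H//.
exact: fourier_distribution_ae.
Qed.
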